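(* Let $n\ge 2$ and let $f$ be a positive Lipschitz continuous function on the unit sphere $\mathbb{S}^n\subset\mathbb{R}^{n+1}$. Extend $f$ to $\mathbb{R}^{n+1}\setminus\{0\}$ as a function homogeneous of degree $-1$ (still denoted $f$). Let $u$ be a solution of $$\Delta_{\mathbb{S}^n}u+nu=f\quad\text{on }\mathbb{S}^n ,$$ extended to $\mathbb{R}^{n+1}$ as a function homogeneous of degree $1$ (so that $\Delta u=f$ on $\mathbb{R}^{n+1}$). Then $u$ is convex if and only if for every $x\in\mathbb{S}^n$ and every unit vector $\xi\in\mathbb{R}^{n+1}$ with $\xi\perp x$, $$\int_{\mathbb{R}^{n+1}}\frac{-\langle\xi,y\rangle\, f_\xi(y)}{|x-y|^{n+1}}\,dy\ \ge\ 0 .$$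
   Context: $\Delta_{\mathbb{S}^n}$ is the Laplace–Beltrami operator on the unit sphere $\mathbb{S}^n$, and $\Delta$ is the Euclidean Laplacian on $\mathbb{R}^{n+1}$. $f_\xi(y)=\langle Df(y),\xi\rangle$ denotes the derivative of the extended function $f$ at $y\in\mathbb{R}^{n+1}$ in direction $\xi$ (it exists for almost every $y$ since $f$ is locally Lipschitz away from $0$). The solution $u$ is convex if its degree-one homogeneous extension is a convex function on $\mathbb{R}^{n+1}$; equivalently, the matrix $\nabla^2u+uI$ is positive semidefinite at every point of $\mathbb{S}^n$, where $\nabla$ is the covariant derivative with respect to a local orthonormal frame on $\mathbb{S}^n$. The equation $\Delta u=f$ on $\mathbb{R}^{n+1}$ is understood in the weak sense ($u\in W^{2,q}_{loc}(\mathbb{R}^{n+1})$ for $q\in(1,n)$), as $u$ and $f$ may be singular at $0$. *)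

(* Defs.v *)
From HB Require Import structures.
From mathcomp Require Import all_boot all_order all_algebra.
From mathcomp Require Import all_classical all_reals all_analysis.

Set Implicit Arguments.
Unset Strict Implicit.
Unset Printing Implicit Defensive.

Import Order.TTheory GRing.Theory Num.Theory.
Import numFieldNormedType.Exports.

Local Open Scope classical_set_scope.
Local Open Scope ring_scope.

(* The library norm on 'rV[R]_m is the sup norm, so the Euclidean structure is
   introduced by hand; both norms induce the same topology. *)
Definition dotp (R : realType) (m : nat) (x y : 'rV[R]_m) : R :=
  \sum_(i < m) x ord0 i * y ord0 i.

Definition enorm (R : realType) (m : nat) (x : 'rV[R]_m) : R :=
  Num.sqrt (dotp x x).

Definition usphere (R : realType) (m : nat) : set 'rV[R]_m :=
  [set x | enorm x = 1].

(* Functions on the sphere are represented by functions on the ambient space of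
   which only the values on [usphere] are ever used: every notion below depends
   on g through its restriction to the sphere.  For k <> 0 the value of
   [hext k g] at the origin is 0, as 0 ^ k = 0 (also for negative k). *)
Definition hext (R : realType) (m : nat) (k : int) (g : 'rV[R]_m -> R)
    (y : 'rV[R]_m) : R :=
  enorm y ^ k * g ((enorm y)^-1 *: y).

Definition lipschitz_sphere (R : realType) (m : nat) (g : 'rV[R]_m -> R) :
    Prop :=
  exists L : R, forall x y : 'rV[R]_m, usphere x -> usphere y ->
    `|g x - g y| <= L * enorm (x - y).

Definition partial (R : realType) (m : nat) (i : 'I_m) (g : 'rV[R]_m -> R)
    (y : 'rV[R]_m) : R :=
  'D_(delta_mx ord0 i) g y.

Definition C1_off0 (R : realType) (m : nat) (g : 'rV[R]_m -> R) : Prop :=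
  forall (i : 'I_m) (y : 'rV[R]_m), y != 0 ->
    derivable g y (delta_mx ord0 i) /\ {for y, continuous (partial i g)}.

Definition C2_off0 (R : realType) (m : nat) (g : 'rV[R]_m -> R) : Prop :=
  C1_off0 g /\ forall i : 'I_m, C1_off0 (partial i g).

(* y |-> y / |y| is a smooth retraction of the punctured space onto the sphere,
   so g is C^2 on the sphere iff its degree-0 extension is C^2 off the origin. *)
Definition C2_sphere (R : realType) (m : nat) (g : 'rV[R]_m -> R) : Prop :=
  C2_off0 (hext 0 g).

(* The Laplace-Beltrami operator is div o grad for the metric induced by the
   Euclidean one.  The degree-0 extension has zero radial derivative, hence its
   Euclidean gradient at x is tangent to the sphere and is the Riemannian
   gradient. *)
Definition sphere_grad (R : realType) (m : nat) (g : 'rV[R]_m -> R)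
    (x : 'rV[R]_m) : 'rV[R]_m :=
  \row_(i < m) partial i (hext 0 g) x.

(* The Riemannian divergence of a tangent field X is the trace over the tangent
   space of v |-> <D_v X, v>.  Extending the components of X by degree 0 makes
   the radial direction contribute 0, so it is also the trace over R^m. *)
Definition sphere_div (R : realType) (m : nat) (X : 'rV[R]_m -> 'rV[R]_m)
    (x : 'rV[R]_m) : R :=
  \sum_(i < m) partial i (hext 0 (fun z => X z ord0 i)) x.

Definition laplace_beltrami (R : realType) (m : nat) (g : 'rV[R]_m -> R) :
    'rV[R]_m -> R :=
  sphere_div (sphere_grad g).

(* Lebesgue measure on R^m, for the product sigma-algebra on m-tuples. *)
Fixpoint lebesgue_tuple (R : realType) (m : nat) :
    set (m.-tuple (measurableTypeR R)) -> \bar R :=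
  match m with
  | 0 => \d_([tuple] : 0.-tuple (measurableTypeR R))
  | m'.+1 =>
      pushforward (product_measure1 (@lebesgue_measure R) (@lebesgue_tuple R m'))
        (fun p : measurableTypeR R * m'.-tuple (measurableTypeR R) =>
           [tuple of p.1 :: p.2])
  end.

Section lebesgue_tuple_measure.
Variables (R : realType) (m : nat).
Variable mu : {sigma_finite_measure set (m.-tuple (measurableTypeR R)) -> \bar R}.

Let c := fun p : measurableTypeR R * m.-tuple (measurableTypeR R) =>
  [tuple of p.1 :: p.2].
Let d := fun t : m.+1.-tuple (measurableTypeR R) =>
  (thead t, [tuple of behead t]).

Let measurable_c : measurable_fun setT c.
Proof. exact: (@measurable_cons _ _ _ _ fst m snd). Qed.

Let measurable_d : measurable_fun setT d.
Proof.
by apply: measurable_fun_pair; [exact: measurable_tnth|exact: measurable_behead].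
Qed.

Let cK : cancel c d.
Proof. by move=> [a t]; congr pair; apply/val_inj. Qed.

Definition cons_measure :=
  pushforward (product_measure1 (@lebesgue_measure R) mu) c.

HB.instance Definition _ := Measure.copy cons_measure
  (measure_function_pushforward__canonical__measure_function_Measure
     (product_measure1 (@lebesgue_measure R) mu) measurable_c).

Let cons_measure_sigma_finite : sigma_finite setT cons_measure.
Proof.
have /sigma_finiteP[F [TF ndF Foo]] := sigma_finiteT (@lebesgue_measure R).
have /sigma_finiteP[G [TG ndG Goo]] := sigma_finiteT mu.
exists (fun i => d @^-1` (F i `*` G i)).
  rewrite -preimage_bigcup -[LHS](preimage_setT d); congr (_ @^-1` _).
  apply/seteqP; split => // -[x y] _.
  have [i _ Fx] : (\bigcup_i F i) x by rewrite -TF.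
  have [j _ Gy] : (\bigcup_i G i) y by rewrite -TG.
  exists (maxn i j) => //; split.
    by move: x Fx; exact/subsetPset/ndF/leq_maxl.
  by move: y Gy; exact/subsetPset/ndG/leq_maxr.
move=> k; have [mF Fk] := Foo k; have [mG Gk] := Goo k; split.
  by rewrite -[X in measurable X]setTI; apply: measurable_d => //; exact: measurableX.
rewrite /cons_measure /pushforward -comp_preimage.
rewrite (_ : d \o c = id) ?preimage_id; last by apply/funext => p; exact: cK.
by rewrite product_measure1E// lte_mul_pinfty// ge0_fin_numE.
Qed.

HB.instance Definition _ := @Measure_isSigmaFinite.Build _ _ _
  cons_measure cons_measure_sigma_finite.

End lebesgue_tuple_measure.

Lemma lebesgue_tuple_sigma_finite (R : realType) (m : nat) :
  exists mu : {sigma_finite_measure set (m.-tuple (measurableTypeR R)) -> \bar R},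
    @lebesgue_tuple R m = mu.
Proof.
elim: m => [|m [mu muE]].
  by exists [the sigma_finite_measure _ _ of
    \d_([tuple] : 0.-tuple (measurableTypeR R))].
by exists [the sigma_finite_measure _ _ of cons_measure mu] => /=; rewrite muE.
Qed.

Lemma lebesgue_tuple_box (R : realType) (m : nat)
    (A : 'I_m -> set (measurableTypeR R)) : (forall i, measurable (A i)) ->
  (@lebesgue_tuple R m [set t | forall i, A i (tnth t i)] =
   \prod_(i < m) @lebesgue_measure R (A i))%E.
Proof.
elim: m A => [|m IH] A mA.
  rewrite big_ord0 /= diracE mem_set//; by case.
have [mu muE] := lebesgue_tuple_sigma_finite R m.
rewrite big_ord_recl -IH; last by move=> i; exact: mA.
rewrite /= /pushforward muE.
pose B : set (m.-tuple (measurableTypeR R)) :=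
  [set t | forall i, A (lift ord0 i) (tnth t i)].
rewrite -/B.
have mB : measurable B.
  rewrite (_ : B = \bigcap_(i in [set: 'I_m]) ((@tnth _ _)^~ i @^-1` A (lift ord0 i))).
    apply: fin_bigcap_measurable => // i _.
    by rewrite -[X in measurable X]setTI; exact: measurable_tnth.
  by apply/seteqP; split => t /= tB i; [move=> _|]; exact: tB.
rewrite -product_measure1E//; congr product_measure1.
apply/seteqP; split => -[a t] /=.
  move=> At; split; first exact: (At ord0).
  by move=> i; have := At (lift ord0 i); rewrite tnthS.
move=> [Aa tB] i; case: (unliftP ord0 i) => [j ->|->]//.
by rewrite tnthS; exact: tB.
Qed.

Definition integral_Rn (R : realType) (m : nat) (h : 'rV[R]_m -> R) : \bar R :=
  (\int[@lebesgue_tuple R m]_t (h (\row_(i < m) tnth t i))%:E)%E.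

(* Main.v *)
(** Write U and F for the extensions of u and f, so that Laplacian U = F off the
    origin, fix orthogonal unit vectors x and xi, put l(y) = <xi, y>, N = n+1 and,
    for a > 0, s(y) = (|y-x|^2 + a)^(-1/2).  The field H = l s^N satisfies
    Laplacian H_xi = N a (s^(n+3))_xixi, because <xi, x> = 0 and |y-x|^2 = s^-2 - a.
    Integrating by parts (F is only Lipschitz off the origin, hence derivable almost
    everywhere) moves all derivatives onto U:
      int l s^N F_xi = - int N a s^(n+3) U_xixi.
    After the substitution y = x + sqrt(a) z, the right-hand side tends to a negative
    multiple of U_xixi(x) as a tends to 0, while the left-hand side tends to the
    integral of l F_xi / |y-x|^N.  Hence the integral of the theorem is a positive
    multiple of U_xixi(x).  The Hessian of U at x kills the radial direction, so U is
    convex along every line missing the origin iff U_xixi(x) >= 0 for all such x and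
    xi; segments through the origin are limits of segments missing it. *)

Require Import Defs.
From HB Require Import structures.
From mathcomp Require Import all_boot all_order all_algebra.
From mathcomp Require Import ring lra.
From mathcomp Require Import all_classical all_reals all_analysis.
From mathcomp Require Import measurable_realfun.

Set Implicit Arguments.
Unset Strict Implicit.
Unset Printing Implicit Defensive.

Import Order.TTheory GRing.Theory Num.Theory.
Import numFieldNormedType.Exports.

Local Open Scope classical_set_scope.
Local Open Scope ring_scope.

(** The obstacle: [F] is only Lipschitz, [U] has just two continuous derivatives, and both are
    singular at the origin, so [F_xi] cannot be expanded into third derivatives of [U]. Every
    integration by parts therefore goes through one statement, [slip_div]: the integral of [D_v g]
    is 0 when [g] has size [|y|^-1 (1 + |y|)^-n] and is Lipschitz at scale [|y|] with the matching
    constant. The identity for fixed [a] is a sum of such total derivatives, with at most one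
    derivative on [F] and two on [U]. Derivability almost everywhere is needed only in a fixed
    direction, which reduces it to Lipschitz functions of one variable and to Fubini along parallel
    lines. In the limit, [U_xixi] blows up like [1/|y|] at the origin, a point that the substitution
    moves to [-x / sqrt(a)], so no fixed majorant exists after it. Hence [U_xixi] is split with the
    factors [|y|] and [1 - |y|]: the first part is bounded, the second vanishes at [x] and is
    dominated without substituting. The positive multiple is [N] times the integral of
    [(1 + |z|^2)^(-(n+3)/2)]. *)

Section euclidean.
Context {R : realType} {m : nat}.
Implicit Types x y z v : 'rV[R]_m.

Lemma dotpC x y : dotp x y = dotp y x.
Proof. by apply: eq_bigr => i _; rewrite mulrC. Qed.

Lemma dotpDl x y z : dotp (x + y) z = dotp x z + dotp y z.
Proof. by rewrite -big_split; apply: eq_bigr => i _; rewrite mxE mulrDl. Qed.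

Lemma dotpZl a x z : dotp (a *: x) z = a * dotp x z.
Proof. by rewrite mulr_sumr; apply: eq_bigr => i _; rewrite mxE mulrA. Qed.

Lemma dotpDr x y z : dotp z (x + y) = dotp z x + dotp z y.
Proof. by rewrite dotpC dotpDl !(dotpC z). Qed.

Lemma dotpZr a x z : dotp z (a *: x) = a * dotp z x.
Proof. by rewrite dotpC dotpZl (dotpC z). Qed.

Lemma dotpNr x z : dotp z (- x) = - dotp z x.
Proof. by rewrite -scaleN1r dotpZr mulN1r. Qed.

Lemma dotpBr x y z : dotp z (x - y) = dotp z x - dotp z y.
Proof. by rewrite dotpDr dotpNr. Qed.

Lemma dotpNl x z : dotp (- x) z = - dotp x z.
Proof. by rewrite dotpC dotpNr dotpC. Qed.

Lemma dotpBl x y z : dotp (x - y) z = dotp x z - dotp y z.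
Proof. by rewrite dotpDl dotpNl. Qed.

Lemma dotp0r x : dotp x 0 = 0.
Proof. by rewrite -(scale0r 0) dotpZr mul0r. Qed.

Lemma dotp_delta x i : dotp x (delta_mx ord0 i) = x ord0 i.
Proof.
rewrite /dotp (bigD1 i)//= mxE !eqxx mulr1 big1 ?addr0// => j ji.
by rewrite mxE (negbTE ji) mulr0.
Qed.

Lemma dotp_ge0 x : 0 <= dotp x x.
Proof. by apply: sumr_ge0 => i _; rewrite -expr2 sqr_ge0. Qed.

Lemma dotp_eq0 x : (dotp x x == 0) = (x == 0).
Proof.
apply/idP/idP => [|/eqP->]; last by rewrite dotp0r.
rewrite psumr_eq0; last by move=> i _; rewrite -expr2 sqr_ge0.
move=> /allP H; apply/eqP/rowP => i; rewrite mxE.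
by have := H i (mem_index_enum _); rewrite /= mulf_eq0 orbb => /eqP.
Qed.

Lemma enorm_ge0 x : 0 <= enorm x.
Proof. exact: sqrtr_ge0. Qed.

Lemma sqr_enorm x : enorm x ^+ 2 = dotp x x.
Proof. by rewrite sqr_sqrtr ?dotp_ge0. Qed.

Lemma enorm_eq0 x : (enorm x == 0) = (x == 0).
Proof. by rewrite -dotp_eq0 -sqr_enorm sqrf_eq0. Qed.

Lemma enorm_gt0 x : (0 < enorm x) = (x != 0).
Proof. by rewrite lt_neqAle enorm_ge0 andbT eq_sym enorm_eq0. Qed.

Lemma enorm0 : enorm (0 : 'rV[R]_m) = 0.
Proof. by apply/eqP; rewrite enorm_eq0. Qed.

Lemma enormZ a x : enorm (a *: x) = `|a| * enorm x.
Proof. by rewrite /enorm dotpZl dotpZr mulrA -expr2 sqrtrM ?sqr_ge0// sqrtr_sqr. Qed.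

Lemma enormN x : enorm (- x) = enorm x.
Proof. by rewrite -scaleN1r enormZ normrN1 mul1r. Qed.

Lemma enorm_dist x y : enorm (x - y) = enorm (y - x).
Proof. by rewrite -enormN opprB. Qed.

(** Cauchy-Schwarz: the squared length of [(x.x) y - (x.y) x] is [(x.x) ((x.x)(y.y) - (x.y)^2)], so
    the second factor is nonnegative once [x] is nonzero. *)
Lemma dotp_le x y : `|dotp x y| <= enorm x * enorm y.
Proof.
rewrite -(@ler_pXn2r _ 2)// ?nnegrE ?mulr_ge0 ?enorm_ge0//.
rewrite exprMn !sqr_enorm real_normK ?num_real//.
have [/eqP|x0] := eqVneq (dotp x x) 0.
  by rewrite dotp_eq0 => /eqP ->; rewrite [dotp 0 y]dotpC !dotp0r expr0n mul0r.
have xp : 0 < dotp x x by rewrite lt_neqAle eq_sym x0 dotp_ge0.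
have := dotp_ge0 (dotp x x *: y - dotp x y *: x).
rewrite !(dotpBl, dotpBr, dotpZl, dotpZr) (dotpC y x) => H.
by rewrite -subr_ge0 -(pmulr_rge0 _ xp); apply: le_trans H _; rewrite le_eqVlt; apply/orP; left; apply/eqP; ring.
Qed.

Lemma enormD x y : enorm (x + y) <= enorm x + enorm y.
Proof.
rewrite -(@ler_pXn2r _ 2)// ?nnegrE ?addr_ge0 ?enorm_ge0//.
rewrite sqrrD !sqr_enorm dotpDl !dotpDr (dotpC y x).
by have := le_trans (ler_norm _) (dotp_le x y); rewrite mulr2n; lra.
Qed.

Lemma enormB_le x y : enorm x - enorm y <= enorm (x - y).
Proof. by have := enormD (x - y) y; rewrite subrK; lra. Qed.

Lemma enormB_dist x y : `|enorm x - enorm y| <= enorm (x - y).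
Proof.
rewrite ler_norml enormB_le andbT; have := enormB_le y x.
by rewrite enorm_dist; lra.
Qed.

Lemma coord_le_enorm x i : `|x ord0 i| <= enorm x.
Proof.
rewrite -(@ler_pXn2r _ 2)// ?nnegrE ?enorm_ge0//.
rewrite sqr_enorm real_normK ?num_real// /dotp (bigD1 i)//= -expr2 lerDl.
by apply: sumr_ge0 => j _; rewrite -expr2 sqr_ge0.
Qed.

Lemma coord_le_norm x i : `|x ord0 i| <= `|x|.
Proof.
rewrite [leRHS]/Num.norm/= mx_normrE.
by apply: (@le_bigmax _ _ _ 0 (fun i => `|x i.1 i.2|) (ord0, i)).
Qed.

Lemma enorm_le_norm x : enorm x <= m%:R * `|x|.
Proof.
rewrite -(@ler_pXn2r _ 2)// ?nnegrE ?mulr_ge0 ?enorm_ge0//.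
rewrite sqr_enorm /dotp.
have le1 i : x ord0 i * x ord0 i <= `|x| ^+ 2.
  rewrite -expr2 -real_normK ?num_real// lerXn2r ?nnegrE//; exact: coord_le_norm.
apply: le_trans (ler_sum _ (fun i _ => le1 i)) _.
rewrite sumr_const card_ord exprMn -[leLHS]mulr_natl.
apply: ler_wpM2r; first exact: sqr_ge0.
by rewrite -natrX ler_nat; case: (m) => // k; rewrite expnS expn1 leq_pmulr.
Qed.

Lemma norm_le_enorm x : `|x| <= enorm x.
Proof.
rewrite [leLHS]/Num.norm/= mx_normrE.
apply: bigmax_le; first exact: enorm_ge0.
by move=> [i j] _ /=; rewrite (ord1 i) coord_le_enorm.
Qed.

(** With [enorm_nearP], this lets neighbourhoods, which are defined by the sup norm, be handled with
    Euclidean balls. The divisor [m.+1] keeps the radius positive in dimension 0. *)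
Lemma near_enorm y (P : set 'rV[R]_m) e : 0 < e ->
  (forall z, enorm (z - y) <= e -> P z) -> \forall z \near y, P z.
Proof.
move=> e0 H; apply/nbhs_ballP.
have m1 : 0 < (m.+1)%:R :> R by rewrite ltr0n.
exists (e / m.+1%:R); rewrite /= ?divr_gt0//.
move=> z; rewrite mx_norm_ball /ball_ /= => zy; apply: H.
apply: le_trans (enorm_le_norm _) _; rewrite distrC.
apply: (@le_trans _ _ (m.+1%:R * `|y - z|)); first by rewrite ler_wpM2r// ler_nat.
by move: zy; rewrite ltr_pdivlMr// mulrC => /ltW.
Qed.

Lemma enorm_nearP y (P : set 'rV[R]_m) : (\forall z \near y, P z) ->
  exists2 e, 0 < e & forall z, enorm (z - y) < e -> P z.
Proof.
move=> /nbhs_ballP[e/= e0 H]; exists e => // z zy; apply: H.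
rewrite mx_norm_ball /ball_ /= distrC; exact: le_lt_trans (norm_le_enorm _) zy.
Qed.

Lemma continuous_enormP (g : 'rV[R]_m -> R) y : {for y, continuous g} <->
  forall e, 0 < e -> exists2 d, 0 < d &
    forall z, enorm (z - y) <= d -> `|g z - g y| <= e.
Proof.
split.
  move=> cg e e0; have /enorm_nearP[d d0 H] :
      \forall z \near y, `|g y - g z| <= e.
    exact: (@cvgr_dist_le _ _ _ _ (nbhs_filter y) _ _ cg).
  exists (d / 2); first by rewrite divr_gt0.
  move=> z zy; rewrite distrC; apply: H; apply: le_lt_trans zy _.
  by rewrite ltr_pdivrMr// ltr_pMr// ltr1n.
move=> H; apply: (@cvgrPdist_le _ _ _ _ (nbhs_filter y) _ _).2 => e e0.
have [d d0 {}H] := H e e0; apply: (near_enorm d0) => z zy.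
by rewrite distrC; exact: H.
Qed.

Section continuous_at.
Variables (y : 'rV[R]_m) (f g : 'rV[R]_m -> R).
Hypotheses (cf : {for y, continuous f}) (cg : {for y, continuous g}).

Lemma cont_cst (c : R) : {for y, continuous (fun=> c : R)}.
Proof. by move=> P /nbhs_singleton Pc; apply: (@filterS _ _ (nbhs_filter y) setT) => [z _ |]; [exact: Pc|exact: filterT]. Qed.

Lemma contD : {for y, continuous (fun z => f z + g z)}.
Proof. exact: (cvgD cf cg). Qed.

Lemma contM : {for y, continuous (fun z => f z * g z)}.
Proof. exact: (cvgM cf cg). Qed.

Lemma contX n : {for y, continuous (fun z => f z ^+ n)}.
Proof. exact: (continuous_comp cf (@exprn_continuous R n (f y))). Qed.

Lemma contV : f y != 0 -> {for y, continuous (fun z => (f z)^-1)}.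
Proof. by move=> fy; exact: (cvgV fy cf). Qed.

End continuous_at.

Lemma continuous_enorm : continuous (@enorm R m).
Proof.
move=> y; apply/continuous_enormP => e e0; exists e => // z.
exact: le_trans (enormB_dist _ _).
Qed.

Lemma continuous_dotpr v : continuous (dotp v).
Proof.
move=> y; apply/continuous_enormP => e e0.
have v1 : 0 < enorm v + 1 by rewrite ltr_wpDl// enorm_ge0.
exists (e / (enorm v + 1)); first by rewrite divr_gt0.
move=> z; rewrite ler_pdivlMr// => zy; rewrite -dotpBr.
apply: le_trans (dotp_le _ _) _; apply: le_trans _ zy.
by rewrite mulrC ler_wpM2l ?enorm_ge0// lerDl.
Qed.

End euclidean.

Lemma row_neq0 (R : realType) (m : nat) (v : 'rV[R]_m) : v != 0 ->
  exists i, v ord0 i != 0.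
Proof.
move=> v0; apply/existsP; apply: contraNT v0.
rewrite negb_exists => /forallP H; apply/eqP/rowP => i; rewrite mxE.
by have := H i; rewrite negbK => /eqP.
Qed.

(** * Lipschitz functions are derivable almost everywhere *)

Section lipschitz_derivable.
Context {R : realType}.
Local Notation mu := (@lebesgue_measure R).

Lemma stieltjes_itvoc (f : cumulative R R) (a b : R) : a <= b ->
  lebesgue_stieltjes_measure f `]a, b]%classic = (f b - f a)%:E.
Proof.
move=> ab; rewrite /lebesgue_stieltjes_measure/= /measure_extension/=.
rewrite measurable_mu_extE/=; last exact: is_ocitv.
rewrite wlength_itv/= lte_fin; case: ifPn => [//|]; rewrite -leNgt => ba.
by rewrite (@le_anti _ _ a b) ?ab ?ba// subrr.
Qed.

(* The Stieltjes measures of f and g add up to L times the Lebesgue measure. *)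
Lemma stieltjes_dominates (f g : cumulative R R) (L : R) :
  0 <= L -> (forall t, f t + g t = L * t) ->
  lebesgue_stieltjes_measure f `<< mu.
Proof.
move=> L0 fgL.
pose L' := NngNum L0.
pose h : R -> R := fun t => L * t.
have hnd : nondecreasing h by move=> x y xy; rewrite /h ler_wpM2l.
have hrc : right_continuous h.
  by apply: right_continuousW => x; apply: cvgM; [exact: cvg_cst|exact: cvg_id].
pose hc : cumulative R R := HB.pack h (isCumulative.Build R _ R h hnd hrc).
pose nf := (lebesgue_stieltjes_measure f : {measure set (measurableTypeR R) -> \bar R}).
pose ng := (lebesgue_stieltjes_measure g : {measure set (measurableTypeR R) -> \bar R}).
have addE A : measure_add nf ng A = (nf A + ng A)%E by exact: measure_addE.
have e1 A : measurable A -> lebesgue_stieltjes_measure hc A = measure_add nf ng A.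
  apply: lebesgue_stieltjes_measure_unique => X /ocitvP[->|[[a b] ab ->]].
    by rewrite !measure0.
  rewrite [RHS]addE.
  rewrite [LHS](stieltjes_itvoc _ (ltW ab)).
  rewrite [X in (X + _)%E](stieltjes_itvoc f (ltW ab)).
  rewrite [X in (_ + X)%E](stieltjes_itvoc g (ltW ab)).
  by rewrite -EFinD/= /h -!fgL; congr EFin; ring.
have e2 A : measurable A -> lebesgue_stieltjes_measure hc A = mscale L' mu A.
  apply: (@lebesgue_stieltjes_measure_unique _ hc (mscale L' mu)) => X /ocitvP[->|[[a b] ab ->]].
    by rewrite !measure0.
  rewrite [LHS](stieltjes_itvoc _ (ltW ab)).
  rewrite /= /mscale/= lebesgue_measure_itv/= lte_fin ab.
  by rewrite -EFinD -EFinM/= /h mulrBr.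
apply/null_content_dominatesP => A mA A0.
have : (nf A + ng A = 0)%E.
  by rewrite -addE -e1// e2// /mscale/= A0 mule0.
by move/eqP; rewrite padde_eq0 ?measure_ge0// => /andP[/eqP].
Qed.

(** Both [L t + g t] and [L t - g t] are nondecreasing, so the Stieltjes measure of the first is
    absolutely continuous. Its Radon-Nikodym density has a primitive that is derivable almost
    everywhere, and [g] differs from this primitive by an affine function. *)
Lemma lipschitz_ae_derivable (g : R -> R) (L : R) : 0 <= L ->
  (forall s t, `|g s - g t| <= L * `|s - t|) ->
  {ae mu, forall t, derivable g t 1}.
Proof.
move=> L0 gL.
have L1 : 0 < L + 1 by rewrite ltr_wpDl.
have cg : continuous g.
  move=> x; apply/cvgrPdist_le => e e0; near=> t.
  apply: le_trans (gL _ _) _.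
  have : `|x - t| <= e / (L + 1).
    near: t; apply/nbhs_ballP; exists (e / (L + 1)); rewrite /= ?divr_gt0//.
    by move=> z /ltW.
  rewrite ler_pdivlMr// => xt; apply: le_trans _ xt.
  by rewrite mulrC ler_wpM2l// lerDl.
pose G (s : R) (t : R) : R := L * t + s * g t.
have ndG s : s = 1 \/ s = -1 -> nondecreasing (G s).
  move=> s1 x y xy; rewrite /G.
  have := gL y x; rewrite (ger0_norm (_ : 0 <= y - x)) ?subr_ge0//.
  rewrite ler_norml => /andP[h1 h2].
  by case: s1 => ->; lra.
have cG s : continuous (G s).
  move=> x; apply: cvgD; apply: cvgM; try exact: cvg_cst; [exact: cvg_id|exact: cg].
have rcG s := right_continuousW (cG s).
pose f1 : cumulative R R := HB.pack (G 1)
  (isCumulative.Build R _ R (G 1) (ndG _ (or_introl erefl)) (rcG 1)).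
pose f2 : cumulative R R := HB.pack (G (-1))
  (isCumulative.Build R _ R (G (-1)) (ndG _ (or_intror erefl)) (rcG (-1))).
have dom : lebesgue_stieltjes_measure f1 `<< mu.
  apply: (@stieltjes_dominates f1 f2 (2 * L)); first by rewrite mulr_ge0.
  by move=> t; rewrite /= /G; ring.
pose nu := (lebesgue_stieltjes_measure f1 : {measure set (measurableTypeR R) -> \bar R}).
have nuE c d : c <= d -> nu `]c, d]%classic = (G 1 d - G 1 c)%:E.
  by move=> cd; exact: (stieltjes_itvoc f1 cd).
(* Radon-Nikodym is applied to a finite measure, hence the restriction of [nu] to a bounded
   interval; these intervals exhaust the line at the end. *)
have main (M : nat) :
    {ae mu, forall x, `]-M.+1%:R, M.+1%:R[%classic x -> derivable g x 1}.
  set a : R := - M.+1%:R; set b : R := M.+1%:R.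
  have ab : a <= b by rewrite /a /b ge0_cp.
  have mI : measurable (`]a, b]%classic : set (measurableTypeR R)).
    exact: measurable_itv.
  have nuI : (nu `]a, b]%classic < +oo)%E.
    by rewrite nuE// ltry.
  pose nuf := mfrestr mI nuI.
  have nufmu : charge_of_finite_measure nuf `<< mu.
    apply/null_content_dominatesP => A mA A0.
    rewrite /charge_of_finite_measure/= /nuf /mfrestr /mrestr.
    have dA : (lebesgue_stieltjes_measure f1).-null_set A.
      exact/dom/measure0_null_setP.
    by apply: dA; [exact: measurableI|exact: subIsetl].
  have [phi [phifin iphi phiE]] : exists f : R -> \bar R,
     [/\ (forall x, f x \is a fin_num),
    mu.-integrable [set: R] f &
    forall A, measurable A -> nuf A = (\int[mu]_(x in A) f x)%E].
    exists (Radon_Nikodym (charge_of_finite_measure nuf) mu); split.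
    - by move=> x; exact: Radon_Nikodym_fin_num.
    - exact: Radon_Nikodym_integrable.
    - by move=> A mA; rewrite -Radon_Nikodym_integral.
  pose p := fine \o phi.
  have pE : EFin \o p = phi by apply/funext => x /=; rewrite /p/= fineK.
  have ip : mu.-integrable [set: R] (EFin \o p) by rewrite pE.
  have ipy y : mu.-integrable `]-oo, y] (EFin \o p).
    by apply: integrableS ip => //; exact: measurable_itv.
  have lp : locally_integrable [set: R] p.
    by apply: open_integrable_locally => //; exact: openT.
  have := FTC1Ny ipy lp; apply: filterS; first exact: (ae_filter_ringOfSetsType mu).
  move=> x /= [dF _].
  rewrite in_itv/= => /andP[ax xb].
  set F : R -> R := fun y => (\int[mu]_(t in [set` `]-oo, y]]) (p t))%R in dF.
  (* The restricted measure ignores everything to the left of [a], so the primitive taken from minus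
     infinity is an increment of [G 1] starting at [a]. *)
  have FE y : a < y -> y < b -> F y = G 1 y - G 1 a.
    move=> ay yb; rewrite /F /Rintegral.
    under eq_integral do rewrite -[(p _)%:E]/((EFin \o p) _) pE.
    rewrite -phiE; last exact: measurable_itv.
    rewrite /nuf /mfrestr /mrestr.
    rewrite [X in nu X](_ : _ = `]a, y]%classic).
      by rewrite nuE// ltW.
    apply/seteqP; split => z /=; rewrite !in_itv/=.
      by move=> [zy /andP[-> _]].
    by move=> /andP[-> zy]; rewrite zy/= (le_trans zy)// ltW.
  apply: (@near_eq_derivable _ _ _ (fun y => F y + (G 1 a - L * y))).
    near=> y; rewrite FE; first by rewrite /G; ring.
      by near: y; exact: lt_nbhsr.
    by near: y; exact: lt_nbhsl.
  exact: derivableD.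
have [N [mN N0 sN]] := ae_foralln main.
exists N; split => // x /= nd; apply: sN => /= H; apply: nd.
apply: (H (Num.bound `|x|)).
rewrite /= in_itv/= -ltr_norml.
by rewrite (lt_trans (archi_boundP (normr_ge0 _)))// ltr_nat.
Unshelve. all: by end_near. Qed.

End lipschitz_derivable.

(** * Lebesgue measure on tuples *)

Section lebesgue_tuple_theory.
Context {R : realType}.
Local Notation mT := (measurableTypeR R).

(** [lebesgue_tuple] is a bare set function obtained by recursion; a structured measure equal to it
    is chosen so that integration theorems apply. *)
Definition leb m : {sigma_finite_measure set (m.-tuple mT) -> \bar R} :=
  projT1 (cid (lebesgue_tuple_sigma_finite R m)).

Lemma lebE m : @lebesgue_tuple R m = leb m.
Proof. by rewrite /leb; case: cid. Qed.

Lemma measurable_tuple_cons m :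
  measurable_fun setT (fun p : mT * m.-tuple mT => [tuple of p.1 :: p.2]).
Proof. exact: (@measurable_cons _ _ _ _ fst m snd). Qed.

Lemma lebS m : (leb m.+1 : set _ -> \bar R) =
  pushforward (product_measure1 (@lebesgue_measure R) (leb m))
        (fun p : mT * m.-tuple mT => [tuple of p.1 :: p.2]).
Proof. by rewrite -lebE /= lebE. Qed.

Local Open Scope ereal_scope.

Lemma ge0_integral_lebS m (h : m.+1.-tuple mT -> \bar R) :
  measurable_fun [set: _.-tuple mT] h -> (forall t, 0 <= h t) ->
  \int[leb m.+1]_t h t =
  \int[@lebesgue_measure R]_a \int[leb m]_t h [tuple of a :: t].
Proof.
move=> mh h0.
rewrite lebS ge0_integral_pushforward//; last exact: measurable_tuple_cons.
rewrite fubini_tonelli1//.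
- by apply: measurableT_comp => //; exact: measurable_tuple_cons.
- by move=> x; exact: h0.
Qed.

Lemma measurable_integral_lebS m (h : m.+1.-tuple mT -> \bar R) :
  measurable_fun [set: _.-tuple mT] h -> (forall t, 0 <= h t) ->
  measurable_fun [set: mT] (fun a => \int[leb m]_t h [tuple of a :: t]).
Proof.
move=> mh h0.
apply: (@measurable_fun_fubini_tonelli_F _ _ _ _ _ (leb m)
  (fun p => h [tuple of p.1 :: p.2])) => //.
by apply: measurableT_comp => //; exact: measurable_tuple_cons.
Qed.

Lemma ge0_integral_leb0 (h : 0.-tuple mT -> \bar R) :
  measurable_fun [set: _.-tuple mT] h -> (forall t, 0 <= h t) ->
  \int[leb 0]_t h t = h [tuple].
Proof.
move=> mh h0; rewrite -lebE /= integral_dirac//.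
by rewrite diracE mem_set// mul1e.
Qed.

(** By uniqueness of Lebesgue measure: [|a|] times its image under [t -> a t + b] gives half-open
    intervals their length. For negative [a] the preimage is closed on the left instead, which does
    not change its length. *)
Lemma ge0_integral_affine (h : R -> \bar R) (a b : R) : a != 0%R ->
  measurable_fun [set: R] h -> (forall t, 0 <= h t) ->
  \int[@lebesgue_measure R]_t h (a * t + b)%R =
  (`|a|^-1)%:E * \int[@lebesgue_measure R]_t h t.
Proof.
move=> a0 mh h0.
pose phi : measurableTypeR R -> measurableTypeR R := fun t => (a * t + b)%R.
have mphi : measurable_fun setT phi.
  by apply: measurable_funD => //; apply: measurable_funM.
pose push : {measure set mT -> \bar R} :=
  measure_function_pushforward__canonical__measure_function_Measure
    (@lebesgue_measure R) mphi.
pose nu := mscale (NngNum (normr_ge0 a)) push.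
have nuE A : measurable A -> @lebesgue_measure R A = nu A.
  apply: lebesgue_measure_unique => X /ocitvP[->|[[c d]/= cd ->]].
    by rewrite !measure0.
  rewrite lebesgue_measure_itv/= lte_fin cd /nu /mscale/= /push/= /pushforward.
  have [ap|an|a00] := ltgtP 0%R a; last by rewrite -a00 eqxx in a0.
    rewrite (_ : phi @^-1` _ = `]((c - b) / a)%R, ((d - b) / a)%R]%classic); last first.
      by apply/seteqP; split => t /=; rewrite !in_itv/= /phi;
        rewrite ltr_pdivrMr// ler_pdivlMr// ltrBlDr lerBrDr mulrC.
    rewrite lebesgue_measure_itv/= lte_fin ltr_pM2r ?invr_gt0// ltrD2r cd.
    by rewrite gtr0_norm// -!EFinD -EFinM; congr EFin; field; rewrite gt_eqF.
  rewrite (_ : phi @^-1` _ = `[((d - b) / a)%R, ((c - b) / a)%R[%classic); last first.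
    by apply/seteqP; split => t /=; rewrite !in_itv/= /phi;
      rewrite ltr_ndivlMr// ler_ndivrMr// ltrBlDr lerBrDr mulrC andbC.
  rewrite lebesgue_measure_itv/= lte_fin ltr_nM2r ?invr_lt0// ltrD2r cd.
  by rewrite ltr0_norm// -!EFinD -EFinM; congr EFin; field; rewrite lt_eqF.
have -> : \int[@lebesgue_measure R]_t h t = \int[nu]_t h t.
  by apply: eq_measure_integral => A mA _; exact: nuE.
rewrite /nu ge0_integral_mscale//= /push/= ge0_integral_pushforward//=.
by rewrite muleA -EFinM mulVf ?normr_eq0// mul1e.
Qed.

Definition tuple_affine m (a : R) (b t : m.-tuple mT) : m.-tuple mT :=
  [tuple (a * tnth t i + tnth b i)%R | i < m].

Lemma tuple_affine_cons m a (b : m.+1.-tuple mT) x (t : m.-tuple mT) :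
  tuple_affine a b [tuple of x :: t] =
  [tuple of (a * x + thead b)%R :: tuple_affine a [tuple of behead b] t].
Proof.
apply: eq_from_tnth => i; rewrite tnth_mktuple.
case: (unliftP ord0 i) => [j ->|->]; last by rewrite !tnth0.
rewrite !tnthS tnth_mktuple; congr (_ + _)%R.
by rewrite [in LHS](tuple_eta b) tnthS.
Qed.

Lemma measurable_tuple_affine m a (b : m.-tuple mT) :
  measurable_fun [set: m.-tuple mT] (tuple_affine a b).
Proof.
apply/measurable_fun_tnthP => i.
rewrite (_ : _ \o _ = fun t => (a * tnth t i + tnth b i)%R); last first.
  by apply/funext => t /=; rewrite tnth_mktuple.
apply: measurable_funD => //; apply: measurable_funM => //.
exact: measurable_tnth.
Qed.

(** One coordinate at a time, each giving a factor [a^-1]. With [a = 1] this is translation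
    invariance, the source of the vanishing integrals below. *)
Lemma ge0_integral_leb_affine m (h : m.-tuple mT -> \bar R) (a : R) b :
  (0 < a)%R -> measurable_fun [set: _.-tuple mT] h -> (forall t, 0 <= h t) ->
  \int[leb m]_t h (tuple_affine a b t) =
  ((a ^- m)%R)%:E * \int[leb m]_t h t.
Proof.
move=> a0; elim: m h b => [|m IH] h b mh h0.
  rewrite !ge0_integral_leb0//; first by rewrite expr0 invr1 mul1e tuple0.
  by apply: measurableT_comp => //; exact: measurable_tuple_affine.
rewrite !ge0_integral_lebS//; last first.
  by apply: measurableT_comp => //; exact: measurable_tuple_affine.
have mc x : measurable_fun [set: m.-tuple mT] (fun t : m.-tuple mT => h [tuple of x :: t]).
  by apply: measurableT_comp => //; exact: (@measurable_cons _ _ _ _ (cst x) m id).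
under eq_integral => x _.
  under eq_integral do rewrite tuple_affine_cons.
  rewrite (IH (fun t => h [tuple of (a * x + thead b)%R :: t]))//.
  over.
rewrite (@ge0_integral_affine (fun x => (a ^- m)%:E * \int[leb m]_t h [tuple of x :: t]) a (thead b)) ?gt_eqF//.
- rewrite ge0_integralZl//.
  + by rewrite muleA -EFinM exprS invfM gtr0_norm.
  + exact: measurable_integral_lebS.
  + by move=> x _; exact: integral_ge0.
  + by rewrite lee_fin invr_ge0 exprn_ge0// ltW.
- by apply: measurable_funeM; exact: measurable_integral_lebS.
- move=> x; apply: mule_ge0; last exact: integral_ge0.
  by rewrite lee_fin invr_ge0 exprn_ge0// ltW.
Qed.

Lemma leb_int m (E : set (m.-tuple mT)) : measurable E ->
  leb m E = \int[leb m]_t (\1_E t)%:E.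
Proof. by move=> mE; rewrite integral_indic// setIT. Qed.

Definition tuple_line m (t v : m.-tuple mT) (s : R) : m.-tuple mT :=
  [tuple (tnth t i + s * tnth v i)%R | i < m].

Lemma measurable_tuple_line m (v : m.-tuple mT) :
  measurable_fun setT (fun p : mT * m.-tuple mT => tuple_line p.2 v p.1).
Proof.
apply/measurable_fun_tnthP => i.
rewrite (_ : _ \o _ = fun p => (tnth p.2 i + p.1 * tnth v i)%R); last first.
  by apply/funext => t /=; rewrite tnth_mktuple.
apply: measurable_funD => //; last by apply: measurable_funM.
by apply: (@measurableT_comp _ _ _ _ _ _ (fun t : m.-tuple mT => tnth t i) _ snd) => //;
  exact: measurable_tnth.
Qed.

(** If the first coordinate of [v] is 0, slices at a fixed first coordinate inherit the hypothesis.
    Otherwise a shear makes [v] parallel to the first axis, and Tonelli integrates along that axis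
    first. *)
Lemma line_null m (E : set (m.-tuple mT)) (v : m.-tuple mT) (i : 'I_m) :
  measurable E -> tnth v i != 0%R ->
  (forall t, @lebesgue_measure R [set s | E (tuple_line t v s)] = 0) ->
  leb m E = 0.
Proof.
elim: m E v i => [? ? []//|m IH] E v i mE vi0 Enull.
rewrite leb_int//.
have m1 : measurable_fun setT (fun t => (\1_E t : R)%:E).
  by apply/measurable_EFinP.
have p1 t : 0 <= (\1_E t : R)%:E by rewrite lee_fin.
have mcons x : measurable_fun setT (fun t : m.-tuple mT => [tuple of x :: t] : m.+1.-tuple mT).
  exact: (@measurable_cons _ _ _ _ (cst x) m id).
rewrite ge0_integral_lebS//.
have [v00|v00] := eqVneq (thead v) 0%R.
  apply: integral0_eq => a _.
  pose Ea := (fun t : m.-tuple mT => [tuple of a :: t] : m.+1.-tuple mT) @^-1` E.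
  have mEa : measurable Ea by rewrite -[Ea]setTI; exact: mcons.
  rewrite -[LHS]/(\int[leb m]_t (\1_Ea t)%:E) -leb_int//.
  have [j vj0] : exists j, tnth [tuple of behead v] j != 0%R.
    case: (unliftP ord0 i) vi0 => [j ->|->].
      by rewrite {1}(tuple_eta v) tnthS => ?; exists j.
    by rewrite -/(thead v) v00 eqxx.
  apply: (IH _ [tuple of behead v] j) => // t.
  rewrite -[RHS](Enull [tuple of a :: t]); congr (lebesgue_measure _).
  apply/seteqP; split => s /=; rewrite /Ea /=; congr E; apply: eq_from_tnth => k;
    case: (unliftP ord0 k) => [k' ->|->]; rewrite ?tnthS ?tnth0 !tnth_mktuple ?tnthS ?tnth0.
  - by rewrite [in RHS](tuple_eta v) tnthS.
  - by rewrite -/(thead v) v00 mulr0 addr0.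
  - by rewrite [in LHS](tuple_eta v) tnthS.
  - by rewrite -/(thead v) v00 mulr0 addr0.
(* [w] is the displacement of the other coordinates per unit of the first one. For each fixed [a],
   translating [t] by [a w] leaves the inner integral unchanged; after the exchange, the inner
   integral runs along a line of direction [v]. *)
pose w := [tuple (tnth v (lift ord0 j) / thead v)%R | j < m].
transitivity (\int[@lebesgue_measure R]_a \int[leb m]_t
    (\1_E [tuple of a :: tuple_line t w a])%:E).
  apply: eq_integral => a _.
  have m1a : measurable_fun setT (fun t : m.-tuple mT => (\1_E [tuple of a :: t] : R)%:E).
    exact: (measurableT_comp m1 (mcons a)).
  have := @ge0_integral_leb_affine m _ 1 [tuple (a * tnth w j)%R | j < m] ltr01
    m1a (fun t => p1 _).
  rewrite expr1n invr1 mul1e => <-.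
  apply: eq_integral => t _; congr (\1_E _)%:E; congr [tuple of _ :: _].
  by apply: eq_from_tnth => j; rewrite !tnth_mktuple mul1r.
rewrite (@fubini_tonelli _ _ _ _ _ (@lebesgue_measure R) (leb m)
  (fun p => (\1_E [tuple of p.1 :: tuple_line p.2 w p.1])%:E))//; last first.
  apply: (measurableT_comp m1).
  exact: (@measurable_cons _ _ _ _ fst m (fun p => tuple_line p.2 w p.1) _ (measurable_tuple_line w)).
apply: integral0_eq => t _ /=.
pose t0 : m.+1.-tuple mT := [tuple of (0%R : mT) :: t].
(* The same line is parametrised by its first coordinate on one side and by multiples of [v] on the
   other; the rescaling does not affect null sets. *)
have lineE a : [tuple of a :: tuple_line t w a] = tuple_line t0 v ((thead v)^-1 * a + 0)%R.
  apply: eq_from_tnth => k; rewrite tnth_mktuple addr0.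
  case: (unliftP ord0 k) => [k' ->|->]; rewrite ?tnthS ?tnth0 ?tnth_mktuple.
    by congr (_ + _)%R; rewrite [LHS]mulrC -mulrA [RHS]mulrC.
  by rewrite add0r mulrAC mulVf ?mul1r.
under eq_integral do rewrite lineE.
have ml : measurable_fun [set: mT] (fun s : mT => tuple_line t0 v s).
  apply: (@measurableT_comp _ _ _ _ _ _ _ _ (fun s : mT => (s, t0)) (measurable_tuple_line v)).
  exact: measurable_pair2.
rewrite (@ge0_integral_affine (fun s => (\1_E (tuple_line t0 v s))%:E) (thead v)^-1 0)//.
- rewrite -[X in _ * X]/(\int[lebesgue_measure]_s (\1_((fun s => tuple_line t0 v s) @^-1` E) s)%:E).
  rewrite integral_indic ?setIT//.
    by rewrite [X in _ * X]Enull mule0.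
  by rewrite -[_ @^-1` _]setTI; exact: ml.
- by rewrite invr_neq0.
- exact: (measurableT_comp m1 ml).
Qed.

End lebesgue_tuple_theory.

(** * Measurability of functions of row vectors *)

Section measurable_rv.
Context {R : realType} {m : nat}.
Local Notation mT := (measurableTypeR R).

Definition rv (t : m.-tuple mT) : 'rV[R]_m := \row_i tnth t i.
Definition vr (y : 'rV[R]_m) : m.-tuple mT := [tuple y ord0 i | i < m].

Lemma rv_line t v s : rv (tuple_line t (vr v) s) = rv t + s *: v.
Proof. by apply/rowP => i; rewrite !mxE !tnth_mktuple. Qed.

Lemma rv_affine a b t : rv (tuple_affine a (vr b) t) = a *: rv t + b.
Proof. by apply/rowP => i; rewrite !mxE !tnth_mktuple. Qed.

(** After rounding to the grid of step [1/(k+1)], any [g] factors through a countable set and is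
    measurable; continuity enters only in the limit over [k]. *)
Definition rv_grid (k : nat) (z : {ffun 'I_m -> int}) : 'rV[R]_m :=
  \row_i ((z i)%:~R / k.+1%:R).

Definition rv_floor (k : nat) (y : 'rV[R]_m) : {ffun 'I_m -> int} :=
  [ffun i => Num.floor (k.+1%:R * y ord0 i)].

Lemma rv_grid_floor k y : enorm (rv_grid k (rv_floor k y) - y) <= m%:R / k.+1%:R.
Proof.
apply: le_trans (enorm_le_norm _) _; rewrite ler_wpM2l//.
rewrite [leLHS]/Num.norm/= mx_normrE.
apply: bigmax_le => [|[i j] _ /=]; first by rewrite invr_ge0.
rewrite !mxE ffunE (ord1 i).
set a := y ord0 j; have k0 : 0 < k.+1%:R :> R by rewrite ltr0n.
have -> : (Num.floor (k.+1%:R * a))%:~R / k.+1%:R - a =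
   ((Num.floor (k.+1%:R * a))%:~R - k.+1%:R * a) / k.+1%:R.
  by field; rewrite gt_eqF.
rewrite normrM (gtr0_norm (_ : 0 < k.+1%:R^-1)) ?invr_gt0//.
rewrite ler_pdivrMr// mulVf ?gt_eqF//.
have /andP[h1 h2] := floor_itv (k.+1%:R * a).
by rewrite ler_norml; move: h2; rewrite intrD/= => h2; lra.
Qed.

Lemma measurable_floor_fiber k (z : int) :
  measurable [set a : mT | Num.floor (k.+1%:R * (a : R)) = z].
Proof.
have k0 : 0 < k.+1%:R :> R by rewrite ltr0n.
rewrite (_ : [set _ | _] = `[z%:~R / k.+1%:R, (z + 1)%:~R / k.+1%:R[%classic).
  exact: measurable_itv.
apply/seteqP; split => a /=; rewrite in_itv/= ler_pdivrMr// ltr_pdivlMr// (mulrC a).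
  by move=> <-; exact: floor_itv.
by move=> /floor_def.
Qed.

Lemma measurable_rv_grid k (g : 'rV[R]_m -> R) :
  measurable_fun setT (fun t => g (rv_grid k (rv_floor k (rv t)))).
Proof.
move=> _ B mB; rewrite setTI.
rewrite (_ : _ @^-1` B =
  \bigcup_(z in [set z | B (g (rv_grid k z))])
    \bigcap_(i in [set: 'I_m]) ((@tnth _ mT)^~ i @^-1` [set a : mT | Num.floor (k.+1%:R * (a : R)) = z i])); last first.
  apply/seteqP; split => t /=.
    move=> Bt; exists (rv_floor k (rv t)) => // i _ /=.
    by rewrite ffunE mxE.
  move=> [z /= Bz H]; rewrite (_ : rv_floor k (rv t) = z)//.
  by apply/ffunP => i; rewrite ffunE mxE; exact: H.
rewrite bigcup_mkcond; apply: countable_bigcupT_measurable.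
  exact: countableP.
move=> z; case: ifP => // _; apply: fin_bigcap_measurable => // i _.
rewrite -[X in measurable X]setTI; apply: measurable_tnth => //.
exact: measurable_floor_fiber.
Qed.

(* At the origin the grid approximation is exact, so continuity is not needed there. *)
Lemma measurable_rv (g : 'rV[R]_m -> R) :
  (forall y, y != 0 -> {for y, continuous g}) ->
  measurable_fun setT (fun t => g (rv t)).
Proof.
move=> cg.
apply: (@measurable_fun_cvg _ _ _ _
  (fun k t => g (rv_grid k (rv_floor k (rv t))))).
  by move=> k; exact: measurable_rv_grid.
move=> t _; set y := rv t; have [y0|/cg/continuous_enormP cy] := eqVneq y 0.
  rewrite (_ : (fun k => _) = cst (g y)); first exact: cvg_cst.
  apply/funext => k /=; congr g; rewrite y0; apply/rowP => i.
  by rewrite !mxE ffunE !mxE mulr0 floor0 mul0r.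
apply/cvgrPdist_le => e e0; have [d d0 H] := cy e e0.
near=> k; rewrite distrC; apply: H; apply: le_trans (rv_grid_floor _ _) _.
rewrite ler_pdivrMr ?ltr0n// mulrC -ler_pdivrMr//.
apply: (@le_trans _ _ k%:R); last by rewrite ler_nat.
by near: k; exact: nbhs_infty_ger.
Unshelve. all: by end_near. Qed.

End measurable_rv.

(* Existence of a limit at 0, tested on countably many increments so that the set
   of points of derivability is visibly measurable. *)
Definition rat_cauchy0 (R : realType) (q : R -> R) := forall k, exists j : nat,
  forall r r' : rat, 0 < `|ratr r : R| < j.+1%:R^-1 -> 0 < `|ratr r' : R| < j.+1%:R^-1 ->
  `|q (ratr r) - q (ratr r')| <= k.+1%:R^-1.

Lemma near0_dnbhsP (R : realType) (P : R -> Prop) :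
  (\forall h \near 0^', P h) <->
  exists2 d, 0 < d & forall h, 0 < `|h| < d -> P h.
Proof.
split.
  move=> /nbhs_ballP[d/= d0 H]; exists d => // h /andP[h0 hd].
  apply: H; last by rewrite -normr_gt0.
  by rewrite /ball/= sub0r normrN.
move=> [d d0 H]; apply/nbhs_ballP; exists d => // h /=.
by rewrite /ball/= sub0r normrN => hd h0; apply: H; rewrite normr_gt0 h0.
Qed.

Lemma exists_invS_lt (R : realType) (d : R) : 0 < d -> exists k : nat, k.+1%:R^-1 < d.
Proof.
by move=> d0; have [k _ H] := near_infty_natSinv_lt (PosNum d0); exists k; apply: H => /=.
Qed.

Lemma cvg_invS_dnbhs0 (R : realType) : (k.+1%:R^-1 : R) @[k --> \oo] --> (0 : R)^'.
Proof.
move=> P /near0_dnbhsP[d d0 H].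
have := near_infty_natSinv_lt (PosNum d0); apply: filterS => k /= kd.
by apply: H; rewrite ger0_norm ?invr_ge0// kd andbT invr_gt0.
Qed.

(** A strict violation of the Cauchy bound at a real increment persists nearby, because [q] is
    continuous off 0, and is therefore met at a rational increment. *)
Lemma cvg_at0_rat (R : realType) (q : R -> R) d : 0 < d ->
  (forall h, 0 < `|h| -> `|h| < d -> {for h, continuous q}) ->
  cvg (q h @[h --> 0^']) <-> rat_cauchy0 q.
Proof.
move=> d0 cq; split.
  move=> /cvg_ex[l /= ql] k.
  have k0 : 0 < k.+1%:R^-1 :> R by rewrite invr_gt0.
  have : \forall h \near 0^', `|l - q h| <= k.+1%:R^-1 / 2.
    by apply: (@cvgr_dist_le _ _ _ _ _ _ _ ql); rewrite divr_gt0.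
  move=> /near0_dnbhsP[e e0 H].
  have [j je] : exists j : nat, j.+1%:R^-1 < e by exact: exists_invS_lt.
  exists j => r r' /andP[r0 rj] /andP[r'0 r'j].
  have h1 := H (ratr r); have h2 := H (ratr r').
  rewrite r0 (lt_trans rj je) in h1; rewrite r'0 (lt_trans r'j je) in h2.
  have -> : q (ratr r) - q (ratr r') = (l - q (ratr r')) - (l - q (ratr r)) by ring.
  apply: le_trans (ler_normB _ _) _.
  by rewrite [leRHS]splitr lerD// ?h1// h2.
move=> H; apply/cauchy_cvgP/cauchy_exP => e e0.
have [k ke] : exists k : nat, k.+1%:R^-1 < e by exact: exists_invS_lt.
have [j {}H] := H k.
have j0 : 0 < j.+1%:R^-1 :> R by rewrite invr_gt0.
have [r' r'j] := rat_in_itvoo j0.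
have {}H r : 0 < `|ratr r : R| < j.+1%:R^-1 ->
    `|q (ratr r) - q (ratr r')| <= k.+1%:R^-1.
  move=> hr; apply: (H _ _ hr); move: r'j; rewrite in_itv/= => /andP[r'0 r'j].
  by rewrite gtr0_norm// r'0.
exists (q (ratr r')); apply/near0_dnbhsP.
exists (Num.min j.+1%:R^-1 d); first by rewrite lt_min j0.
move=> h; rewrite lt_min => /and3P[h0 hj hd].
rewrite /ball/=; apply: le_lt_trans ke; rewrite leNgt; apply/negP => ke.
have : \forall h' \near h, k.+1%:R^-1 < `|q (ratr r') - q h'| /\ (0 < `|h'| < j.+1%:R^-1).
  near=> h'; split; last (apply/andP; split).
  - near: h'; apply: (cvgr_gt (`|q (ratr r') - q h|)) => //.
    by apply: cvg_norm; apply: cvgB; [exact: cvg_cst|exact: cq].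
  - near: h'; apply: (cvgr_gt `|h|) => //; apply: cvg_norm; exact: cvg_id.
  - near: h'; apply: (cvgr_lt `|h|) => //; apply: cvg_norm; exact: cvg_id.
move=> /nbhs_ballP[s/= s0 Hs].
have [r rh] : exists r : rat, ratr r \in `](h - s), (h + s)[%R.
  by apply: rat_in_itvoo; rewrite ltrD2l; lra.
have [] := Hs (ratr r).
  by move: rh; rewrite in_itv/= /ball/= => ?; rewrite ltr_distlC.
by rewrite distrC => h1 /H; rewrite leNgt h1.
Unshelve. all: by end_near. Qed.

(** * Measurability of directional derivatives *)

Section measurable_derive.
Context {R : realType} {m : nat}.
Local Notation mT := (measurableTypeR R).
Variables (g : 'rV[R]_m -> R) (v : 'rV[R]_m).

Definition growth_rate (y : 'rV[R]_m) (h : R) : R := h^-1 * (g (y + h *: v) - g y).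

Lemma growth_rateE y :
  (fun h : R => h^-1 *: ((g \o shift y) (h *: v) - g y)) = growth_rate y.
Proof. by apply: funext => h; rewrite /growth_rate /= (addrC y). Qed.

Lemma derivable_growth_rate y :
  derivable g y v <-> cvg (growth_rate y h @[h --> 0^']).
Proof.
by rewrite /derivable growth_rateE.
Qed.

Lemma derive_growth_rate y : 'D_v g y = lim (growth_rate y h @[h --> 0^']).
Proof.
by rewrite /derive growth_rateE.
Qed.

Lemma is_derive_growth_rate y d :
  is_derive y v g d <-> (growth_rate y h @[h --> 0^'] --> d).
Proof.
split.
  by move=> [/derivable_growth_rate + <-]; rewrite derive_growth_rate.
move=> H; split; first by apply/derivable_growth_rate/cvgP/H.
by rewrite derive_growth_rate; apply/cvg_lim.
Qed.

Hypothesis cg : forall y, y != 0 -> {for y, continuous g}.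
Hypothesis v0 : v != 0.

(** Continuity of [g] may fail at the origin, so small nonzero increments must keep [y + h v] away
    from it. At [y = 0] this is where [v != 0] is used. *)
Lemma growth_rate_continuous y : exists2 d, 0 < d &
  forall h, 0 < `|h| -> `|h| < d -> {for h, continuous (growth_rate y)}.
Proof.
have [d d0 H] : exists2 d, 0 < d & forall h, 0 < `|h| -> `|h| < d -> y + h *: v != 0.
  have [->|y0] := eqVneq y 0.
    exists 1 => // h h0 _; rewrite add0r scaler_eq0 negb_or v0 andbT.
    by rewrite -normr_gt0.
  have vp : 0 < enorm v by rewrite enorm_gt0.
  exists (enorm y / enorm v); first by rewrite divr_gt0// enorm_gt0.
  move=> h _; rewrite ltr_pdivlMr// => hy.
  apply: contraTneq hy => /eqP; rewrite addr_eq0 => /eqP ->.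
  by rewrite enormN enormZ ltxx.
exists d => // h h0 hd; apply: cvgM.
  by apply: cvgV; rewrite -?normr_gt0//; exact: cvg_id.
apply: cvgB; last exact: cvg_cst.
apply: (@continuous_comp _ _ _ (fun h : R => y + h *: v) g); last exact/cg/H.
by apply: (@cvgD _ _ _ (nbhs h) _ (cst y)); [exact: cvg_cst|exact: scalel_continuous].
Qed.

Let cauchy_set : set (m.-tuple mT) := [set t | rat_cauchy0 (growth_rate (rv t))].

Let derivable_cauchy t : derivable g (rv t) v <-> cauchy_set t.
Proof.
have [d d0 H] := growth_rate_continuous (rv t).
by apply: iff_trans (derivable_growth_rate _) _; exact: cvg_at0_rat d0 H.
Qed.

Let measurable_growth_rate h : measurable_fun setT (fun t => growth_rate (rv t) h).
Proof.
apply: measurable_funM => //; apply: measurable_funB; last exact: measurable_rv.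
rewrite (_ : (fun _ => _) = (fun t => g (rv t)) \o tuple_affine 1 (vr (h *: v))).
  by apply: measurableT_comp; [exact: measurable_rv|exact: measurable_tuple_affine].
by apply/funext => t /=; rewrite rv_affine scale1r.
Qed.

Lemma measurable_derivable : measurable [set t : m.-tuple mT | derivable g (rv t) v].
Proof.
rewrite (_ : [set _ | _] = cauchy_set); last first.
  by apply/seteqP; split => t /derivable_cauchy.
pose small (j : nat) (r : rat) := 0 < `|ratr r : R| < j.+1%:R^-1.
rewrite (_ : cauchy_set = \bigcap_k \bigcup_j ~` (\bigcup_(p in [set p : rat * rat | small j p.1 && small j p.2])
   [set t | k.+1%:R^-1 < `|growth_rate (rv t) (ratr p.1) - growth_rate (rv t) (ratr p.2)|])).
  apply: bigcapT_measurable => k; apply: bigcupT_measurable => j.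
  apply: measurableC; rewrite bigcup_mkcond; apply: countable_bigcupT_measurable.
    exact: countableP.
  move=> p; case: ifP => // _.
  rewrite (_ : [set t | _] = (fun t => `|growth_rate (rv t) (ratr p.1) - growth_rate (rv t) (ratr p.2)|) @^-1` `]k.+1%:R^-1, +oo[%classic); last first.
    by apply/seteqP; split => t /=; rewrite in_itv/= andbT.
  rewrite -[X in measurable X]setTI.
  have mf : measurable_fun setT (fun t => `|growth_rate (rv t) (ratr p.1) - growth_rate (rv t) (ratr p.2)|).
    by apply: measurableT_comp => //; apply: measurable_funB.
  by apply: mf => //; exact: measurable_itv.
apply/seteqP; split => t.
  move=> H k _; have [j Hj] := H k; exists j => // -[[r r']/= /andP[sr sr']].
  by rewrite ltNge Hj.
move=> H k; have [j _ Hj] := H k I; exists j => r r' sr sr'.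
rewrite leNgt; apply/negP => lt; apply: Hj; exists (r, r') => //=.
exact/andP.
Qed.

Lemma measurable_derive : measurable_fun setT (fun t : m.-tuple mT => 'D_v g (rv t)).
Proof.
pose D := [set t : m.-tuple mT | derivable g (rv t) v].
have mD : measurable D := measurable_derivable.
(* Where [g] is not derivable, ['D_v g] is the limit of a divergent family, whose default value is
   [point]. The indicators make the approximants converge to that value there. *)
apply: (@measurable_fun_cvg _ _ _ _
  (fun k t => \1_D t * growth_rate (rv t) k.+1%:R^-1 + \1_(~` D) t * (point : R))).
  move=> k; apply: measurable_funD; apply: measurable_funM => //.
  by apply: measurable_indic; exact: measurableC.
move=> t _; rewrite !indicE.
have [Dt|nDt] := pselect (D t).
  have nDt : ~ (~` D) t by move=> /(_ Dt).
  rewrite (mem_set Dt) (memNset nDt).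
  rewrite (_ : (fun k => _) = (fun k => growth_rate (rv t) k.+1%:R^-1)); last first.
    by apply: funext => k; rewrite /= mul1r mul0r addr0.
  have /derivableP/is_derive_growth_rate := Dt.
  exact: (cvg_comp _ _ (@cvg_invS_dnbhs0 R)).
rewrite (memNset nDt) (mem_set (_ : (~` D) t))//.
rewrite (_ : (fun k => _) = cst (point : R)); last first.
  by apply: funext => k; rewrite /= mul0r mul1r add0r.
rewrite derive_growth_rate dvgP; first exact: cvg_cst.
by move=> c; apply: nDt; exact: (derivable_growth_rate (rv t)).2 c.
Qed.

End measurable_derive.

(** * Calculus of directional derivatives *)

Section is_derive_rV.
Context {R : realType} {m : nat}.
Implicit Types (f g : 'rV[R]_m -> R) (y v : 'rV[R]_m).

Lemma is_derive1_cvg (phi : R -> R) (t d : R) :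
  is_derive t 1 phi d <-> (h^-1 * (phi (t + h) - phi t) @[h --> 0^'] --> d).
Proof.
have E : (fun h : R => h^-1 *: ((phi \o shift t) (h *: (1 : R)) - phi t)) =
    (fun h : R => h^-1 * (phi (t + h) - phi t)).
  by apply: funext => h /=; rewrite [h%:A]mulr1 (addrC h).
split.
  move=> []; rewrite /derivable /derive E => c <-; exact: c.
move=> c; split; rewrite /derivable /derive E; first by apply: cvgP; exact: c.
exact: (cvg_lim _ c).
Qed.

Lemma is_derive_line g y v (t d : R) :
  is_derive t 1 (fun t => g (y + t *: v)) d <-> is_derive (y + t *: v) v g d.
Proof.
apply: iff_trans (is_derive1_cvg _ _ _) (iff_sym (iff_trans (is_derive_growth_rate _ _ _ _) _)).
rewrite (_ : growth_rate g v (y + t *: v) =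
  fun h => h^-1 * (g (y + (t + h) *: v) - g (y + t *: v)))//.
by apply: funext => h; rewrite /growth_rate scalerDl addrA.
Qed.

Lemma is_derive_line0 g y v (d : R) :
  is_derive (0 : R) 1 (fun t => g (y + t *: v)) d <-> is_derive y v g d.
Proof. by have := is_derive_line g y v 0 d; rewrite scale0r addr0. Qed.

Lemma isd_ext f g y v d : (forall z, f z = g z) -> is_derive y v f d -> is_derive y v g d.
Proof. by move=> /funext ->. Qed.

Lemma isd_eq f y v d e : d = e -> is_derive y v f d -> is_derive y v f e.
Proof. by move=> ->. Qed.

Section operations.
Variables (f g : 'rV[R]_m -> R) (y v : 'rV[R]_m) (df dg : R).
Hypotheses (Df : is_derive y v f df) (Dg : is_derive y v g dg).

Lemma isd_cst (c : R) : is_derive y v (fun=> c) 0.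
Proof. exact: is_derive_cst. Qed.

Lemma isdD : is_derive y v (fun z => f z + g z) (df + dg).
Proof. exact: is_deriveD. Qed.

Lemma isdB : is_derive y v (fun z => f z - g z) (df - dg).
Proof. exact: is_deriveB. Qed.

Lemma isdM : is_derive y v (fun z => f z * g z) (df * g y + f y * dg).
Proof.
have -> : df * g y + f y * dg = f y *: dg + g y *: df by rewrite addrC [df * _]mulrC.
exact: (@is_deriveM _ _ f g y v df dg Df Dg).
Qed.

Lemma isdZ (c : R) : is_derive y v (fun z => c * f z) (c * df).
Proof. exact: is_deriveZ. Qed.

Lemma isdV : f y != 0 -> is_derive y v (fun z => (f z)^-1) (- (f y) ^- 2 * df).
Proof.
move=> fy; split; first by apply: derivableV => //; exact: ex_derive.
by rewrite deriveV//; congr (_ *: _); exact: derive_val.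
Qed.

Lemma isd_comp (phi : R -> R) d : is_derive (f y) 1 phi d ->
  is_derive y v (fun z => phi (f z)) (d * df).
Proof.
move=> Dphi; apply/is_derive_line0.
have := (@is_derive_line0 f y v df).2 Df.
apply: is_derive1_comp.
by rewrite scale0r addr0.
Qed.

End operations.

Lemma isdX f y v df n : is_derive y v f df ->
  is_derive y v (fun z => f z ^+ n) (n%:R * f y ^+ n.-1 * df).
Proof.
move=> Df; elim: n => [|n IH].
  rewrite !mul0r; apply: (@isd_ext (fun=> 1)).
  by move=> z; rewrite expr0.
apply: (@isd_ext (fun z => f z * f z ^+ n)); first by move=> z; rewrite exprS.
apply: isd_eq (isdM Df IH).
case: n {IH} => [|n] /=; first by rewrite expr0; ring.
by rewrite -[n.+2]addn1 natrD exprS; ring.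
Qed.

Lemma isd_sum n (h : 'I_n -> 'rV[R]_m -> R) y v (dh : 'I_n -> R) :
  (forall i, is_derive y v (h i) (dh i)) ->
  is_derive y v (fun z => \sum_(i < n) h i z) (\sum_(i < n) dh i).
Proof.
move=> H; rewrite (_ : (fun z => _) = \sum_(i < n) h i); first exact: is_derive_sum.
by apply: funext => z; rewrite fct_sumE.
Qed.

Lemma isd_dotp w y v : is_derive y v (dotp w) (dotp w v).
Proof.
apply/is_derive_line0.
rewrite (_ : (fun t => _) = (fun t : R => dotp w y + t * dotp w v)); last first.
  by apply: funext => t; rewrite dotpDr dotpZr.
apply/is_derive1_cvg.
apply: cvg_near_cst.
apply/near0_dnbhsP; exists 1 => // h /andP[h0 _] /=.
by field; rewrite -normr_gt0.
Qed.

Lemma isd_dotpB x y v : is_derive y v (fun z => dotp (z - x) (z - x)) (2 * dotp v (y - x)).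
Proof.
apply: (@isd_ext (fun z => dotp z z - 2 * dotp x z + dotp x x)).
  by move=> z; rewrite !(dotpBl, dotpBr) (dotpC z x); ring.
rewrite (_ : 2 * _ = 2 * dotp v y - 2 * dotp x v + 0); last first.
  by rewrite dotpBr (dotpC x v); ring.
apply: isdD.
apply: isdB; last by apply: isdZ; exact: isd_dotp.
apply: (@isd_ext (fun z => \sum_i (dotp (delta_mx ord0 i) z * dotp (delta_mx ord0 i) z))).
  by move=> z; apply: eq_bigr => i _; rewrite !(dotpC (delta_mx _ _)) !dotp_delta.
rewrite (_ : 2 * _ = \sum_i (dotp (delta_mx ord0 i) v * dotp (delta_mx ord0 i) y +
   dotp (delta_mx ord0 i) y * dotp (delta_mx ord0 i) v)); last first.
  rewrite mulr_sumr; apply: eq_bigr => i _.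
  by rewrite !(dotpC (delta_mx _ _)) !dotp_delta; ring.
by apply: isd_sum => i; apply: isdM; exact: isd_dotp.
Qed.

Lemma isd_sig_base a x y v : 0 < a ->
  is_derive y v (fun z => Num.sqrt (dotp (z - x) (z - x) + a))
    (dotp v (y - x) / Num.sqrt (dotp (y - x) (y - x) + a)).
Proof.
move=> a0.
have Q0 : 0 < dotp (y - x) (y - x) + a by rewrite ltr_wpDl// dotp_ge0.
have s0 : Num.sqrt (dotp (y - x) (y - x) + a) != 0 by rewrite gt_eqF// sqrtr_gt0.
have DQ : is_derive y v (fun z => dotp (z - x) (z - x) + a) (2 * dotp v (y - x) + 0).
  by apply: isdD; exact: isd_dotpB.
apply: isd_eq (isd_comp DQ (is_derive1_sqrt Q0)).
by rewrite addr0; field.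
Qed.

End is_derive_rV.

(** * Integration over row vectors *)

Section integration.
Context {R : realType} {m : nat}.
Local Notation mT := (measurableTypeR R).
Implicit Types (h k : 'rV[R]_m -> R).

(* [integral_Rn] integrates over tuples; measurability, integrability, the value of
   the integral and almost-everywhere statements are transported along [rv]. *)
Definition mrv h := measurable_fun setT (fun t : m.-tuple mT => h (rv t)).

Definition integ h := (leb m).-integrable setT (fun t : m.-tuple mT => (h (rv t))%:E).

Definition Int h : R := fine (\int[leb m]_t (h (rv t))%:E)%E.

Definition aerv (P : 'rV[R]_m -> Prop) := {ae (leb m), forall t : m.-tuple mT, P (rv t)}.

Lemma integral_RnE h : integ h -> integral_Rn h = (Int h)%:E.
Proof.
move=> ih; rewrite /Int fineK; last exact: integrable_fin_num.
by rewrite /integral_Rn lebE.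
Qed.

Lemma mrvD h k : mrv h -> mrv k -> mrv (fun y => h y + k y).
Proof. exact: measurable_funD. Qed.
Lemma mrvM h k : mrv h -> mrv k -> mrv (fun y => h y * k y).
Proof. exact: measurable_funM. Qed.
Lemma mrvN h : mrv h -> mrv (fun y => - h y).
Proof. by move=> mh; apply: measurableT_comp. Qed.
Lemma mrvB h k : mrv h -> mrv k -> mrv (fun y => h y - k y).
Proof. by move=> mh mk; apply: mrvD => //; exact: mrvN. Qed.
Lemma mrv_cst (c : R) : mrv (fun=> c).
Proof. exact: measurable_cst. Qed.
Lemma mrv_continuous h : (forall y, y != 0 -> {for y, continuous h}) -> mrv h.
Proof. exact: measurable_rv. Qed.

Lemma integ_mrv h : integ h -> mrv h.
Proof. by move=> /measurable_int /measurable_EFinP. Qed.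

Lemma integD h k : integ h -> integ k -> integ (fun y => h y + k y).
Proof. by move=> ih ik; apply: (integrableD _ ih ik). Qed.

Lemma integZ c h : integ h -> integ (fun y => c * h y).
Proof. by move=> ih; apply: (integrableZl _ c ih). Qed.

Lemma IntD h k : integ h -> integ k -> Int (fun y => h y + k y) = Int h + Int k.
Proof.
move=> ih ik; rewrite /Int -fineD ?integrable_fin_num//; congr fine.
exact: (integralD _ ih ik).
Qed.

Lemma IntZ c h : integ h -> Int (fun y => c * h y) = c * Int h.
Proof.
move=> ih; rewrite /Int -[c in RHS]/(fine c%:E) -fineM ?integrable_fin_num//.
by congr fine; apply: (integralZl _ ih).
Qed.

Lemma integN h : integ h -> integ (fun y => - h y).
Proof. by move=> /(integZ (-1)); rewrite (_ : (fun _ => _) = (fun y => - h y))//; apply: funext => y; rewrite mulN1r. Qed.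

Lemma IntN h : integ h -> Int (fun y => - h y) = - Int h.
Proof.
move=> /(IntZ (-1)); rewrite mulN1r => <-; congr Int.
by apply: funext => y; rewrite mulN1r.
Qed.

Lemma integB h k : integ h -> integ k -> integ (fun y => h y - k y).
Proof. by move=> ih ik; apply: integD => //; exact: integN. Qed.

Lemma IntB h k : integ h -> integ k -> Int (fun y => h y - k y) = Int h - Int k.
Proof. by move=> ih ik; rewrite IntD ?IntN//; exact: integN. Qed.

Lemma integ0 : integ (fun=> 0).
Proof. exact: integrable0. Qed.

Lemma Int0 : Int (fun=> 0) = 0.
Proof. by rewrite /Int integral0. Qed.

Lemma integ_sum n (h : 'I_n -> 'rV[R]_m -> R) : (forall i, integ (h i)) ->
  integ (fun y => \sum_(i < n) h i y) /\
  Int (fun y => \sum_(i < n) h i y) = \sum_(i < n) Int (h i).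
Proof.
elim: n h => [|n IH] h ih.
  rewrite big_ord0 (_ : (fun _ => _) = (fun=> 0)); last by apply: funext => y; rewrite big_ord0.
  by split; [exact: integ0|exact: Int0].
rewrite (_ : (fun _ => _) = (fun y => h ord0 y + \sum_(i < n) h (lift ord0 i) y)); last first.
  by apply: funext => y; rewrite big_ord_recl.
have [i1 e1] := IH (fun i => h (lift ord0 i)) (fun i => ih _).
by split; [exact: integD|rewrite IntD// e1 big_ord_recl].
Qed.

Lemma aerv_and P Q : aerv P -> aerv Q -> aerv (fun y => P y /\ Q y).
Proof.
move=> [A [mA A0 PA]] [B [mB B0 QB]].
exists (A `|` B); split; [exact: measurableU|exact: null_set_setU|].
move=> t /= /not_andP[]/= h; [left; exact: PA|right; exact: QB].
Qed.

Lemma aervS (P Q : 'rV[R]_m -> Prop) : (forall y, P y -> Q y) -> aerv P -> aerv Q.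
Proof.
by move=> PQ [A [mA A0 PA]]; exists A; split=> // t nq; apply: PA => /= /PQ.
Qed.

Lemma aervW (P : 'rV[R]_m -> Prop) : (forall y, P y) -> aerv P.
Proof. by move=> H; apply: aeW => t; exact: H. Qed.

Lemma integ_ae_le h k : mrv h -> integ k -> aerv (fun y => `|h y| <= k y) -> integ h.
Proof.
move=> mh ik le.
have mh' : measurable_fun setT (fun t : m.-tuple mT => (h (rv t))%:E).
  by apply/measurable_EFinP.
apply/integrableP; split => //.
have /integrableP[mk] := ik; apply: le_lt_trans.
apply: ae_ge0_le_integral => //; try by apply: measurableT_comp.
case: le => A [mA A0 HA]; exists A; split => // t /= nt; apply: HA => /= ct.
by apply: nt => _; rewrite lee_fin (le_trans ct)// ler_norm.
Qed.

Lemma integ_ae_eq h k : mrv h -> mrv k -> aerv (fun y => h y = k y) ->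
  integ h -> integ k /\ Int k = Int h.
Proof.
move=> mh mk e ih; split.
  have ia : integ (fun y => `|h y|) by exact: integrable_norm ih.
  by apply: (integ_ae_le mk ia); apply: aervS e => y ->.
congr fine; apply: ae_eq_integral => //; try exact/measurable_EFinP.
case: e => A [mA A0 HA]; exists A; split => // t /= nt; apply: HA => /= ct.
by apply: nt => _; rewrite ct.
Qed.

Lemma integ_dct (h_ : nat -> 'rV[R]_m -> R) h k :
  (forall i, mrv (h_ i)) -> mrv h -> integ k ->
  aerv (fun y => h_ i y @[i --> \oo] --> h y) ->
  (forall i, aerv (fun y => `|h_ i y| <= k y)) ->
  integ h /\ (Int (h_ i) @[i --> \oo] --> Int h).
Proof.
move=> mh_ mh ik cv le.
have mh_' i : measurable_fun setT (fun t : m.-tuple mT => (h_ i (rv t))%:E).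
  by apply/measurable_EFinP; exact: mh_.
have mh' : measurable_fun setT (fun t : m.-tuple mT => (h (rv t))%:E).
  by apply/measurable_EFinP; exact: mh.
have [||ih _ cvi] := @dominated_convergence _ _ _ (leb m) setT measurableT
   (fun i t => (h_ i (rv t))%:E) (fun t => (h (rv t))%:E) (fun t => (k (rv t))%:E)
   mh_' mh' _ ik _.
- case: cv => A [mA A0 HA]; exists A; split => // t /= nt; apply: HA => /= ct.
  by apply: nt => _; apply/cvg_EFin => //; exact: nearW.
- have [A [mA A0 HA]] := ae_foralln le.
  exists A; split => // t /= nt; apply: HA => /= ct.
  by apply: nt => i _; rewrite lee_fin.
split=> //; apply/fine_cvg; rewrite fineK//; exact: integrable_fin_num.
Qed.

Lemma integ_affine h (a : R) b : 0 < a -> integ h ->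
  integ (fun y => h (a *: y + b)) /\ Int (fun y => h (a *: y + b)) = a ^- m * Int h.
Proof.
move=> a0 ih.
pose f (t : m.-tuple mT) := (h (rv t))%:E.
pose phi := @tuple_affine R m a (vr b).
have mphi : measurable_fun setT phi by exact: measurable_tuple_affine.
have fE : (fun t : m.-tuple mT => (h (a *: rv t + b))%:E) = f \o phi.
  by apply: funext => t; rewrite /f/= rv_affine.
have /integrableP[mf fi] := ih.
have ge0E (g : m.-tuple mT -> \bar R) : measurable_fun setT g -> (forall t, 0 <= g t)%E ->
    (\int[leb m]_t (g \o phi) t = (a ^- m)%:E * \int[leb m]_t g t)%E.
  by move=> mg g0; exact: ge0_integral_leb_affine.
have ifphi : (leb m).-integrable setT (f \o phi).
  apply/integrableP; split; first exact: measurableT_comp.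
  rewrite (ge0E (fun t => `|f t|%E))//; last exact: measurableT_comp.
  by rewrite lte_mul_pinfty// lee_fin invr_ge0 exprn_ge0// ltW.
split; first by rewrite /integ fE.
rewrite /Int fE -[a ^- m]/(fine (a ^- m)%:E) -fineM//; last exact: integrable_fin_num.
congr fine; rewrite integralE funepos_comp funeneg_comp.
rewrite !ge0E//; [|exact: measurable_funeneg|exact: measurable_funepos].
rewrite -muleBr//; first by rewrite -integralE.
apply: fin_num_adde_defl.
rewrite fin_numN; apply: integrable_fin_num => //; exact: integrable_funeneg.
Qed.

End integration.

(** * Cubes, points and almost everywhere derivability *)

Section null_sets.
Context {R : realType} {m : nat}.
Local Notation mT := (measurableTypeR R).

(** Cubes stand in for Euclidean balls in the dyadic estimates, because [lebesgue_tuple_box] gives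
    their measure exactly. *)
Definition cube (a : R) : set (m.-tuple mT) :=
  [set t | forall i, `[(- a), a]%classic (tnth t i : R)].

Lemma measurable_cube a : measurable (cube a).
Proof.
rewrite (_ : cube a = \bigcap_(i in [set: 'I_m]) ((@tnth _ mT)^~ i @^-1` `[(- a), a]%classic)).
  apply: fin_bigcap_measurable => // i _.
  by rewrite -[X in measurable X]setTI; apply: measurable_tnth => //; exact: measurable_itv.
by apply/seteqP; split => t /= H i; [move=> _|]; exact: H.
Qed.

Lemma leb_cube a : 0 <= a -> leb m (cube a) = (((2 * a) ^+ m)%:E)%E.
Proof.
move=> a0; rewrite -lebE.
rewrite (@lebesgue_tuple_box R m (fun=> `[(- a), a]%classic)); last first.
  by move=> i; exact: measurable_itv.
rewrite lebesgue_measure_itv/= lte_fin.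
rewrite (_ : (if - a < a then _ else _) = (2 * a)%:E).
  by rewrite prodEFin prodr_const card_ord.
case: ltP => h; first by rewrite -EFinD; congr EFin; ring.
have -> : a = 0 by lra.
by rewrite mulr0.
Qed.

Lemma integral_cube a : 0 <= a ->
  (\int[leb m]_t (\1_(cube a) t)%:E = ((2 * a) ^+ m)%:E)%E.
Proof.
move=> a0; rewrite integral_indic//; last exact: measurable_cube.
by rewrite setIT; exact: leb_cube.
Qed.

Lemma aerv_neq (p : 'rV[R]_m) : (0 < m)%N -> aerv (fun y => y != p).
Proof.
move=> m0; exists [set t : m.-tuple mT | forall i, [set (p ord0 i : mT)] (tnth t i)]; split.
- rewrite (_ : [set t | _] = \bigcap_(i in [set: 'I_m]) ((@tnth _ mT)^~ i @^-1` [set (p ord0 i : mT)])).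
    apply: fin_bigcap_measurable => // i _.
    by rewrite -[X in measurable X]setTI; apply: measurable_tnth => //; exact: measurable_set1.
  by apply/seteqP; split => t /= H i; [move=> _|]; exact: H.
- rewrite -lebE (@lebesgue_tuple_box R m (fun i => [set (p ord0 i : mT)])); last by move=> i; exact: measurable_set1.
  rewrite (bigD1 (Ordinal m0))//= (lebesgue_measure_set1) mul0e//.
- move=> t /= /negP; rewrite negbK => /eqP <- i; by rewrite mxE.
Qed.

(** The set of bad points is measurable and meets every line of direction [v] in a null set, so
    [line_null] applies. Only the fixed direction [v] is concerned, not full differentiability. *)
Lemma aerv_derivable (g : 'rV[R]_m -> R) (v : 'rV[R]_m) :
  (forall y, y != 0 -> {for y, continuous g}) -> v != 0 ->
  (forall y, {ae (@lebesgue_measure R), forall s : R, derivable g (y + s *: v) v}) ->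
  aerv (fun y => derivable g y v).
Proof.
move=> cg v0 H.
have mD := measurable_derivable cg v0.
pose E := ~` [set t : m.-tuple mT | derivable g (rv t) v].
have mE : measurable E by exact: measurableC.
exists E; split => //.
have [i vi] := row_neq0 v0.
apply: (@line_null _ _ E (vr v) i) => //; first by rewrite tnth_mktuple.
move=> t.
have mS : measurable [set s : mT | E (tuple_line t (vr v) s)].
  have ml : measurable_fun [set: mT] (fun s : mT => tuple_line t (vr v) s).
    apply: (@measurableT_comp _ _ _ _ _ _ _ _ (fun s : mT => (s, t)) (measurable_tuple_line (vr v))).
    exact: measurable_pair2.
  by rewrite -[X in measurable X]setTI; exact: ml.
apply: measure_negligible => //.
have [A [mA A0 HA]] := H (rv t).
exists A; split; [exact: mA|exact: A0|move=> s Es; apply: HA => /= ds; apply: Es].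
by rewrite /= rv_line.
Qed.

End null_sets.

(** * The integrable majorant *)

Section weight.
Context {R : realType} {p : nat}.
Local Notation mT := (measurableTypeR R).

(* The common integrable majorant: order -p at the origin and order -(p+2) at
   infinity, in dimension p+1. *)
Definition weight (y : 'rV[R]_p.+1) : R := (enorm y ^+ p)^-1 * ((1 + enorm y) ^+ 2)^-1.

Lemma weight_ge0 y : 0 <= weight y.
Proof. by rewrite /weight mulr_ge0// invr_ge0 exprn_ge0// ?addr_ge0// ?enorm_ge0. Qed.

Lemma mrv_weight : mrv weight.
Proof.
apply: mrv_continuous => y y0.
have yp : 0 < enorm y by rewrite enorm_gt0.
have c1 : {for y, continuous (fun y => 1 + enorm y : R)}.
  by apply: contD; [exact: cont_cst|exact: continuous_enorm].
apply: contM; apply: contV; rewrite ?gt_eqF ?exprn_gt0 ?addr_gt0//.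
  by apply: contX; exact: continuous_enorm.
exact: contX.
Qed.

(* The weight is dominated by the sum over k of [G k]: balls of radius 2^-k account
   for the singularity, balls of radius 2^(k+1) for the tail. *)
Let c k : R := 2 ^+ (k.+1 * p).
Let d k : R := (2 ^+ (k * p))^-1 * (2 ^+ (k * 2))^-1.
Let G k (t : p.+1.-tuple mT) : R :=
  c k * \1_(cube (2 ^+ k)^-1) t + d k * \1_(cube (2 ^+ k.+1)) t.

Let c0 k : 0 <= c k. Proof. exact: exprn_ge0. Qed.
Let d0 k : 0 <= d k.
Proof. by rewrite mulr_ge0// invr_ge0 exprn_ge0. Qed.
Let G0 k t : 0 <= G k t.
Proof. by rewrite addr_ge0// mulr_ge0. Qed.

Let mG k : measurable_fun setT (fun t => (G k t)%:E).
Proof.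
apply/measurable_EFinP; apply: measurable_funD; apply: measurable_funM => //;
  apply: measurable_indic; exact: measurable_cube.
Qed.

Let intG k : (\int[leb p.+1]_t (G k t)%:E <= (2 ^+ (2 * p + 4) / (2 ^ k.+1)%:R)%:E)%E.
Proof.
rewrite /G; under eq_integral do rewrite EFinD !EFinM.
have mi a : measurable_fun setT (fun t => (\1_(@cube R p.+1 a) t)%:E : \bar R).
  by apply/measurable_EFinP; apply: measurable_indic; exact: measurable_cube.
rewrite ge0_integralD//; try by move=> t _; rewrite -EFinM lee_fin mulr_ge0.
all: try exact: measurable_funeM.
rewrite !ge0_integralZl//; try by rewrite lee_fin.
rewrite !integral_cube ?exprn_ge0 ?invr_ge0 ?exprn_ge0//.
rewrite -!EFinM -EFinD lee_fin /c /d.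
have x0 : 2 ^+ k != 0 :> R by rewrite expf_neq0.
have X0 : (2 ^+ k) ^+ p != 0 :> R by rewrite expf_neq0.
rewrite natrX mulSn (mulnC 2 p) !(exprD, exprS, expr0, exprM, exprMn, exprVn, mulr1).
set x : R := 2 ^+ k in x0 X0 *; set X : R := x ^+ p in X0 *; set T : R := 2 ^+ p.
have T0 : 0 <= T by exact: exprn_ge0.
have xp : 0 < x by rewrite exprn_gt0.
(* With [T = 2^p] and [x = 2^k], the small cube contributes [2 T^2 / x] and the large one
   [4 T^2 / x]. The bound [8 T^2 / x] is rounded up to the general term of a geometric series of
   ratio 1/2. *)
rewrite [leLHS](_ : _ = 6 * T ^+ 2 / x); last by field; rewrite X0 x0.
rewrite [leRHS](_ : _ = 8 * T ^+ 2 / x); last by field.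
by rewrite ler_pM2r ?invr_gt0// ler_wpM2r ?sqr_ge0// ler_nat.
Qed.

Let dyadic_lt1 (b : R) : 0 < b -> b <= 1 ->
  exists k, (2 ^+ k.+1)^-1 < b <= (2 ^+ k)^-1.
Proof.
move=> b0 b1.
have ex : exists k, (2 ^+ k.+1)^-1 < b.
  have [k kb] := exists_invS_lt b0; exists k; apply: le_lt_trans kb.
  rewrite lef_pV2 ?posrE ?exprn_gt0 ?ltr0n// -natrX ler_nat.
  by apply: ltnW; apply: ltn_expl.
exists (ex_minn ex); case: ex_minnP => k -> /= min.
case: k min => [|k] min; first by rewrite expr0 invr1.
by rewrite leNgt; apply/negP => /min; rewrite ltnn.
Qed.

Let dyadic_gt1 (b : R) : 1 < b -> exists k, 2 ^+ k < b <= 2 ^+ k.+1.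
Proof.
move=> b1.
have ex : exists k, b <= 2 ^+ k.+1.
  exists (Num.bound b); apply: le_trans (ltW (archi_boundP (ltW (lt_trans ltr01 b1)))) _.
  by rewrite -natrX ler_nat; apply/ltnW/ltnW; apply: ltn_expl.
exists (ex_minn ex); case: ex_minnP => k -> /= min.
case: k min => [|k] min; first by rewrite expr0 b1.
by rewrite andbT ltNge; apply/negP => /min; rewrite ltnn.
Qed.

(** The shells are those of the sup norm, so that a shell lies inside a cube. For [|y| <= 1] the
    factor [(1 + |y|)^-2] is bounded by 1 and the inner cube suffices; for [|y| > 1] both factors
    are compared with powers of [2^k]. *)
Let weight_le_dyadic t : rv t != 0 -> exists k, weight (rv t) <= G k t.
Proof.
set y := rv t => y0.
have cubeE a : `|y| <= a -> cube a t.
  move=> ya i; have := coord_le_norm y i; rewrite mxE => h.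
  by rewrite /= in_itv/= -ler_norml (le_trans h).
have b0 : 0 < `|y| by rewrite normr_gt0.
have bE := norm_le_enorm y.
have w1 a : 0 < a -> a < `|y| -> (enorm y ^+ p)^-1 <= (a ^+ p)^-1.
  move=> a0 ay; have ae := lt_le_trans ay bE.
  rewrite lef_pV2 ?posrE ?exprn_gt0//; last exact: lt_trans ae.
  by rewrite lerXn2r ?nnegrE ?enorm_ge0// ltW.
have [b1|b1] := leP `|y| 1.
  have [k /andP[k1 k2]] := @dyadic_lt1 _ b0 b1; exists k.
  rewrite /G indicE mem_set; last exact: cubeE.
  rewrite mulr1; apply: ler_wpDr; first by rewrite mulr_ge0.
  rewrite /weight -[leRHS]mulr1; apply: ler_pM.
  - by rewrite invr_ge0 exprn_ge0// enorm_ge0.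
  - by rewrite invr_ge0 exprn_ge0// addr_ge0// enorm_ge0.
  - have := w1 _ _ k1; rewrite invr_gt0 exprn_gt0// => /(_ isT).
    by rewrite exprVn invrK /c -exprM.
  - rewrite invf_le1 ?exprn_gt0 ?exprn_ege1 ?lerDl ?enorm_ge0//.
    by rewrite ltr_pwDl// enorm_ge0.
have [k /andP[k1 k2]] := @dyadic_gt1 _ b1; exists k.
rewrite /G [X in _ <= _ + _ * X]indicE mem_set; last exact: cubeE.
rewrite mulr1; apply: ler_wpDl; first by rewrite mulr_ge0.
rewrite /weight /d; apply: ler_pM.
- by rewrite invr_ge0 exprn_ge0// enorm_ge0.
- by rewrite invr_ge0 exprn_ge0// addr_ge0// enorm_ge0.
- have := w1 _ _ k1; rewrite exprn_gt0// => /(_ isT).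
  by rewrite -exprM.
- rewrite exprM lef_pV2 ?posrE ?exprn_gt0//; last first.
    by rewrite ltr_pwDl// enorm_ge0.
  rewrite lerXn2r ?nnegrE ?addr_ge0 ?enorm_ge0 ?exprn_ge0//.
  by rewrite ltW// (lt_le_trans k1)// (le_trans bE)// lerDr.
Qed.

Lemma integ_weight : integ weight.
Proof.
apply/integrableP; split; first by apply/measurable_EFinP; exact: mrv_weight.
apply: (@le_lt_trans _ _ (\int[leb p.+1]_t (\sum_(k <oo) (G k t)%:E))%E).
  apply: ae_ge0_le_integral => //.
  - by apply: measurableT_comp => //; apply/measurable_EFinP; exact: mrv_weight.
  - by move=> t _; apply: nneseries_ge0 => k _ _; rewrite lee_fin.
  - apply: (emeasurable_fun_cvg (fun n t => \sum_(0 <= k < n) (G k t)%:E)%E).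
      by move=> n; apply: emeasurable_sum => k; exact: mG.
    move=> t _; apply: ereal_nondecreasing_is_cvgn.
    by apply: ereal_nondecreasing_series => k _ _; rewrite lee_fin.
  - have [A [mA A0 HA]] := @aerv_neq R p.+1 0 isT.
    exists A; split => // t /= nt; apply: HA => /= t0; apply: nt => _.
    rewrite ?gee0_abs ?lee_fin ?ger0_norm ?weight_ge0//.
    have [k wk] := weight_le_dyadic t0.
    apply: le_trans (nneseries_lim_ge k.+1 _); last by move=> i _ _; rewrite lee_fin.
    apply: (@le_trans _ _ (G k t)%:E); first by rewrite lee_fin.
    rewrite big_nat_recr//= leeDr//.
    by apply: sume_ge0 => i _; rewrite lee_fin.
rewrite integral_nneseries//; last by move=> k t _; rewrite lee_fin.
apply: (@le_lt_trans _ _ (\sum_(k <oo) (2 ^+ (2 * p + 4) / (2 ^ (k + 1))%:R)%:E)%E).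
  apply: lee_nneseries; first by move=> k _ _; apply: integral_ge0 => t _; rewrite lee_fin.
  by move=> k _; rewrite addn1; exact: intG.
have := @cvg_geometric_eseries_half R (2 ^+ (2 * p + 4)) 0.
by move=> /cvg_lim ->//; rewrite ltry.
Qed.

End weight.

(** * Lipschitz bounds at the scale of the distance to the origin *)

Section slip.
Context {R : realType} {m : nat}.
Implicit Types (W : R -> R) (g : 'rV[R]_m -> R).

(* [g] is bounded by [W(|y|)] and, at the scale [|y|], it is Lipschitz with
   constant [W(|y|) / |y|], as if it were differentiable with a derivative one
   order smaller. *)
Definition slip W g := exists2 C, 0 <= C &
  (forall y, y != 0 -> `|g y| <= C * W (enorm y)) /\
  (forall y z, y != 0 -> enorm (y - z) <= enorm y / 2 ->
     `|g y - g z| <= C * W (enorm y) * (enorm (y - z) / enorm y)).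

Lemma slip_le W W' K g : 0 <= K -> (forall r, 0 < r -> W r <= K * W' r) ->
  slip W g -> slip W' g.
Proof.
move=> K0 WW' [C C0 [b l]]; exists (C * K); first exact: mulr_ge0.
have hW y : y != 0 -> C * W (enorm y) <= C * K * W' (enorm y).
  by move=> y0; rewrite -mulrA ler_wpM2l// WW'// enorm_gt0.
split=> [y y0|y z y0 yz]; first by apply: le_trans (b _ y0) _; exact: hW.
apply: le_trans (l _ _ y0 yz) _; rewrite ler_wpM2r ?hW//.
by rewrite divr_ge0 ?enorm_ge0.
Qed.

Lemma slipZ W g c : slip W g -> slip W (fun y => c * g y).
Proof.
move=> [C C0 [b l]]; exists (`|c| * C); first exact: mulr_ge0.
split=> [y y0|y z y0 yz]; first by rewrite normrM -mulrA ler_wpM2l// b.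
rewrite -mulrBr normrM -(mulrA _ C) -(mulrA `|c|) ler_wpM2l//; exact: l.
Qed.

Lemma slipD W g1 g2 : slip W g1 -> slip W g2 -> slip W (fun y => g1 y + g2 y).
Proof.
move=> [C C0 [b l]] [D D0 [b' l']]; exists (C + D); first exact: addr_ge0.
split=> [y y0|y z y0 yz].
  by rewrite mulrDl; apply: le_trans (ler_normD _ _) _; rewrite lerD ?b ?b'.
rewrite opprD addrACA !mulrDl; apply: le_trans (ler_normD _ _) _.
by rewrite lerD ?l ?l'.
Qed.

(** The increment of the product is expanded around [y], since the bounds refer to [y] only. The
    value [g2 z] is rewritten as [g2 y - (g2 y - g2 z)] and costs a factor 2, because
    [|y - z| <= |y|]; whence the constant 3. *)
Lemma slipM W1 W2 g1 g2 : slip W1 g1 -> slip W2 g2 ->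
  slip (fun r => W1 r * W2 r) (fun y => g1 y * g2 y).
Proof.
move=> [C C0 [b l]] [D D0 [b' l']]; exists (3 * (C * D)).
  by rewrite !mulr_ge0.
split=> [y y0|y z y0 yz].
  rewrite normrM; apply: (@le_trans _ _ ((C * W1 (enorm y)) * (D * W2 (enorm y)))).
    by apply: ler_pM => //; [exact: b|exact: b'].
  rewrite [leRHS](_ : _ = 3 * ((C * W1 (enorm y)) * (D * W2 (enorm y)))); last by ring.
  rewrite ler_peMl ?ler1n//.
  rewrite mulr_ge0//; first exact: le_trans (normr_ge0 _) (b _ y0).
  exact: le_trans (normr_ge0 _) (b' _ y0).
have A0 := le_trans (normr_ge0 _) (b _ y0).
have B0 := le_trans (normr_ge0 _) (b' _ y0).
have yp : 0 < enorm y by rewrite enorm_gt0.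
have := l _ _ y0 yz; have := l' _ _ y0 yz; have := b _ y0; have := b' _ y0.
set A := C * W1 _ in A0 *; set B := D * W2 _ in B0 *.
set e := enorm (y - z) / enorm y.
have e0 : 0 <= e by rewrite divr_ge0 ?enorm_ge0.
have e1 : e <= 1 by rewrite ler_pdivrMr// mul1r; move: yz; lra.
move=> h1 h2 h3 h4.
have -> : g1 y * g2 y - g1 z * g2 z =
  g1 y * (g2 y - g2 z) + (g1 y - g1 z) * (g2 y - (g2 y - g2 z)) by ring.
apply: le_trans (ler_normD _ _) _; rewrite !normrM.
have h5 : `|g2 y - (g2 y - g2 z)| <= B + B.
  apply: le_trans (ler_normB _ _) _; apply: lerD => //.
  by apply: le_trans h3 _; rewrite ler_piMr.
have -> : 3 * (C * D) * (W1 (enorm y) * W2 (enorm y)) * e = A * (B * e) + A * e * (B + B).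
  by rewrite /A /B; ring.
by apply: lerD; apply: ler_pM.
Qed.

Lemma slipX W g n : slip W g -> slip (fun r => W r ^+ n.+1) (fun y => g y ^+ n.+1).
Proof.
move=> sg; elim: n => [|n IH]; first exact: sg.
rewrite (_ : (fun r => _) = fun r => W r * W r ^+ n.+1); last first.
  by apply: funext => r; rewrite exprS.
rewrite (_ : (fun y => _) = fun y => g y * g y ^+ n.+1); last first.
  by apply: funext => y; rewrite exprS.
exact: slipM.
Qed.

Lemma slip_cont W g y : slip W g -> y != 0 -> {for y, continuous g}.
Proof.
move=> [C C0 [b l]] y0; apply/continuous_enormP => e e0.
have yp : 0 < enorm y by rewrite enorm_gt0.
set K := C * W (enorm y) / enorm y.
have K0 : 0 <= K by rewrite divr_ge0 ?enorm_ge0// (le_trans (normr_ge0 _) (b _ y0)).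
exists (Num.min (enorm y / 2) (e / (K + 1))).
  by rewrite lt_min !divr_gt0// ltr_wpDl.
move=> z; rewrite le_min => /andP[z1 z2].
rewrite distrC; apply: le_trans (l _ _ y0 _) _; first by rewrite enorm_dist.
rewrite ler_pdivlMr in z2; last by rewrite ltr_wpDl.
rewrite [leLHS](_ : _ = K * enorm (z - y)); last by rewrite enorm_dist /K; ring.
apply: le_trans z2; rewrite mulrC ler_wpM2l ?enorm_ge0//.
by rewrite lerDl.
Qed.

Lemma slip_enorm : slip id (@enorm R m).
Proof.
exists 1; [exact: ler01|split=> [y y0|y z y0 yz]].
  by rewrite ger0_norm ?enorm_ge0// mul1r.
rewrite mul1r mulrCA divff ?mulr1 ?enorm_eq0//; exact: enormB_dist.
Qed.

(* A smooth regularization of 1 / |y - x|. *)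
Definition sig (a : R) (x y : 'rV[R]_m) : R := (Num.sqrt (dotp (y - x) (y - x) + a))^-1.

Lemma sig_gt0 a x y : 0 < a -> 0 < sig a x y.
Proof. by move=> a0; rewrite invr_gt0 sqrtr_gt0 ltr_wpDl// dotp_ge0. Qed.

(** The inverse of [sig] is the length of the vector [(y - x, sqrt a)], hence 1-Lipschitz in [y].
    Concretely, [(s - t)(s + t) = (b - c)(b + c)] with [b <= s] and [c <= t]. *)
Lemma sig_lip a x y z : 0 < a ->
  `|(sig a x y)^-1 - (sig a x z)^-1| <= enorm (y - z).
Proof.
move=> a0; rewrite /sig !invrK.
have sE w : Num.sqrt (dotp (w - x) (w - x) + a) ^+ 2 = enorm (w - x) ^+ 2 + a.
  by rewrite sqr_sqrtr ?sqr_enorm// addr_ge0 ?dotp_ge0// ltW.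
have sP w : 0 < Num.sqrt (dotp (w - x) (w - x) + a).
  by rewrite sqrtr_gt0 ltr_wpDl// dotp_ge0.
have sge w : enorm (w - x) <= Num.sqrt (dotp (w - x) (w - x) + a).
  by rewrite -(@ler_pXn2r _ 2)// ?nnegrE ?enorm_ge0 ?(ltW (sP _))// sE lerDl ltW.
have := enormB_dist (y - x) (z - x).
rewrite (_ : y - x - (z - x) = y - z); last by rewrite opprB addrA subrK.
have := sE y; have := sE z; have := sP y; have := sP z; have := sge y; have := sge z.
have := enorm_ge0 (y - x); have := enorm_ge0 (z - x).
set t := Num.sqrt _; set s := Num.sqrt _; set b := enorm (y - x); set c := enorm (z - x).
move=> c0 b0 tc sb t0 s0 tE sE' bc.
have st : (s - t) * (s + t) = (b - c) * (b + c).
  by rewrite -!subr_sqr sE' tE; ring.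
rewrite -(@ler_pM2r _ (s + t)) ?addr_gt0//.
rewrite -[in leLHS](gtr0_norm (addr_gt0 s0 t0)) -normrM st normrM.
rewrite (ger0_norm (addr_ge0 b0 c0)); apply: ler_pM => //; first exact: addr_ge0.
exact: lerD.
Qed.

Lemma slip_sig a x : 0 < a -> slip (fun r => (1 + r)^-1) (sig a x).
Proof.
move=> a0.
set e := Num.sqrt a; have e0 : 0 < e by rewrite sqrtr_gt0.
(* From [1 + |y| <= (1 + |x|) + |y - x|]: the first term is at most [(1 + |x|) / e] times [1 / sig],
   since [e <= 1 / sig], and the second is at most [1 / sig]. *)
pose K := (1 + enorm x) / e + 1.
have K1 : 1 <= K by rewrite lerDr divr_ge0 ?addr_ge0 ?enorm_ge0// ltW.
have K0 : 0 < K by exact: lt_le_trans K1.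
have sP y := sig_gt0 x y a0.
have sK y : 1 + enorm y <= K * (sig a x y)^-1.
  have h1 : e <= (sig a x y)^-1.
    by rewrite /sig invrK ler_wsqrtr// lerDr dotp_ge0.
  have h2 : enorm (y - x) <= (sig a x y)^-1.
    by rewrite /sig invrK /enorm ler_wsqrtr// lerDl ltW.
  have h3 := enormB_le y x.
  rewrite /K mulrDl mul1r -mulrA.
  have h4 : 1 + enorm x <= (1 + enorm x) * (e^-1 * (sig a x y)^-1).
    rewrite ler_peMr ?addr_ge0 ?enorm_ge0//.
    by rewrite mulrC ler_pdivlMr// mul1r.
  by lra.
have sK' y : sig a x y <= K * (1 + enorm y)^-1.
  have y1 : 0 < 1 + enorm y by rewrite ltr_pwDl// enorm_ge0.
  have siP : 0 < (sig a x y)^-1 by rewrite /sig invrK sqrtr_gt0 ltr_wpDl// dotp_ge0.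
  rewrite ler_pdivlMr// -(ler_pM2r siP).
  by rewrite mulrAC divff ?gt_eqF// mul1r sK.
exists (2 * K ^+ 2); first by rewrite mulr_ge0// sqr_ge0.
split=> [y y0|y z y0 yz].
  rewrite gtr0_norm//; apply: le_trans (sK' y) _; rewrite ler_wpM2r//.
    by rewrite invr_ge0 addr_ge0// enorm_ge0.
  by rewrite expr2; nra.
have -> : sig a x y - sig a x z = - ((sig a x y * sig a x z) * ((sig a x y)^-1 - (sig a x z)^-1)).
  by field; rewrite !gt_eqF.
have yp : 0 < enorm y by rewrite enorm_gt0.
rewrite normrN normrM normrM (gtr0_norm (sP y)) (gtr0_norm (sP z)).
have zh : enorm y / 2 <= enorm z.
  by have := enormB_le y z; move: yz; lra.
have h1 : sig a x z <= 2 * K * (1 + enorm y)^-1.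
  apply: le_trans (sK' z) _; rewrite mulrC [leRHS]mulrC mulrA ler_wpM2r ?(ltW K0)//.
  rewrite -[2]invrK -invfM lef_pV2 ?posrE; last 2 first.
    by rewrite ltr_pwDl// enorm_ge0.
    by rewrite mulr_gt0// ltr_pwDl// enorm_ge0.
  by move: zh; lra.
have h2 : (1 + enorm y)^-1 <= (enorm y)^-1.
  by rewrite lef_pV2 ?posrE ?ltr_pwDl ?enorm_ge0// lerDr.
have y1 : 0 <= (1 + enorm y)^-1 by rewrite invr_ge0 addr_ge0// enorm_ge0.
rewrite (_ : 2 * K ^+ 2 * (1 + enorm y)^-1 * (enorm (y - z) / enorm y) =
   (K * (1 + enorm y)^-1) * (2 * K * (enorm y)^-1) * enorm (y - z)); last by ring.
apply: ler_pM => //; last exact: sig_lip.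
  by rewrite mulr_ge0// ltW.
apply: ler_pM => //; try exact: ltW.
by apply: le_trans h1 _; rewrite ler_wpM2l// mulr_ge0// ltW.
Qed.

End slip.

(** * The integral of a directional derivative vanishes *)

Section divergence.
Context {R : realType} {p : nat}.
Implicit Types (g G : 'rV[R]_p.+1 -> R) (v : 'rV[R]_p.+1).

Lemma cont_lip m (G : 'rV[R]_m -> R) L : 0 <= L ->
  (forall y z, `|G y - G z| <= L * enorm (y - z)) -> continuous G.
Proof.
move=> L0 GL y; apply/continuous_enormP => e e0.
have L1 : 0 < L + 1 by rewrite ltr_wpDl.
exists (e / (L + 1)); first by rewrite divr_gt0.
move=> z; rewrite ler_pdivlMr// => zy.
apply: le_trans (GL _ _) _; apply: le_trans _ zy.
by rewrite mulrC ler_wpM2l ?enorm_ge0// lerDl.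
Qed.

Lemma aerv_derivable_lip G L v : 0 <= L -> v != 0 ->
  (forall y z, `|G y - G z| <= L * enorm (y - z)) ->
  aerv (fun y => derivable G y v).
Proof.
move=> L0 v0 GL.
apply: aerv_derivable => //; first by move=> y _; exact: cont_lip GL y.
move=> y.
have [||A [mA A0 HA]] :=
  @lipschitz_ae_derivable R (fun t => G (y + t *: v)) (L * enorm v).
- by rewrite mulr_ge0// enorm_ge0.
- move=> s t; apply: le_trans (GL _ _) _.
  rewrite (_ : y + s *: v - (y + t *: v) = (s - t) *: v).
    by rewrite enormZ mulrAC mulrA.
  by rewrite opprD addrACA subrr add0r scalerBl.
exists A; split; [exact: mA|exact: A0|].
move=> s ns; apply: HA => /= ds; apply: ns.
apply/derivable_growth_rate.
rewrite (_ : growth_rate G v (y + s *: v) = fun h : R =>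
  h^-1 *: (((fun t => G (y + t *: v)) \o shift s) (h *: 1) - G (y + s *: v))).
  exact: ds.
apply: funext => h; rewrite /growth_rate /=; congr (_ * (G _ - _)).
by rewrite [h%:A]mulr1 scalerDl -addrA (addrC (s *: v)).
Qed.

Lemma growth_rate_bound m (g : 'rV[R]_m -> R) (v y : 'rV[R]_m) (B d : R) : 0 < d ->
  derivable g y v ->
  (forall h, 0 < `|h| < d -> `|growth_rate g v y h| <= B) -> `|'D_v g y| <= B.
Proof.
move=> d0 dg H.
have := (@is_derive_growth_rate _ _ g v y ('D_v g y)).1 (derivableP dg).
move=> cv; rewrite -(cvg_lim (@Rhausdorff R) (cvg_norm cv)).
apply: limr_le; first by apply: cvgP; exact: cvg_norm cv.
by apply/near0_dnbhsP; exists d.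
Qed.

(** Order 1 at the origin makes a function globally Lipschitz across it; order [-(p+2)] at infinity
    makes its difference quotients integrable uniformly in the increment. *)
Let W1 (r : R) := r * ((1 + r) ^+ p.+3)^-1.

(** Close pairs are covered by [slip]. Otherwise [|y| < 2 |y - z|] and [|z| < 3 |y - z|], and the
    bound [|G y| <= C |y|] at both points gives the constant [5 C]. *)
Let slip_W1_lip G : slip W1 G -> G 0 = 0 ->
  exists2 L, 0 <= L & forall y z, `|G y - G z| <= L * enorm (y - z).
Proof.
move=> [C C0 [b l]] G0.
have W1le r : 0 <= r -> W1 r <= r.
  move=> r0; rewrite /W1 ler_piMr// invf_le1 ?exprn_gt0 ?ltr_pwDl//.
  by rewrite exprn_ege1// lerDl.
have b' y : `|G y| <= C * enorm y.
  have [->|y0] := eqVneq y 0; first by rewrite G0 normr0 enorm0 mulr0.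
  by apply: le_trans (b _ y0) _; rewrite ler_wpM2l// W1le// enorm_ge0.
exists (5 * C); first exact: mulr_ge0.
move=> y z; have [yz|yz] := leP (enorm (y - z)) (enorm y / 2).
  have [y0|y0] := eqVneq y 0.
    move: yz; rewrite y0 enorm0 mul0r => yz.
    have : enorm (0 - z) == 0 by rewrite eq_le yz enorm_ge0.
    by rewrite enorm_eq0 sub0r oppr_eq0 => /eqP ->; rewrite !subrr normr0 mulr_ge0 ?enorm_ge0// mulr_ge0.
  apply: le_trans (l _ _ y0 yz) _.
  apply: (@le_trans _ _ (C * enorm y * (enorm (y - z) / enorm y))).
    rewrite ler_wpM2r ?divr_ge0 ?enorm_ge0// ler_wpM2l// W1le//; exact: enorm_ge0.
  rewrite [leLHS](_ : _ = C * enorm (y - z)); last by field; rewrite enorm_eq0.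
  rewrite ler_wpM2r ?enorm_ge0// ler_peMl//.
  by rewrite ler1n.
have := b' y; have := b' z; have := enormD (z - y) y; rewrite subrK enorm_dist => h1 h2 h3.
apply: le_trans (ler_normB _ _) _.
have : C * enorm z <= C * (3 * enorm (y - z)) by rewrite ler_wpM2l//; lra.
have : C * enorm y <= C * (2 * enorm (y - z)) by rewrite ler_wpM2l//; lra.
by lra.
Qed.

Lemma le_weight (y : 'rV[R]_p.+1) : y != 0 -> ((1 + enorm y) ^+ p.+2)^-1 <= weight y.
Proof.
move=> y0; have yp : 0 < enorm y by rewrite enorm_gt0.
have y1 : 0 < 1 + enorm y by rewrite addr_gt0.
have e1 k : 0 < (1 + enorm y) ^+ k by exact: exprn_gt0.
have e2 k : 0 < enorm y ^+ k by exact: exprn_gt0.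
rewrite /weight -invfM lef_pV2 ?posrE ?(mulr_gt0 (e2 _) (e1 _)) ?e1//.
have y1' := ltW y1; have yp' := ltW yp.
rewrite -[p.+2]addn2 exprD ler_wpM2r ?exprn_ge0//.
by rewrite lerXn2r ?nnegrE// lerDr.
Qed.

Let slip_W1_int0 G v : slip W1 G -> G 0 = 0 -> v != 0 ->
  [/\ aerv (fun y => derivable G y v), integ ('D_v G) & Int ('D_v G) = 0].
Proof.
move=> sG G0 v0.
have [L L0 GL] := slip_W1_lip sG G0.
have cG := cont_lip L0 GL.
have mG : mrv G by apply: mrv_continuous => y _; exact: cG.
have dG := aerv_derivable_lip L0 v0 GL.
have vp : 0 < enorm v by rewrite enorm_gt0.
have [C C0 [b l]] := sG.
have n0 : aerv (fun y : 'rV[R]_p.+1 => y != 0) by exact: aerv_neq.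
have iG : integ G.
  apply: (@integ_ae_le _ _ G _ mG (integZ C integ_weight)).
  apply: aervS n0 => y y0; apply: le_trans (b _ y0) _; rewrite ler_wpM2l//.
  apply: le_trans _ (le_weight y0); rewrite /W1 exprS invfM mulrA.
  have y1 : 0 < 1 + enorm y by rewrite ltr_pwDl// enorm_ge0.
  rewrite ler_piMl ?invr_ge0 ?exprn_ge0 ?(ltW y1)//.
  by rewrite ler_pdivrMr// mul1r lerDr.
(* The first entry serves increments with [|h v| <= |y|/2]. For longer ones with [|h| <= 1], one has
   [|y| < 2 |v|], and the factor [(1 + 2 |v|)^(p+2)] compensates for the decay asked of the
   majorant. *)
pose K := Num.max (C * enorm v) (L * enorm v * (1 + 2 * enorm v) ^+ p.+2).
have K0 : 0 <= K by rewrite le_max mulr_ge0// ltW.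
have GK y h : y != 0 -> 0 < `|h| <= 1 -> `|growth_rate G v y h| <= K * ((1 + enorm y) ^+ p.+2)^-1.
  move=> y0 /andP[h0 h1].
  have y1 : 0 < 1 + enorm y by rewrite ltr_pwDl// enorm_ge0.
  have yp : 0 < enorm y by rewrite enorm_gt0.
  rewrite /growth_rate normrM normfV mulrC ler_pdivrMr//.
  have eh : enorm (y - (y + h *: v)) = `|h| * enorm v.
    by rewrite opprD addrA subrr add0r enormN enormZ.
  rewrite distrC; have [yh|yh] := leP (`|h| * enorm v) (enorm y / 2).
    rewrite -eh in yh; apply: le_trans (l _ _ y0 yh) _.
    rewrite eh /W1.
    rewrite [leLHS](_ : _ = (C * enorm v) * ((1 + enorm y) ^+ p.+3)^-1 * `|h|); last first.
      by field; rewrite !gt_eqF ?exprn_gt0.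
    rewrite ler_wpM2r//; apply: ler_pM => //.
    - by rewrite mulr_ge0// ltW.
    - by rewrite invr_ge0 exprn_ge0// ltW.
    - by rewrite le_max lexx.
    - rewrite lef_pV2 ?posrE ?exprn_gt0// [leRHS]exprS ler_peMl ?exprn_ge0 ?(ltW y1)//.
      by rewrite lerDl enorm_ge0.
  apply: le_trans (GL _ _) _; rewrite eh.
  rewrite [leLHS](_ : _ = L * enorm v * `|h|); last by ring.
  rewrite ler_wpM2r//.
  apply: (@le_trans _ _ (L * enorm v * (1 + 2 * enorm v) ^+ p.+2 * ((1 + enorm y) ^+ p.+2)^-1)).
    rewrite ler_pdivlMr ?exprn_gt0// ler_wpM2l ?mulr_ge0 ?(ltW vp)//.
    rewrite lerXn2r ?nnegrE ?addr_ge0 ?mulr_ge0 ?enorm_ge0// lerD2l.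
    have : `|h| * enorm v <= enorm v by rewrite ler_piMl// ltW.
    by move: yh; lra.
  by rewrite ler_wpM2r ?invr_ge0 ?exprn_ge0 ?(ltW y1)// le_max lexx orbT.
pose q (k : nat) y := growth_rate G v y k.+1%:R^-1.
have iGs h : integ (fun y => G (y + h *: v)) /\ Int (fun y => G (y + h *: v)) = Int G.
  have := @integ_affine _ _ G 1 (h *: v) ltr01 iG.
  rewrite expr1n invr1 mul1r (_ : (fun y => G (1 *: y + h *: v)) = (fun y => G (y + h *: v)))//.
  by apply: funext => y; rewrite scale1r.
have q0 k : Int (q k) = 0.
  have [i1 e1] := iGs k.+1%:R^-1.
  by rewrite /q /growth_rate IntZ ?IntB ?e1 ?subrr ?mulr0//; exact: integB.
have [] := @integ_dct _ _ q ('D_v G) (fun y => K * weight y).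
- move=> k; apply: mrvM; first exact: mrv_cst.
  by apply: mrvB => //; apply: integ_mrv; exact: (iGs _).1.
- by apply: measurable_derive => // y _; exact: cG.
- exact: integZ integ_weight.
- apply: aervS dG => y dy.
  apply: (cvg_comp _ _ (@cvg_invS_dnbhs0 R)).
  exact: (@is_derive_growth_rate _ _ G v y ('D_v G y)).1 (derivableP dy).
- move=> k; apply: aervS n0 => y y0.
  apply: le_trans (GK y _ y0 _) _.
    by rewrite gtr0_norm ?invr_gt0// invf_le1// ler1n andbT.
  by rewrite ler_wpM2l// le_weight.
move=> iD cv; split => //.
have : Int (q i) @[i --> \oo] --> 0.
  by rewrite (_ : (fun i => Int (q i)) = cst 0); [exact: cvg_cst|apply: funext => k; exact: q0].
by move=> cv0; exact: cvg_unique cv cv0.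
Qed.

(* A cut-off of order |y|^2 at the origin and |y|^-2 at infinity, which tends to 1
   off the origin as a tends to 0. *)
Definition omega (a : R) (y : 'rV[R]_p.+1) : R :=
  dotp y y / ((dotp y y + a) * (1 + a * dotp y y)).

Lemma sig_sqr m (a : R) (x y : 'rV[R]_m) : 0 < a ->
  sig a x y ^+ 2 = (dotp (y - x) (y - x) + a)^-1.
Proof. by move=> a0; rewrite exprVn sqr_sqrtr// addr_ge0 ?dotp_ge0// ltW. Qed.

Let omega_den (a : R) (y : 'rV[R]_p.+1) : 0 < a -> (0 < dotp y y + a) && (0 < 1 + a * dotp y y).
Proof.
move=> a0; rewrite ltr_wpDl ?dotp_ge0//= ltr_pwDl//.
by rewrite mulr_ge0 ?dotp_ge0// ltW.
Qed.

(** Since [1 + a |y|^2 = a (|y|^2 + 1/a)], the cut-off is [|y|^2] times the squares of two kernels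
    [sig] centred at 0, with parameters [a] and [1/a]; the rules for products do the rest. *)
Lemma slip_omega a : 0 < a -> slip (fun r => r ^+ 2 * ((1 + r) ^+ 4)^-1) (omega a).
Proof.
move=> a0; have ia0 : 0 < a^-1 by rewrite invr_gt0.
have := slipM (slipX 1 (@slip_enorm R p.+1))
  (slipM (slipX 1 (slip_sig 0 a0)) (slipZ a^-1 (slipX 1 (slip_sig 0 ia0)))).
rewrite (_ : (fun y => _ * _) = omega a); last first.
  apply: funext => y; rewrite !sig_sqr// subr0 sqr_enorm /omega.
  have /andP[h1 h2] := omega_den y a0.
  have h3 : 0 < dotp y y + a^-1 by rewrite ltr_wpDl// dotp_ge0.
  by field; rewrite !gt_eqF.
apply: (@slip_le _ _ _ _ 1) => // r r0; rewrite mul1r.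
rewrite -exprD -exprVn; exact: lexx.
Qed.

Let omega_le1 a y : 0 < a -> `|omega a y| <= 1.
Proof.
move=> a0; have /andP[h1 h2] := omega_den y a0; have := dotp_ge0 y.
rewrite /omega => q0; rewrite ger0_norm ?divr_ge0 ?mulr_ge0 ?(ltW h1) ?(ltW h2)//.
rewrite ler_pdivrMr ?mulr_gt0// mul1r.
have : 0 <= a * dotp y y by rewrite mulr_ge0// ltW.
by move: h1 h2 q0 a0; set q := dotp y y; nra.
Qed.

Let domega (a : R) (y v : 'rV[R]_p.+1) := a * (1 - dotp y y ^+ 2) / ((dotp y y + a) * (1 + a * dotp y y)) ^+ 2 * (2 * dotp v y).

Let isd_omega a y v : 0 < a -> is_derive y v (omega a) (domega a y v).
Proof.
move=> a0; have /andP[h1 h2] := omega_den y a0.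
have Dq : is_derive y v (fun z => dotp z z) (2 * dotp v y).
  have := isd_dotpB 0 y v; rewrite subr0; apply: isd_ext => z.
  by rewrite subr0.
have Dq1 := isdD Dq (isd_cst y v a).
have Dq2 := isdD (isd_cst y v 1) (isdZ Dq a).
have Dd := isdM Dq1 Dq2.
have d0 : (dotp y y + a) * (1 + a * dotp y y) != 0.
  by rewrite gt_eqF// mulr_gt0.
have := isdM Dq (isdV Dd d0); apply: isd_eq.
rewrite /domega; field.
by rewrite !gt_eqF.
Qed.

(** The bound does not depend on [a], as dominated convergence requires. With [q = |y|^2] it amounts
    to [a q (1 + q^2) <= (q + a)^2 (1 + a q)^2], which follows from [(q + a)^2 >= 2 a q + q^2] and
    [(1 + a q)^2 >= 1 + 2 a q]. *)
Let domega_le a y v : 0 < a -> y != 0 -> `|domega a y v| <= 2 * enorm v / enorm y.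
Proof.
move=> a0 y0; have /andP[h1 h2] := omega_den y a0.
have yp : 0 < enorm y by rewrite enorm_gt0.
rewrite /domega normrM (normrM 2) (ger0_norm (_ : (0 : R) <= 2))// mulrC.
have dv := dotp_le v y.
apply: (@le_trans _ _ (2 * (enorm v * enorm y) * (enorm y ^+ 2)^-1)); last first.
  by rewrite le_eqVlt; apply/orP; left; apply/eqP; field; rewrite gt_eqF.
apply: ler_pM => //; first by rewrite ler_wpM2l.
rewrite sqr_enorm.
have q0 : 0 < dotp y y by rewrite -sqr_enorm exprn_gt0.
have d0 : 0 < ((dotp y y + a) * (1 + a * dotp y y)) ^+ 2 by rewrite exprn_gt0// mulr_gt0.
rewrite normrM normfV (gtr0_norm d0) ler_pdivrMr// -ler_pdivrMl ?invr_gt0// invrK.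
rewrite normrM (gtr0_norm a0).
set q := dotp y y in q0 *.
have : `|1 - q ^+ 2| <= 1 + q ^+ 2.
  by apply: le_trans (ler_normB _ _) _; rewrite normr1 ger0_norm// sqr_ge0.
have aq : 0 < a * q by exact: mulr_gt0.
move=> H; apply: (@le_trans _ _ (a * q * (1 + q ^+ 2))).
  by rewrite mulrA (mulrC q) ler_wpM2l// ltW.
rewrite exprMn; have e1 : 2 * (a * q) + q ^+ 2 <= (q + a) ^+ 2.
  by have := sqr_ge0 a; rewrite sqrrD; lra.
have e2 : 1 + 2 * (a * q) <= (1 + a * q) ^+ 2.
  by have := sqr_ge0 (a * q); rewrite sqrrD; lra.
apply: (@le_trans _ _ ((2 * (a * q) + q ^+ 2) * (1 + 2 * (a * q)))).
  by have := sqr_ge0 q; have := sqr_ge0 (a * q); nra.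
apply: ler_pM => //; first by rewrite addr_ge0 ?sqr_ge0// mulr_ge0// ltW.
by rewrite addr_ge0// mulr_ge0// ltW.
Qed.

Let omega_cvg1 y : y != 0 -> omega k.+1%:R^-1 y @[k --> \oo] --> (1 : R).
Proof.
move=> y0; have q0 : 0 < dotp y y by rewrite -sqr_enorm exprn_gt0// enorm_gt0.
have c0 : (k.+1%:R^-1 : R) @[k --> \oo] --> (0 : R).
  exact: cvg_harmonic.
have := @cvgM _ _ _ _ (cst (dotp y y)) (fun k => ((dotp y y + k.+1%:R^-1) * (1 + k.+1%:R^-1 * dotp y y))^-1) (dotp y y) ((dotp y y + 0) * (1 + 0 * dotp y y))^-1.
rewrite mul0r !addr0 mulr1 divff ?gt_eqF//; apply; first exact: cvg_cst.
apply: cvgV; first by rewrite gt_eqF.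
rewrite -[X in _ --> X]mulr1; apply: cvgM.
  by rewrite -[X in _ --> X]addr0; apply: cvgD => //; exact: cvg_cst.
rewrite -[X in _ --> X]addr0; apply: cvgD; first exact: cvg_cst.
by rewrite -[X in _ --> X](mul0r (dotp y y)); apply: cvgM => //; exact: cvg_cst.
Qed.

Let domega_cvg0 y v : y != 0 -> domega k.+1%:R^-1 y v @[k --> \oo] --> (0 : R).
Proof.
move=> y0; have q0 : 0 < dotp y y by rewrite -sqr_enorm exprn_gt0// enorm_gt0.
have c0 : (k.+1%:R^-1 : R) @[k --> \oo] --> (0 : R).
  exact: cvg_harmonic.
rewrite -[X in _ --> X](mul0r (2 * dotp v y)); apply: cvgM; last exact: cvg_cst.
rewrite -[X in _ --> X](mul0r ((dotp y y) ^+ 2)^-1); apply: cvgM.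
  by rewrite -[X in _ --> X](mul0r (1 - dotp y y ^+ 2)); apply: cvgM => //; exact: cvg_cst.
apply: cvgV; first by rewrite gt_eqF ?exprn_gt0.
rewrite expr2; under eq_fun do rewrite expr2.
suff : (dotp y y + k.+1%:R^-1) * (1 + k.+1%:R^-1 * dotp y y) @[k --> \oo] --> dotp y y.
  by move=> h; apply: cvgM.
rewrite -[X in _ --> X]mulr1; apply: cvgM.
  by rewrite -[X in _ --> X]addr0; apply: cvgD => //; exact: cvg_cst.
rewrite -[X in _ --> X]addr0; apply: cvgD; first exact: cvg_cst.
by rewrite -[X in _ --> X](mul0r (dotp y y)); apply: cvgM => //; exact: cvg_cst.
Qed.

(** The order of a kernel of decay [p] multiplied by [F]: the largest size for which integration by
    parts is needed. *)
Definition W0 (r : R) := r^-1 * ((1 + r) ^+ p)^-1.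

(** Both sides have order [-(p+2)] at infinity. At the origin the orders are [-2] and [-p], which is
    where [2 <= p] enters. *)
Lemma W0_weight (y : 'rV[R]_p.+1) : (2 <= p)%N -> y != 0 -> W0 (enorm y) / enorm y <= weight y.
Proof.
move=> p2 y0; have yp : 0 < enorm y by rewrite enorm_gt0.
have y1 : 0 < 1 + enorm y by rewrite addr_gt0.
have yp' := ltW yp; have y1' := ltW y1.
rewrite /W0 /weight; set r := enorm y in yp y1 yp' y1' *; set k := (p - 2)%N.
have pE (s : R) : s ^+ p = s ^+ k * s ^+ 2 by rewrite -exprD subnK.
rewrite !pE.
have e : r ^+ k <= (1 + r) ^+ k by rewrite lerXn2r ?nnegrE// lerDr.
have e1 : 0 < r ^+ k by exact: exprn_gt0.
have e2 : 0 < (1 + r) ^+ k by exact: exprn_gt0.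
rewrite [leLHS](_ : _ = (r ^+ 2 * (1 + r) ^+ 2)^-1 * ((1 + r) ^+ k)^-1); last first.
  by field; rewrite !gt_eqF.
rewrite [leRHS](_ : _ = (r ^+ 2 * (1 + r) ^+ 2)^-1 * (r ^+ k)^-1); last first.
  by field; rewrite !gt_eqF.
rewrite ler_wpM2l ?invr_ge0 ?mulr_ge0 ?exprn_ge0//.
by rewrite lef_pV2.
Qed.

Lemma slip_derive_bound W g v : v != 0 -> slip W g -> exists2 C, 0 <= C &
  forall y, y != 0 -> derivable g y v -> `|'D_v g y| <= C * (W (enorm y) / enorm y).
Proof.
move=> v0 [C C0 [b l]]; exists (C * enorm v); first by rewrite mulr_ge0// enorm_ge0.
have vp : 0 < enorm v by rewrite enorm_gt0.
move=> y y0 dy; have yp : 0 < enorm y by rewrite enorm_gt0.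
apply: (@growth_rate_bound _ _ _ _ _ (enorm y / (2 * enorm v))) => //.
  by rewrite divr_gt0// mulr_gt0.
move=> h /andP[h0 hy].
have eh : enorm (y - (y + h *: v)) = `|h| * enorm v.
  by rewrite opprD addrA subrr add0r enormN enormZ.
rewrite /growth_rate normrM normfV mulrC ler_pdivrMr// distrC.
apply: le_trans (l _ _ y0 _) _.
  rewrite eh; move: hy; rewrite ltr_pdivlMr ?mulr_gt0//.
  by move=> hy; rewrite ler_pdivlMr//; apply: ltW; rewrite mulrAC -mulrA.
by rewrite eh le_eqVlt; apply/orP; left; apply/eqP; field; rewrite gt_eqF.
Qed.

(* Multiplication by [omega] turns g into a globally Lipschitz function, for which
   the integral of the difference quotients vanishes by translation invariance. *)
Lemma slip_div g v : (2 <= p)%N -> v != 0 -> slip W0 g ->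
  [/\ aerv (fun y => derivable g y v), integ ('D_v g) & Int ('D_v g) = 0].
Proof.
move=> p2 v0 sg.
have n0 : aerv (fun y : 'rV[R]_p.+1 => y != 0) by exact: aerv_neq.
have k0 k : 0 < k.+1%:R^-1 :> R by rewrite invr_gt0.
pose g_ (k : nat) y := omega k.+1%:R^-1 y * g y.
have s_ k : slip W1 (g_ k).
  apply: (@slip_le _ _ _ _ 1) (slipM (slip_omega (k0 k)) sg) => // r r0.
  have r1 : 0 < 1 + r by rewrite addr_gt0.
  rewrite mul1r /W0 /W1.
  rewrite [leLHS](_ : _ = r * (((1 + r) ^+ p.+3)^-1 * (1 + r)^-1)); last first.
    by rewrite !exprS expr0; field; rewrite !gt_eqF// exprn_gt0.
  rewrite ler_wpM2l ?(ltW r0)// ler_piMr ?invr_ge0 ?exprn_ge0 ?(ltW r1)//.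
  by rewrite invf_le1// lerDl ltW.
have g_0 k : g_ k 0 = 0 by rewrite /g_ /omega dotp0r !mul0r.
have I_ k := slip_W1_int0 (s_ k) (g_0 k) v0.
have omega_neq0 y : y != 0 -> omega 1 y != 0.
  move=> y0; have q0 : 0 < dotp y y by rewrite -sqr_enorm exprn_gt0// enorm_gt0.
  have /andP[h1 h2] := omega_den y (@ltr01 R).
  by rewrite /omega mulf_neq0 ?invr_eq0 ?gt_eqF// mulr_gt0.
(* [g_ 0] is the product of [omega 1] and [g]; dividing by [omega 1], nonzero off the origin,
   carries derivability back to [g]. *)
have dg : aerv (fun y => derivable g y v).
  have [d0 _ _] := I_ 0%N; apply: aervS (aerv_and n0 d0) => y [y0 dy].
  have D1 := isd_omega y v (@ltr01 R).
  have := isdM (isdV D1 (omega_neq0 _ y0)) (derivableP dy).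
  move=> [dd _]; apply: near_eq_derivable dd.
  have /enorm_nearP[e e0 He] : \forall z \near y, z != 0.
    have yp : 0 < enorm y by rewrite enorm_gt0.
    apply: (@near_enorm _ _ y _ (enorm y / 2)); first by rewrite divr_gt0.
    move=> z zy; apply: contraTneq zy => ->; rewrite sub0r enormN -ltNge.
    by rewrite ltr_pdivrMr// ltr_pMr// ltr1n.
  apply: (@near_enorm _ _ y _ (e / 2)); first by rewrite divr_gt0.
  move=> z zy; rewrite /g_ invr1 mulrA mulVf ?mul1r// omega_neq0//.
  by apply: He; apply: le_lt_trans zy _; rewrite ltr_pdivrMr// ltr_pMr// ltr1n.
have Dg_ k y : derivable g y v -> 'D_v (g_ k) y = domega k.+1%:R^-1 y v * g y + omega k.+1%:R^-1 y * 'D_v g y.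
  move=> dy; have := isdM (isd_omega y v (k0 k)) (derivableP dy).
  by move=> [_].
have [C C0 [b l]] := sg.
have vp : 0 < enorm v by rewrite enorm_gt0.
have [D D0 bD] := slip_derive_bound v0 sg.
have [] := @integ_dct _ _ (fun k => 'D_v (g_ k)) ('D_v g) (fun y => (2 * C * enorm v + D) * weight y).
- by move=> k; have [_ + _] := I_ k; exact: integ_mrv.
- by apply: measurable_derive => // y y0; exact: slip_cont sg y0.
- exact: integZ integ_weight.
- apply: aervS (aerv_and n0 dg) => y [y0 dy].
  have : domega k.+1%:R^-1 y v * g y + omega k.+1%:R^-1 y * 'D_v g y @[k --> \oo]
      --> 0 * g y + 1 * 'D_v g y.
    apply: cvgD; apply: cvgM; try exact: cvg_cst; first exact: domega_cvg0.
    exact: omega_cvg1.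
  rewrite mul0r add0r mul1r.
  rewrite (_ : (fun k => _) = (fun k => 'D_v (g_ k) y))//.
  by apply: funext => k; rewrite Dg_.
- move=> k; apply: aervS (aerv_and n0 dg) => y [y0 dy].
  have yp : 0 < enorm y by rewrite enorm_gt0.
  rewrite Dg_//; apply: le_trans (ler_normD _ _) _.
  rewrite (normrM (domega _ _ _)) (normrM (omega _ _)).
  apply: (@le_trans _ _ (2 * enorm v / enorm y * (C * W0 (enorm y)) + 1 * (D * (W0 (enorm y) / enorm y)))).
    apply: lerD; apply: ler_pM => //; [by apply: domega_le; rewrite ?k0|exact: b|by apply: omega_le1; rewrite k0|exact: bD].
  rewrite [leLHS](_ : _ = (2 * C * enorm v + D) * (W0 (enorm y) / enorm y)); last by ring.
  by rewrite ler_wpM2l ?W0_weight// addr_ge0// !mulr_ge0// ltW.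
move=> iD cv; split => //.
have : Int ('D_v (g_ i)) @[i --> \oo] --> 0.
  rewrite (_ : (fun i => Int _) = cst 0); first exact: cvg_cst.
  by apply: funext => k; have [_ _ ->] := I_ k.
by move=> cv0; exact: cvg_unique cv cv0.
Qed.

End divergence.

(** * Functions of class C1 off the origin *)

Section C1.
Context {R : realType} {m : nat}.
Implicit Types (f g : 'rV[R]_m -> R).

Lemma isd_scale g (y v : 'rV[R]_m) c d : is_derive y v g d -> is_derive y (c *: v) g (c * d).
Proof.
move=> /is_derive_line0 D; apply/is_derive_line0.
rewrite (_ : (fun t => _) = (fun t => g (y + t *: v)) \o (fun t : R => t * c)); last first.
  by apply: funext => t /=; rewrite scalerA.
rewrite mulrC; apply: is_derive1_comp; first by rewrite mul0r.
apply/is_derive1_cvg; apply: cvg_near_cst.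
apply/near0_dnbhsP; exists 1 => // h /andP[h0 _] /=.
by field; rewrite -normr_gt0.
Qed.

Lemma mvt_line g (y v : 'rV[R]_m) : (forall t, 0 <= t <= 1 -> derivable g (y + t *: v) v) ->
  exists2 c, 0 <= c <= 1 & g (y + v) - g y = 'D_v g (y + c *: v).
Proof.
move=> dg.
have D (t : R) : 0 <= t <= 1 -> is_derive t 1 (fun t => g (y + t *: v)) ('D_v g (y + t *: v)).
  by move=> t01; apply/is_derive_line/derivableP/dg.
have [||c] := @MVT_segment R (fun t => g (y + t *: v)) (fun t => 'D_v g (y + t *: v)) 0 1 ler01.
- by move=> t; rewrite in_itv/= => /andP[t0 t1]; apply: D; rewrite !ltW.
- apply: derivable_within_continuous => t; rewrite in_itv/= => t01.
  by have [] := D t t01.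
rewrite in_itv/= => c01; rewrite scale1r scale0r addr0 subr0 mulr1 => e.
by exists c.
Qed.

Lemma neq0_ball (y : 'rV[R]_m) : y != 0 -> forall z, enorm (z - y) <= enorm y / 2 ->
  enorm y / 2 <= enorm z /\ z != 0.
Proof.
move=> y0 z zy; have yp : 0 < enorm y by rewrite enorm_gt0.
have : enorm y / 2 <= enorm z.
  by have := enormB_le y z; rewrite enorm_dist; lra.
by move=> h; split => //; rewrite -enorm_gt0; lra.
Qed.

Lemma near_neq0 (y : 'rV[R]_m) : y != 0 -> \forall z \near y, z != 0.
Proof.
move=> y0; apply: (@near_enorm _ _ y _ (enorm y / 2)).
  by rewrite divr_gt0// enorm_gt0.
by move=> z /(neq0_ball y0)[].
Qed.

Lemma cont_ext_off0 f g y : (forall z, z != 0 -> f z = g z) -> y != 0 ->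
  {for y, continuous f} -> {for y, continuous g}.
Proof.
move=> fg y0 /continuous_enormP cf; apply/continuous_enormP => e e0.
have [d d0 H] := cf e e0; have yp : 0 < enorm y by rewrite enorm_gt0.
exists (Num.min d (enorm y / 2)); first by rewrite lt_min d0 divr_gt0.
move=> z; rewrite le_min => /andP[zd /(neq0_ball y0)[_ z0]].
by rewrite -!fg//; exact: H.
Qed.

Lemma isd_ext_off0 f g (y v : 'rV[R]_m) d : (forall z, z != 0 -> f z = g z) -> y != 0 ->
  is_derive y v f d -> is_derive y v g d.
Proof.
move=> fg y0; apply: near_eq_is_derive.
have : \forall z \near y, z != 0 by exact: near_neq0.
by apply: (@filterS _ _ (nbhs_filter y)) => z; exact: fg.
Qed.

Lemma C1_ext f g : (forall z, z != 0 -> f z = g z) -> C1_off0 f -> C1_off0 g.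
Proof.
move=> fg Cf i y y0; have [df cf] := Cf i y y0.
split; first by have [] := isd_ext_off0 fg y0 (derivableP df).
apply: cont_ext_off0 y0 cf => z z0; have [dfz _] := Cf i z z0.
by rewrite /partial; have [_ ->] := isd_ext_off0 fg z0 (derivableP dfz).
Qed.

(* The increment [h v] is reached one coordinate at a time, applying the mean
   value theorem along each axis. *)
Let trunc (v : 'rV[R]_m) (k : nat) : 'rV[R]_m := \row_i (if (i < k)%N then v ord0 i else 0).

Let truncS v (k : 'I_m) : trunc v k.+1 = trunc v k + v ord0 k *: delta_mx ord0 k.
Proof.
apply/rowP => i; rewrite !mxE eqxx/= ltnS.
have [->|ik] := eqVneq i k; first by rewrite leqnn ltnn add0r mulr1.
by rewrite mulr0 addr0 leq_eqVlt (negbTE (_ : val i != val k))//.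
Qed.

Let enorm_trunc v k c : 0 <= c <= 1 ->
  forall j : 'I_m, val j = k -> enorm (trunc v k + (c * v ord0 j) *: delta_mx ord0 j) <= enorm v.
Proof.
move=> /andP[c0 c1] j jk; rewrite /enorm ler_wsqrtr//; apply: ler_sum => i _.
rewrite !mxE eqxx/= -!expr2.
have [->|ij] := eqVneq i j.
  rewrite jk ltnn add0r mulr1 exprMn ler_piMl ?sqr_ge0//.
  by rewrite exprn_ile1.
by rewrite mulr0 addr0; case: ifP => _; rewrite ?lexx// expr0n sqr_ge0.
Qed.

Let cvg_sum_ord (F : set_system R) (FF : Filter F) n (D : 'I_n -> R -> R) (l : 'I_n -> R) :
  (forall k, D k h @[h --> F] --> l k) ->
  \sum_(k < n) D k h @[h --> F] --> \sum_(k < n) l k.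
Proof.
elim: n D l => [|n IH] D l H.
  by rewrite big_ord0; under eq_fun do rewrite big_ord0; exact: cvg_cst.
rewrite big_ord_recl; under eq_fun do rewrite big_ord_recl.
by apply: cvgD => //; apply: IH => k; exact: H.
Qed.

Lemma is_derive_C1 g (y v : 'rV[R]_m) : C1_off0 g -> y != 0 ->
  is_derive y v g (\sum_(i < m) v ord0 i * partial i g y).
Proof.
move=> Cg y0; apply/is_derive_growth_rate.
have yp : 0 < enorm y by rewrite enorm_gt0.
have v1 : 0 < enorm v + 1 by rewrite ltr_wpDl// enorm_ge0.
pose D (k : 'I_m) h := h^-1 * (g (y + h *: trunc v k.+1) - g (y + h *: trunc v k)).
have -> : growth_rate g v y = (fun h => \sum_(k < m) D k h).
  apply: funext => h; rewrite /growth_rate /D -mulr_sumr; congr (_ * _).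
  rewrite (_ : \sum_(k < m) _ = \sum_(0 <= k < m) (g (y + h *: trunc v k.+1) - g (y + h *: trunc v k))).
    rewrite telescope_sumr//; congr (g (_ + _ *: _) - g _).
      by apply/rowP => i; rewrite mxE ltn_ord.
    rewrite (_ : trunc v 0 = 0) ?scaler0 ?addr0//.
    by apply/rowP => i; rewrite !mxE.
  by rewrite big_mkord.
apply: cvg_sum_ord => k; apply/cvgrPdist_le => e e0.
have vk1 : 0 < `|v ord0 k| + 1 by rewrite ltr_wpDl.
have [_ /continuous_enormP ck] := Cg k y y0.
have [d d0 H] := ck (e / (`|v ord0 k| + 1)) (divr_gt0 e0 vk1).
apply/near0_dnbhsP; exists (Num.min d (enorm y / 2) / (enorm v + 1)).
  by rewrite divr_gt0// lt_min d0 divr_gt0.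
move=> h /andP[h0]; rewrite ltr_pdivlMr// lt_min => /andP[hd hy].
have hN : h != 0 by rewrite -normr_gt0.
pose w := h *: (v ord0 k *: delta_mx ord0 k : 'rV[R]_m).
have close c : 0 <= c <= 1 ->
    enorm (y + h *: trunc v k + c *: w - y) <= `|h| * (enorm v + 1).
  move=> c01.
  have -> : y + h *: trunc v k + c *: w - y =
      h *: (trunc v k + (c * v ord0 k) *: delta_mx ord0 k).
    by apply/rowP => i; rewrite !mxE; ring.
  rewrite enormZ ler_wpM2l//.
  by apply: le_trans (enorm_trunc v c01 erefl) _; rewrite lerDl.
have near0 c : 0 <= c <= 1 -> y + h *: trunc v k + c *: w != 0.
  move=> c01; apply: (proj2 (neq0_ball y0 _)).
  by apply: le_trans (close c c01) _; exact: ltW.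
have Dw c : 0 <= c <= 1 -> is_derive (y + h *: trunc v k + c *: w) w g
    (h * (v ord0 k * partial k g (y + h *: trunc v k + c *: w))).
  move=> c01; do 2 apply: isd_scale; apply: derivableP.
  by have [] := Cg k _ (near0 c c01).
have [t t01|c c01] := @mvt_line g (y + h *: trunc v k) w.
  by have [] := Dw t t01.
have [_ ->] := Dw c c01.
rewrite /D truncS scalerDr addrA => ->.
rewrite mulKf// -mulrBr normrM distrC.
have : `|partial k g (y + h *: trunc v k + c *: w) - partial k g y| <= e / (`|v ord0 k| + 1).
  by apply: H; apply: le_trans (close c c01) _; exact: ltW.
rewrite ler_pdivlMr// => H1; apply: le_trans H1.
by rewrite mulrC ler_wpM2l// lerDl.
Qed.

Lemma derive_C1 g (y v : 'rV[R]_m) : C1_off0 g -> y != 0 ->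
  'D_v g y = \sum_(i < m) v ord0 i * partial i g y.
Proof. by move=> Cg y0; have [_] := is_derive_C1 v Cg y0. Qed.

End C1.

(** * Products, bounds and homogeneity for functions of class C1 off the origin *)

Section C1_algebra.
Context {R : realType} {m : nat}.
Implicit Types (f g : 'rV[R]_m -> R).

Lemma C1_is_derive i g (y : 'rV[R]_m) : C1_off0 g -> y != 0 ->
  is_derive y (delta_mx ord0 i) g (partial i g y).
Proof. by move=> Cg y0; have [/derivableP] := Cg i y y0. Qed.

Lemma C1_intro g (dg : 'I_m -> 'rV[R]_m -> R) :
  (forall i y, y != 0 -> is_derive y (delta_mx ord0 i) g (dg i y)) ->
  (forall i y, y != 0 -> {for y, continuous (dg i)}) -> C1_off0 g.
Proof.
move=> D cd i y y0; have [dy _] := D i y y0; split => //.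
apply: cont_ext_off0 y0 (cd i y y0) => z z0.
by have [_] := D i z z0.
Qed.

Lemma cont_sum n (h : 'I_n -> 'rV[R]_m -> R) (y : 'rV[R]_m) :
  (forall i, {for y, continuous (h i)}) -> {for y, continuous (fun z => \sum_(i < n) h i z)}.
Proof.
elim: n h => [|n IH] h ch.
  rewrite (_ : (fun z => _) = fun=> 0); first exact: cont_cst.
  by apply: funext => z; rewrite big_ord0.
rewrite (_ : (fun z => _) = fun z => h ord0 z + \sum_(i < n) h (lift ord0 i) z).
  by apply: contD => //; apply: IH => i; exact: ch.
by apply: funext => z; rewrite big_ord_recl.
Qed.

Lemma derive_C1_le g (y v : 'rV[R]_m) B : C1_off0 g -> y != 0 ->
  (forall i, `|partial i g y| <= B) -> `|'D_v g y| <= m%:R * B * enorm v.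
Proof.
move=> Cg y0 H; rewrite derive_C1//; apply: le_trans (ler_norm_sum _ _ _) _.
apply: (@le_trans _ _ (\sum_(i < m) (B * enorm v))).
  apply: ler_sum => i _; rewrite normrM mulrC; apply: ler_pM => //.
  exact: coord_le_enorm.
by rewrite sumr_const card_ord -[leLHS]mulr_natl mulrA.
Qed.

Lemma C1_segment g (y z : 'rV[R]_m) B : C1_off0 g -> y != 0 ->
  enorm (z - y) <= enorm y / 2 ->
  (forall c i, enorm (c - y) <= enorm (z - y) -> `|partial i g c| <= B) ->
  `|g z - g y| <= m%:R * B * enorm (z - y).
Proof.
move=> Cg y0 zy H.
have close t : 0 <= t <= 1 -> enorm (y + t *: (z - y) - y) <= enorm (z - y).
  move=> /andP[t0 t1].
  by rewrite addrC addKr enormZ ger0_norm// ler_piMl// enorm_ge0.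
have n0 t : 0 <= t <= 1 -> y + t *: (z - y) != 0.
  move=> t01; apply: (proj2 (neq0_ball y0 _)).
  exact: le_trans (close _ t01) zy.
have [t t01|c c01] := @mvt_line _ _ g y (z - y).
  by have [] := is_derive_C1 (z - y) Cg (n0 t t01).
rewrite [y + (z - y)]addrC subrK => ->.
by apply: derive_C1_le => // [|i]; [exact: n0|apply: H; exact: close].
Qed.

(** [C1_off0] speaks of partial derivatives only. Their continuity bounds them by [G y + 1] near
    [y], and the mean value theorem along segments then gives continuity of [g] itself. *)
Lemma C1_cont g (y : 'rV[R]_m) : C1_off0 g -> y != 0 -> {for y, continuous g}.
Proof.
move=> Cg y0; apply/continuous_enormP => e e0.
have yp : 0 < enorm y by rewrite enorm_gt0.
pose G (z : 'rV[R]_m) : R := \sum_(i < m) `|partial i g z|.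
have G0 z : 0 <= G z by exact: sumr_ge0.
have /continuous_enormP cG : {for y, continuous G}.
  apply: cont_sum => i; have [_ ci] := Cg i y y0; exact: cvg_norm ci.
have [d d0 H] := cG 1 ltr01.
pose K := m%:R * (G y + 1) + 1.
have K0 : 0 < K by rewrite ltr_wpDl// mulr_ge0// addr_ge0.
exists (Num.min (Num.min d (enorm y / 2)) (e / K)).
  by rewrite !lt_min d0 !divr_gt0.
move=> z; rewrite !le_min => /andP[/andP[zd zy] ze].
apply: le_trans (@C1_segment g y z (G y + 1) Cg y0 zy _) _.
  move=> c i cz.
  have := H c (le_trans cz zd); rewrite ler_distl => /andP[_ Gc].
  apply: le_trans Gc; rewrite /G (bigD1 i)//= lerDl.
  exact: sumr_ge0.
rewrite ler_pdivlMr// in ze; apply: le_trans ze.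
by rewrite mulrC ler_wpM2l ?enorm_ge0// lerDl.
Qed.

Lemma C1M f g : C1_off0 f -> C1_off0 g -> C1_off0 (fun y => f y * g y).
Proof.
move=> Cf Cg.
apply: (@C1_intro _ (fun i y => partial i f y * g y + f y * partial i g y)) => i y y0.
  by apply: isdM; exact: C1_is_derive.
have [_ cf] := Cf i y y0; have [_ cg] := Cg i y y0.
by apply: contD; apply: contM => //; exact: C1_cont.
Qed.

Lemma C1D f g : C1_off0 f -> C1_off0 g -> C1_off0 (fun y => f y + g y).
Proof.
move=> Cf Cg.
apply: (@C1_intro _ (fun i y => partial i f y + partial i g y)) => i y y0.
  by apply: isdD; exact: C1_is_derive.
by have [_ cf] := Cf i y y0; have [_ cg] := Cg i y y0; exact: contD.
Qed.

Lemma C1_dotp (w : 'rV[R]_m) : C1_off0 (dotp w).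
Proof.
apply: (@C1_intro _ (fun i y => dotp w (delta_mx ord0 i))) => i y y0.
  exact: isd_dotp.
exact: cont_cst.
Qed.

Lemma isd_enorm (y v : 'rV[R]_m) : y != 0 ->
  is_derive y v (@enorm R m) (dotp v y / enorm y).
Proof.
move=> y0; have q0 : 0 < dotp y y by rewrite -sqr_enorm exprn_gt0// enorm_gt0.
have Dq : is_derive y v (fun z => dotp z z) (2 * dotp v y).
  have := isd_dotpB 0 y v; rewrite subr0; apply: isd_ext => z.
  by rewrite subr0.
apply: isd_eq (isd_comp Dq (is_derive1_sqrt q0)).
by rewrite -/(enorm y); field; rewrite enorm_eq0.
Qed.

Lemma C1_enorm : C1_off0 (@enorm R m).
Proof.
apply: (@C1_intro _ (fun i y => dotp (delta_mx ord0 i) y / enorm y)) => i y y0.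
  exact: isd_enorm.
apply: contM; first exact: continuous_dotpr.
by apply: contV; [exact: continuous_enorm|rewrite enorm_eq0].
Qed.

Lemma C1_enormV : C1_off0 (fun y : 'rV[R]_m => (enorm y)^-1).
Proof.
apply: (@C1_intro _ (fun i y => - (enorm y) ^- 2 * (dotp (delta_mx ord0 i) y / enorm y))) => i y y0.
  by apply: isdV; rewrite ?enorm_eq0//; exact: isd_enorm.
have cV : {for y, continuous (fun y : 'rV[R]_m => (enorm y)^-1)}.
  by apply: contV; [exact: continuous_enorm|rewrite enorm_eq0].
apply: contM; last by apply: contM => //; exact: continuous_dotpr.
rewrite (_ : (fun z => _) = fun z : 'rV[R]_m => -1 * ((enorm z)^-1 * (enorm z)^-1)).
  by apply: contM; [exact: cont_cst|exact: contM].
by apply: funext => z; rewrite mulN1r -invfM expr2.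
Qed.

(** Partial derivatives are bounded at every [c] with [|c| >= |y|/2], because the segment from [y]
    to a point within [|y|/2] stays in that region. *)
Lemma slip_C1 (W : R -> R) g C : 0 <= C -> C1_off0 g -> (forall y : 'rV[R]_m, y != 0 -> `|g y| <= C * W (enorm y)) ->
  (forall (y c : 'rV[R]_m) i, y != 0 -> enorm y / 2 <= enorm c -> `|partial i g c| <= C * W (enorm y) / enorm y) ->
  slip W g.
Proof.
move=> C0 Cg b H; exists ((m%:R + 1) * C); first by rewrite mulr_ge0// addr_ge0.
have CW0 (y : 'rV[R]_m) : y != 0 -> 0 <= C * W (enorm y).
  by move=> y0; apply: le_trans (b _ y0); exact: normr_ge0.
split=> [y y0|y z y0 yz].
  by apply: le_trans (b _ y0) _; rewrite -mulrA ler_peMl ?CW0// lerDr.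
rewrite enorm_dist in yz.
rewrite distrC; apply: le_trans (@C1_segment g y z (C * W (enorm y) / enorm y) Cg y0 yz _) _.
  move=> c i cz; apply: H => //.
  by have [] := neq0_ball y0 (le_trans cz yz).
rewrite (enorm_dist z).
rewrite [leLHS](_ : _ = m%:R * (C * W (enorm y) * (enorm (y - z) / enorm y))); last by ring.
rewrite -[in leRHS](mulrA (m%:R + 1)) -(mulrA (m%:R + 1)) ler_wpM2r ?lerDl//.
by rewrite mulr_ge0 ?CW0// divr_ge0 ?enorm_ge0.
Qed.

(** Differentiation lowers the degree of homogeneity by one. [s] stands for the power of [t], so
    that the same statement serves degrees 1 and 0. *)
Lemma isd_homog g (s t : R) (y v : 'rV[R]_m) d : 0 < t ->
  (forall z, z != 0 -> g (t *: z) = s * g z) -> y != 0 ->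
  is_derive y v g d -> is_derive (t *: y) v g (s / t * d).
Proof.
move=> t0 H y0 D; have tn : t != 0 by rewrite gt_eqF.
have ty0 : t *: y != 0 by rewrite scaler_eq0 negb_or tn.
apply: (@isd_ext_off0 _ _ (fun z => s * g (t^-1 *: z))) => //.
  move=> z z0; rewrite -H ?scalerA ?divff ?scale1r//.
  by rewrite scaler_eq0 negb_or invr_eq0 tn.
rewrite -mulrA; apply: isdZ.
apply/is_derive_line0.
rewrite (_ : (fun r => _) = (fun r : R => g (y + r *: (t^-1 *: v)))); last first.
  by apply: funext => r; rewrite scalerDr !scalerA mulVf// scale1r (mulrC r).
by apply/is_derive_line0; exact: isd_scale.
Qed.

(** Compactness of the unit sphere. Applied to derivatives of [U] multiplied by the power of [|y|]
    that makes them homogeneous of degree 0, it yields their growth bounds. *)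
Lemma homog0_bounded g : (forall t y, 0 < t -> y != 0 -> g (t *: y) = g y) ->
  (forall y, y != 0 -> {for y, continuous g}) ->
  exists2 C, 0 <= C & forall y, y != 0 -> `|g y| <= C.
Proof.
move=> H cg.
have S0 y : @usphere R m y -> y != 0.
  by move=> y1; rewrite -enorm_eq0 y1 oner_eq0.
have cS : compact (@usphere R m).
  apply: bounded_closed_compact.
    exists 1; split; first exact: num_real.
    move=> M M1 y y1; apply: le_trans (norm_le_enorm _) _.
    by rewrite y1 ltW.
  rewrite (_ : @usphere R m = @enorm R m @^-1` [set 1])//.
  apply: closed_comp; last exact: closed_eq.
  by move=> y _; exact: continuous_enorm.
have cI : compact (g @` @usphere R m).
  apply: continuous_compact cS.
  by apply: continuous_in_subspaceT => y; rewrite inE => y1; apply: cg; exact: S0.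
have [M [Mr HM]] := compact_bounded (cI : compact (g @` @usphere R m : set R^o)).
exists `|M + 1|; rewrite ?normr_ge0// => y y0.
have yp : 0 < enorm y by rewrite enorm_gt0.
rewrite -(H (enorm y)^-1) ?invr_gt0//.
apply: le_trans (ler_norm _); apply: HM; first by rewrite ltrDl.
exists ((enorm y)^-1 *: y) => //.
by rewrite /usphere/= enormZ gtr0_norm ?invr_gt0// mulVf// gt_eqF.
Qed.

End C1_algebra.

(** * Homogeneous extensions *)

Section homogeneous_extension.
Context {R : realType} {m : nat}.
Implicit Types (u f : 'rV[R]_m -> R).

Lemma hext0_scale u (t : R) (y : 'rV[R]_m) : 0 < t -> hext 0 u (t *: y) = hext 0 u y.
Proof.
move=> t0; rewrite /hext !expr0z !mul1r enormZ gtr0_norm// scalerA.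
have [->|y0] := eqVneq y 0; first by rewrite !scaler0.
congr (u (_ *: _)); field; rewrite enorm_eq0 y0; exact: lt0r_neq0.
Qed.

Lemma hextE k u (y : 'rV[R]_m) : hext k u y = enorm y ^ k * hext 0 u y.
Proof. by rewrite /hext expr0z mul1r. Qed.

Lemma hext1E u (y : 'rV[R]_m) : hext 1 u y = enorm y * hext 0 u y.
Proof. by rewrite hextE expr1z. Qed.

Lemma hext1_scale u (t : R) (y : 'rV[R]_m) : 0 < t -> hext 1 u (t *: y) = t * hext 1 u y.
Proof. by move=> t0; rewrite !hext1E hext0_scale// enormZ gtr0_norm// mulrA. Qed.

Lemma hext1_0 u : hext 1 u (0 : 'rV[R]_m) = 0.
Proof. by rewrite hext1E enorm0 mul0r. Qed.

Lemma hextN1E u (y : 'rV[R]_m) : hext (-1) u y = (enorm y)^-1 * hext 0 u y.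
Proof. by rewrite hextE exprN1. Qed.

Lemma hextN1_scale u (t : R) (y : 'rV[R]_m) : 0 < t ->
  hext (-1) u (t *: y) = t^-1 * hext (-1) u y.
Proof. by move=> t0; rewrite !hextN1E hext0_scale// enormZ gtr0_norm// invfM mulrA. Qed.

Lemma hext_sphere k u (x : 'rV[R]_m) : usphere x -> hext k u x = u x.
Proof. by rewrite /usphere/= /hext => ->; rewrite exp1rz invr1 scale1r mul1r. Qed.

Lemma usphere_neq0 (x : 'rV[R]_m) : usphere x -> x != 0.
Proof. by move=> x1; rewrite -enorm_eq0 x1 oner_eq0. Qed.

Lemma normalize_sphere (y : 'rV[R]_m) : y != 0 -> usphere ((enorm y)^-1 *: y).
Proof.
move=> y0; rewrite /usphere/= enormZ gtr0_norm ?invr_gt0 ?enorm_gt0//.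
by rewrite mulVf// enorm_eq0.
Qed.

Lemma normalizeK (y : 'rV[R]_m) : y != 0 -> enorm y *: ((enorm y)^-1 *: y) = y.
Proof. by move=> y0; rewrite scalerA divff ?scale1r// enorm_eq0. Qed.

(** The increment splits into that of the radial factor and that of [f] between the normalised
    points, which lie within [2 |y - z| / |y|] of each other. *)
Lemma slip_hextN1 f : lipschitz_sphere f -> slip (fun r => r^-1) (hext (-1) f).
Proof.
move=> [L fL].
have [B B0 fB] : exists2 B, 0 <= B & forall x : 'rV[R]_m, usphere x -> `|f x| <= B.
  (* The sphere is empty in dimension 0. Otherwise [f] is bounded by its value at a base point plus
     [|L|] times the diameter 2. *)
  have [[x0 x01]|nx] := pselect (exists x0 : 'rV[R]_m, usphere x0); last first.
    by exists 0 => // x x1; case: nx; exists x.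
  exists (`|f x0| + `|L| * 2) => [|x x1]; first by rewrite addr_ge0// mulr_ge0.
  rewrite -[f x](subrK (f x0)) addrC; apply: le_trans (ler_normD _ _) _; rewrite lerD2l.
  apply: le_trans (fL _ _ x1 x01) _.
  apply: (@le_trans _ _ (`|L| * enorm (x - x0))).
    by rewrite ler_wpM2r ?enorm_ge0// ler_norm.
  rewrite ler_wpM2l//; apply: le_trans (enormD _ _) _.
  by rewrite enormN x1 x01.
exists (3 * B + 4 * `|L|); first by rewrite addr_ge0// mulr_ge0.
split=> [y y0|y z y0 yz].
  have yp : 0 < enorm y by rewrite enorm_gt0.
  rewrite /hext exprN1 normrM gtr0_norm ?invr_gt0// mulrC ler_wpM2r ?invr_ge0 ?(ltW yp)//.
  apply: le_trans (fB _ (normalize_sphere y0)) _.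
  by have := normr_ge0 L; move: B0; lra.
have yz' : enorm (z - y) <= enorm y / 2 by rewrite enorm_dist.
have [zh z0] := neq0_ball y0 yz'.
have yp : 0 < enorm y by rewrite enorm_gt0.
have zp : 0 < enorm z by rewrite enorm_gt0.
have fy := fB _ (normalize_sphere y0).
have fyz := fL _ _ (normalize_sphere y0) (normalize_sphere z0).
rewrite /hext !exprN1.
set a := enorm y in yp zh fy fyz *; set b := enorm z in zp zh fyz *.
set d := enorm (y - z).
have d0 : 0 <= d by exact: enorm_ge0.
have ab : `|a^-1 - b^-1| <= d / (a * b).
  rewrite (_ : a^-1 - b^-1 = - (a - b) / (a * b)); last by field; rewrite !gt_eqF.
  rewrite normrM normrN normfV (gtr0_norm (mulr_gt0 yp zp)).
  by rewrite ler_wpM2r ?invr_ge0 ?mulr_ge0 ?(ltW yp) ?(ltW zp)//; exact: enormB_dist.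
have ba : b^-1 <= 2 / a.
  by rewrite -[2 / a]invrK lef_pV2 ?posrE ?invr_gt0 ?divr_gt0// invf_div.
have n1 : enorm (a^-1 *: y - b^-1 *: z) <= 2 * d / a.
  rewrite (_ : _ - _ = a^-1 *: (y - z) + (a^-1 - b^-1) *: z); last first.
    by rewrite scalerBr scalerBl addrA subrK.
  apply: le_trans (enormD _ _) _; rewrite !enormZ gtr0_norm ?invr_gt0//.
  have : `|a^-1 - b^-1| * b <= d / (a * b) * b by rewrite ler_wpM2r// ltW.
  rewrite (_ : d / (a * b) * b = d / a); last by field; rewrite !gt_eqF.
  have -> : 2 * d / a = a^-1 * d + d / a by ring.
  by rewrite -/d -/b lerD2l.
rewrite (_ : _ - _ = (a^-1 - b^-1) * f (a^-1 *: y) + b^-1 * (f (a^-1 *: y) - f (b^-1 *: z))); last by ring.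
apply: le_trans (ler_normD _ _) _; rewrite (normrM (_ - _)) (normrM b^-1).
have t1 : `|a^-1 - b^-1| * `|f (a^-1 *: y)| <= (2 * d / a ^+ 2) * B.
  apply: ler_pM => //; apply: le_trans ab _.
  rewrite (_ : d / (a * b) = d / a * b^-1); last by field; rewrite !gt_eqF.
  rewrite (_ : 2 * d / a ^+ 2 = d / a * (2 / a)); last by field; rewrite gt_eqF.
  by rewrite ler_wpM2l// divr_ge0// ltW.
have t2 : `|b^-1| * `|f (a^-1 *: y) - f (b^-1 *: z)| <= (2 / a) * (`|L| * (2 * d / a)).
  apply: ler_pM => //; first by rewrite gtr0_norm ?invr_gt0.
  apply: le_trans fyz _; apply: (@le_trans _ _ (`|L| * enorm (a^-1 *: y - b^-1 *: z))).
    by rewrite ler_wpM2r ?enorm_ge0// ler_norm.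
  by rewrite ler_wpM2l.
apply: le_trans (lerD t1 t2) _.
rewrite [leLHS](_ : _ = (2 * B + 4 * `|L|) * (d / a ^+ 2)); last by field; rewrite gt_eqF.
rewrite [leRHS](_ : _ = (3 * B + 4 * `|L|) * (d / a ^+ 2)); last by field; rewrite gt_eqF.
rewrite ler_wpM2r ?divr_ge0 ?exprn_ge0 ?(ltW yp)//.
by move: B0; lra.
Qed.

End homogeneous_extension.

(** * The extension of the solution: Laplacian, growth and Hessian *)

Section solution.
Context {R : realType} {p : nat}.
Variables (f u : 'rV[R]_p.+1 -> R).
Hypotheses (u_C2 : C2_sphere u) (u_sol : forall x : 'rV[R]_p.+1, usphere x ->
       laplace_beltrami u x + p%:R * u x = f x).

Local Notation U := (hext 1 u).
Local Notation g := (hext 0 u).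

Let C1g : C1_off0 g := u_C2.1.
Let C1dg i : C1_off0 (partial i g) := u_C2.2 i.

Lemma C1_hext1 : C1_off0 U.
Proof.
by apply: C1_ext (C1M C1_enorm C1g) => z _; rewrite hext1E.
Qed.

Let dU i y : y != 0 -> partial i U y =
  (dotp (delta_mx ord0 i) y * (enorm y)^-1) * g y + enorm y * partial i g y.
Proof.
move=> y0; have D := isdM (isd_enorm (delta_mx ord0 i) y0) (C1_is_derive i C1g y0).
have /= [_ e] := isd_ext (fun z => esym (hext1E u z)) D.
exact: e.
Qed.

Lemma C1_partial_hext1 i : C1_off0 (partial i U).
Proof.
apply: C1_ext (C1D (C1M (C1M (C1_dotp (delta_mx ord0 i)) C1_enormV) C1g) (C1M C1_enorm (C1dg i))).
by move=> z z0; rewrite dU.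
Qed.

Lemma partial_hext1_scale i t y : 0 < t -> y != 0 -> partial i U (t *: y) = partial i U y.
Proof.
move=> t0 y0.
have [_ e] := isd_homog t0 (fun z _ => hext1_scale u z t0) y0 (C1_is_derive i C1_hext1 y0).
by rewrite /partial e divff ?mul1r// gt_eqF.
Qed.

Lemma partial2_hext1_scale i j t y : 0 < t -> y != 0 ->
  partial j (partial i U) (t *: y) = t^-1 * partial j (partial i U) y.
Proof.
move=> t0 y0; have H z : z != 0 -> partial i U (t *: z) = 1 * partial i U z.
  by move=> z0; rewrite mul1r; exact: partial_hext1_scale.
have [_ e] := isd_homog t0 H y0 (C1_is_derive j (C1_partial_hext1 i) y0).
by rewrite [LHS]e div1r.
Qed.

Lemma partial2_bounded i j : exists2 C, 0 <= C &
  forall y, y != 0 -> `|partial j (partial i U) y| <= C / enorm y.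
Proof.
have [||C C0 H] := @homog0_bounded R p.+1 (fun y => enorm y * partial j (partial i U) y).
- move=> t y t0 y0; rewrite partial2_hext1_scale// enormZ gtr0_norm//.
  by field; rewrite gt_eqF.
- move=> y y0; apply: contM; first exact: continuous_enorm.
  by have [] := C1_partial_hext1 i j y0.
exists C => // y y0; have yp : 0 < enorm y by rewrite enorm_gt0.
rewrite ler_pdivlMr// mulrC -[X in X * _](ger0_norm (ltW yp)) -normrM.
exact: H.
Qed.

Lemma slip_partial_hext1 i : slip (fun=> 1) (partial i U).
Proof.
have [C C0 HC] := homog0_bounded (fun t y => @partial_hext1_scale i t y)
  (fun y y0 => C1_cont (C1_partial_hext1 i) y0).
have [D D0 HD] : exists2 D, 0 <= D & forall j y, y != 0 -> `|partial j (partial i U) y| <= D / enorm y.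
  have H j : exists D, 0 <= D /\ forall y, y != 0 -> `|partial j (partial i U) y| <= D / enorm y.
    by have [D D0 HD] := partial2_bounded i j; exists D.
  have [D HD] := choice H.
  exists (\sum_j D j); first by apply: sumr_ge0 => j _; have [] := HD j.
  move=> j y y0; have [_ h] := HD j; apply: le_trans (h y y0) _.
  rewrite ler_wpM2r ?invr_ge0 ?enorm_ge0// (bigD1 j)//= lerDl.
  by apply: sumr_ge0 => k _; have [] := HD k.
apply: (@slip_C1 _ _ (fun=> 1) _ (C + 2 * D)) => [||y y0|y c j y0 yc].
- by rewrite addr_ge0// mulr_ge0.
- exact: C1_partial_hext1.
- by rewrite mulr1; apply: le_trans (HC _ y0) _; rewrite lerDl mulr_ge0.
- have yp : 0 < enorm y by rewrite enorm_gt0.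
  have c0 : c != 0 by rewrite -enorm_gt0; apply: lt_le_trans yc; rewrite divr_gt0.
  apply: le_trans (HD _ _ c0) _; rewrite mulr1.
  apply: (@le_trans _ _ (D * (2 / enorm y))).
    rewrite ler_wpM2l// -[2 / _]invrK lef_pV2 ?posrE ?enorm_gt0 ?invr_gt0 ?divr_gt0//.
    by rewrite invf_div.
  rewrite mulrCA mulrA ler_wpM2r ?invr_ge0 ?(ltW yp)//.
  by rewrite lerDr.
Qed.

Lemma slip_hext1 : slip id U.
Proof.
have [C C0 HC] := homog0_bounded (fun t y t0 _ => hext0_scale u y t0)
  (fun y y0 => C1_cont C1g y0).
have H i : exists D, 0 <= D /\ forall y, y != 0 -> `|partial i U y| <= D.
  have [D D0 [b _]] := slip_partial_hext1 i; exists D; split => // y y0.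
  by rewrite -[D]mulr1; exact: b.
have [D HD] := choice H.
apply: (@slip_C1 _ _ id _ (C + \sum_j D j)) => [||y y0|y c j y0 yc].
- by rewrite addr_ge0// sumr_ge0// => j _; have [] := HD j.
- exact: C1_hext1.
- rewrite hext1E normrM ger0_norm ?enorm_ge0// mulrC ler_wpM2r ?enorm_ge0//.
  apply: le_trans (HC _ y0) _; rewrite lerDl.
  by apply: sumr_ge0 => j _; have [] := HD j.
- have yp : 0 < enorm y by rewrite enorm_gt0.
  have c0 : c != 0 by rewrite -enorm_gt0; apply: lt_le_trans yc; rewrite divr_gt0.
  rewrite -mulrA divff ?gt_eqF// mulr1.
  have [_ h] := HD j; apply: le_trans (h c c0) _.
  rewrite (bigD1 j)//= addrCA lerDl addr_ge0//.
  by apply: sumr_ge0 => k _; have [] := HD k.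
Qed.

Let euler_g (y : 'rV[R]_p.+1) : y != 0 -> \sum_i y ord0 i * partial i g y = 0.
Proof.
move=> y0; rewrite -derive_C1//.
have yp : 0 < enorm y by rewrite enorm_gt0.
have : is_derive y y g 0; last by case.
apply/is_derive_growth_rate; apply: cvg_near_cst; apply/near0_dnbhsP.
exists 1 => // h /andP[_ h1]; rewrite /growth_rate.
have -> : y + h *: y = (1 + h) *: y by rewrite scalerDl scale1r.
rewrite hext0_scale ?subrr ?mulr0//.
by move: h1; rewrite ltr_norml => /andP[]; lra.
Qed.

(** On the sphere, with [U = |y| g], the sum of the [U_ii] is [(p+1) g - g + 2 <x, grad g>] plus the
    Laplacian of [g]. Euler's relation for degree 0 kills the middle term, and likewise the term
    [<x, grad g>] that [sphere_div] produces. *)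
Let laplacian_sphere (x : 'rV[R]_p.+1) : usphere x -> \sum_i partial i (partial i U) x = f x.
Proof.
move=> x1; have x0 := usphere_neq0 x1; have ex : enorm x = 1 := x1.
rewrite -u_sol// /laplace_beltrami /sphere_div.
have e1 i : partial i (hext 0 (fun z => sphere_grad u z ord0 i)) x =
    x ord0 i * partial i g x + partial i (partial i g) x.
  (* The gradient of [g] has degree -1, so its extension by degree 0, used in [sphere_div], is [|y|]
     times it. *)
  have Dg (y : 'rV[R]_p.+1) (y0 : y != 0) : hext 0 (fun z => sphere_grad u z ord0 i) y = enorm y * partial i g y.
    have yp : 0 < enorm y by rewrite enorm_gt0.
    rewrite /hext expr0z mul1r /sphere_grad mxE.
    have H (z : 'rV[R]_p.+1) : z != 0 -> g ((enorm y)^-1 *: z) = 1 * g z.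
      by move=> z0; rewrite mul1r hext0_scale// invr_gt0.
    have iy : 0 < (enorm y)^-1 by rewrite invr_gt0.
    have [_ e] := isd_homog iy H y0 (C1_is_derive i C1g y0).
    by rewrite [LHS]e invrK mul1r.
  have D := isdM (isd_enorm (delta_mx ord0 i) x0) (C1_is_derive i (C1dg i) x0).
  have [_ e] := isd_ext_off0 (fun z z0 => esym (Dg z z0)) x0 D.
  by rewrite [LHS]e ex divr1 mul1r dotpC dotp_delta.
rewrite [X in _ = X + _](eq_bigr _ (fun i _ => e1 i)) big_split/= (euler_g x0) add0r.
have e2 i : partial i (partial i U) x =
   g x - x ord0 i * x ord0 i * g x + 2 * (x ord0 i * partial i g x) + partial i (partial i g) x.
  have D1 := isdM (isd_dotp (delta_mx ord0 i) x (delta_mx ord0 i)) (isdV (isd_enorm (delta_mx ord0 i) x0) (_ : enorm x != 0)).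
  have D2 := isdM (D1 _) (C1_is_derive i C1g x0).
  have D3 := isdM (isd_enorm (delta_mx ord0 i) x0) (C1_is_derive i (C1dg i) x0).
  have [|_ e] := isd_ext_off0 (fun z z0 => esym (@dU i z z0)) x0 (isdD (D2 _) D3).
    by rewrite ex oner_eq0.
  rewrite [LHS]e ex !dotp_delta !(dotpC _ x) !dotp_delta mxE !eqxx /= expr1n invr1.
  by ring.
transitivity (\sum_i (g x - x ord0 i * x ord0 i * g x +
    2 * (x ord0 i * partial i g x) + partial i (partial i g) x)).
  by apply: eq_bigr => i _; exact: e2.
have s2 : \sum_i 2 * (x ord0 i * partial i g x) = 0.
  by rewrite -mulr_sumr euler_g// mulr0.
have s1 : \sum_(i < p.+1) g x = p.+1%:R * g x.
  by rewrite sumr_const card_ord [RHS]mulr_natl.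
have s3 : \sum_i x ord0 i * x ord0 i * g x = g x.
  by rewrite -mulr_suml -/(dotp x x) -sqr_enorm ex expr1n mul1r.
rewrite !big_split/= s2 addr0 addrC; congr (_ + _).
rewrite sumrN s3 s1 -(hext_sphere 0 u x1) -natr1; ring.
Qed.

Lemma laplacian_hext1 (y : 'rV[R]_p.+1) : y != 0 -> \sum_i partial i (partial i U) y = hext (-1) f y.
Proof.
move=> y0; have yp : 0 < enorm y by rewrite enorm_gt0.
have x1 := normalize_sphere y0.
rewrite -[in RHS](normalizeK y0) hextN1_scale// (hext_sphere _ _ x1) -laplacian_sphere//.
rewrite mulr_sumr; apply: eq_bigr => i _.
rewrite -[in LHS](normalizeK y0) partial2_hext1_scale//.
exact: usphere_neq0.
Qed.

Definition dir_derive (v y : 'rV[R]_p.+1) : R := \sum_i v ord0 i * partial i U y.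

Definition dir_derive2 (v y : 'rV[R]_p.+1) : R :=
  \sum_i v ord0 i * \sum_j v ord0 j * partial j (partial i U) y.

Lemma isd_hext1 v y : y != 0 -> is_derive y v U (dir_derive v y).
Proof. by move=> y0; apply: is_derive_C1 => //; exact: C1_hext1. Qed.

Lemma isd_dir_derive v y : y != 0 -> is_derive y v (dir_derive v) (dir_derive2 v y).
Proof.
move=> y0; apply: isd_sum => i; apply: isdZ.
by apply: is_derive_C1 => //; exact: C1_partial_hext1.
Qed.

Lemma slip_dir_derive v : slip (fun=> 1) (dir_derive v).
Proof.
have : forall n (h : 'I_n -> 'I_p.+1), slip (fun=> 1)
    (fun y => \sum_(i < n) v ord0 (h i) * partial (h i) U y).
  elim=> [|n IH] h.
    have -> : (fun y => \sum_(i < 0) v ord0 (h i) * partial (h i) U y) = (fun y => 0 * 0).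
      by apply: funext => y; rewrite big_ord0 mul0r.
    apply: slipZ; exists 0 => //; split=> [y _|y z _ _]; first by rewrite normr0 mul0r.
    by rewrite subrr normr0 !mul0r.
  have -> : (fun y => \sum_(i < n.+1) v ord0 (h i) * partial (h i) U y) =
      (fun y => v ord0 (h ord0) * partial (h ord0) U y +
        \sum_(i < n) v ord0 (h (lift ord0 i)) * partial (h (lift ord0 i)) U y).
    by apply: funext => y; rewrite big_ord_recl.
  by apply: slipD; [apply: slipZ; exact: slip_partial_hext1|exact: (IH (fun i => h (lift ord0 i)))].
by move=> /(_ _ id).
Qed.

Lemma dir_derive2_cont v y : y != 0 -> {for y, continuous (dir_derive2 v)}.
Proof.
move=> y0; apply: cont_sum => i; apply: contM; first exact: cont_cst.
apply: cont_sum => j; apply: contM; first exact: cont_cst.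
by have [] := C1_partial_hext1 i j y0.
Qed.

Lemma dir_derive2_scale v t y : 0 < t -> y != 0 ->
  dir_derive2 v (t *: y) = t^-1 * dir_derive2 v y.
Proof.
move=> t0 y0; rewrite /dir_derive2 mulr_sumr; apply: eq_bigr => i _.
rewrite [RHS]mulrCA; congr (_ * _); rewrite mulr_sumr; apply: eq_bigr => j _.
by rewrite partial2_hext1_scale// mulrCA.
Qed.

Lemma dir_derive2_bounded v : exists2 C, 0 <= C &
  forall y, y != 0 -> `|dir_derive2 v y| <= C / enorm y.
Proof.
have [||C C0 H] := @homog0_bounded R p.+1 (fun y => enorm y * dir_derive2 v y).
- move=> t y t0 y0; rewrite dir_derive2_scale// enormZ gtr0_norm//.
  by field; rewrite gt_eqF.
- move=> y y0; apply: contM; first exact: continuous_enorm.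
  exact: dir_derive2_cont.
exists C => // y y0; have yp : 0 < enorm y by rewrite enorm_gt0.
rewrite ler_pdivlMr// mulrC -[X in X * _](ger0_norm (ltW yp)) -normrM.
exact: H.
Qed.

Lemma euler_partial i (y : 'rV[R]_p.+1) : y != 0 -> \sum_j y ord0 j * partial j (partial i U) y = 0.
Proof.
move=> y0; rewrite -derive_C1//; last exact: C1_partial_hext1.
have : is_derive y y (partial i U) 0; last by case.
apply/is_derive_growth_rate; apply: cvg_near_cst; apply/near0_dnbhsP.
exists 1 => // h /andP[_ h1]; rewrite /growth_rate.
have -> : y + h *: y = (1 + h) *: y by rewrite scalerDl scale1r.
rewrite partial_hext1_scale ?subrr ?mulr0//.
by move: h1; rewrite ltr_norml => /andP[]; lra.
Qed.

(** The radial direction contracted with the other index of the Hessian. Symmetry of mixed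
    derivatives is avoided: Euler's relation [sum_i z_i U_i = U] is differentiated in direction [j],
    and [U_j] cancels on both sides. *)
Lemma euler_partial' j (y : 'rV[R]_p.+1) : y != 0 -> \sum_i y ord0 i * partial j (partial i U) y = 0.
Proof.
move=> y0.
have E (z : 'rV[R]_p.+1) : z != 0 -> \sum_i z ord0 i * partial i U z = U z.
  move=> z0; rewrite -derive_C1//; last exact: C1_hext1.
  have : is_derive z z U (U z); last by case.
  apply/is_derive_growth_rate; apply: cvg_near_cst; apply/near0_dnbhsP.
  exists 1 => // h /andP[h0 h1]; rewrite /growth_rate.
  have -> : z + h *: z = (1 + h) *: z by rewrite scalerDl scale1r.
  rewrite hext1_scale; last by move: h1; rewrite ltr_norml => /andP[]; lra.
  by field; rewrite -normr_gt0.
have D i : is_derive y (delta_mx ord0 j) (fun z => dotp (delta_mx ord0 i) z * partial i U z)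
    (dotp (delta_mx ord0 i) (delta_mx ord0 j) * partial i U y + dotp (delta_mx ord0 i) y * partial j (partial i U) y).
  by apply: isdM; [exact: isd_dotp|exact: C1_is_derive (C1_partial_hext1 i) y0].
have E' (z : 'rV[R]_p.+1) : z != 0 -> \sum_i dotp (delta_mx ord0 i) z * partial i U z = U z.
  by move=> z0; rewrite -E//; apply: eq_bigr => i _; rewrite dotpC dotp_delta.
have [_ e1] := isd_ext_off0 E' y0 (isd_sum D).
have : partial j U y = \sum_i (dotp (delta_mx ord0 i) (delta_mx ord0 j) * partial i U y + dotp (delta_mx ord0 i) y * partial j (partial i U) y) by exact: e1.
rewrite big_split/= (bigD1 j)//= dotp_delta mxE !eqxx mul1r big1 ?addr0; last first.
  by move=> i ij; rewrite dotp_delta mxE eq_sym (negbTE ij) mul0r.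
move=> H; apply: (addrI (partial j U y)); rewrite addr0 [RHS]H; congr (_ + _).
by apply: eq_bigr => i _; rewrite (dotpC (delta_mx _ _)) dotp_delta.
Qed.

Lemma dir_derive2_tangent a (y v : 'rV[R]_p.+1) : y != 0 ->
  dir_derive2 (a *: y + v) y = dir_derive2 v y.
Proof.
move=> y0; rewrite /dir_derive2.
have e i : \sum_j (a *: y + v) ord0 j * partial j (partial i U) y =
    \sum_j v ord0 j * partial j (partial i U) y.
  under eq_bigr do rewrite !mxE mulrDl -mulrA.
  by rewrite big_split/= -mulr_sumr euler_partial// mulr0 add0r.
under eq_bigr do rewrite e mulr_sumr; rewrite exchange_big/=.
under [RHS]eq_bigr do rewrite mulr_sumr; rewrite [RHS]exchange_big/=.
apply: eq_bigr => j _.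
transitivity (a * v ord0 j * (\sum_i y ord0 i * partial j (partial i U) y) +
    \sum_i v ord0 i * (v ord0 j * partial j (partial i U) y)).
  by rewrite mulr_sumr -big_split; apply: eq_bigr => i _; rewrite !mxE /=; ring.
by rewrite euler_partial'// mulr0 add0r.
Qed.

Lemma dir_derive2Z a (y v : 'rV[R]_p.+1) : dir_derive2 (a *: v) y = a ^+ 2 * dir_derive2 v y.
Proof.
rewrite /dir_derive2 mulr_sumr; apply: eq_bigr => i _.
rewrite !mulr_sumr; apply: eq_bigr => j _; rewrite !mxE; ring.
Qed.

End solution.

(** * The integral identity *)

Section kernel_slip.
Context {R : realType} {m : nat}.
Implicit Types (g h : 'rV[R]_m -> R) (k : nat).

Definition decay k (r : R) := ((1 + r) ^+ k)^-1.

Lemma slip_decayS k g : slip (decay k.+1) g -> slip (decay k) g.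
Proof.
apply: (@slip_le _ _ _ _ 1) => // r r0; rewrite mul1r /decay.
have r1 : 0 < 1 + r by rewrite addr_gt0.
rewrite lef_pV2 ?posrE ?(exprn_gt0 _ r1)// exprS ler_peMl ?exprn_ge0 ?(ltW r1)//.
by rewrite lerDl ltW.
Qed.

(** Each factor of linear growth costs one order of decay. *)
Lemma slip_decay_lin k l g : slip (fun r => 1 + r) l -> slip (decay k.+1) g ->
  slip (decay k) (fun y => l y * g y).
Proof.
move=> sl sg; apply: (@slip_le _ _ _ _ 1) (slipM sl sg) => // r r0.
rewrite mul1r /decay exprS invfM mulrA divff ?mul1r//.
by rewrite gt_eqF// addr_gt0.
Qed.

Lemma slip_cst (c : R) : slip (fun r => 1 + r) (fun _ : 'rV[R]_m => c).
Proof.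
exists `|c|; first exact: normr_ge0.
split=> [y y0|y z y0 _]; first by rewrite ler_peMr// lerDl enorm_ge0.
by rewrite subrr normr0 !mulr_ge0// ?addr_ge0 ?divr_ge0 ?enorm_ge0 ?invr_ge0 ?enorm_ge0.
Qed.

Lemma slip_dotp w : slip (fun r => 1 + r) (@dotp R m w).
Proof.
exists (enorm w); first exact: enorm_ge0.
split=> [y y0|y z y0 _].
  apply: le_trans (dotp_le _ _) _; rewrite ler_wpM2l ?enorm_ge0//.
  by rewrite lerDr.
rewrite -dotpBr; apply: le_trans (dotp_le _ _) _; rewrite -mulrA ler_wpM2l ?enorm_ge0//.
rewrite mulrCA ler_peMr ?enorm_ge0// ler_pdivlMr ?enorm_gt0// mul1r.
by rewrite lerDr.
Qed.

Lemma slip_coordB (x : 'rV[R]_m) i : slip (fun r => 1 + r) (fun y => (y - x) ord0 i).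
Proof.
have := slipD (slip_dotp (delta_mx ord0 i)) (slip_cst (- x ord0 i)).
rewrite (_ : (fun y => _ + _) = fun y => (y - x) ord0 i)//.
by apply: funext => y; rewrite dotpC dotp_delta !mxE.
Qed.

Lemma slip_sigX a x k : 0 < a -> slip (decay k.+1) (fun y => @sig R m a x y ^+ k.+1).
Proof.
move=> a0; have := slipX k (slip_sig x a0).
apply: (@slip_le _ _ _ _ 1) => // r r0; rewrite mul1r /decay exprVn; exact: lexx.
Qed.

Lemma isd_sigX a x (y v : 'rV[R]_m) k : 0 < a ->
  is_derive y v (fun y => sig a x y ^+ k) (- k%:R * dotp v (y - x) * sig a x y ^+ k.+2).
Proof.
move=> a0; have s0 : Num.sqrt (dotp (y - x) (y - x) + a) != 0.
  by rewrite gt_eqF// sqrtr_gt0 ltr_wpDl// dotp_ge0.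
have := isdX k (isdV (isd_sig_base x y v a0) s0); apply: isd_eq.
rewrite -/(sig a x y) -exprVn -/(sig a x y).
case: k => [|k] /=; first by rewrite !(mul0r, oppr0).
rewrite [sig a x y ^+ k.+3]exprS [sig a x y ^+ k.+2]exprS [sig a x y ^+ k.+1]exprS; ring.
Qed.

End kernel_slip.

Section hextN1_derivable.
Context {R : realType} {p : nat}.
Variables (f : 'rV[R]_p.+1 -> R) (xi : 'rV[R]_p.+1).
Hypotheses (p2 : (2 <= p)%N) (f_lip : lipschitz_sphere f) (xi0 : xi != 0).

(** [F] decays too slowly for [slip_div]. Multiplication by a smooth positive kernel of decay [p]
    brings it to order [W0], and division by that kernel brings derivability back. *)
Lemma aerv_derivable_hextN1 : aerv (fun y => derivable (hext (-1) f) y xi).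
Proof.
pose s := @sig R p.+1 1 0.
have s0 k y : s y ^+ k != 0 by rewrite expf_neq0// gt_eqF// sig_gt0.
have sl k : (0 < k)%N -> slip (decay k) (fun y => s y ^+ k).
  by case: k => // k _; exact: slip_sigX.
have ss := sl p (ltnW p2).
have [|dG _ _] := @slip_div _ _ (fun y => s y ^+ p * hext (-1) f y) xi p2 xi0.
  apply: (@slip_le _ _ _ _ 1) (slipM ss (slip_hextN1 f_lip)) => // r r0.
  by rewrite mul1r /decay /W0 mulrC lexx.
apply: aervS dG => y dy.
have E z : (s z ^+ p)^-1 * (s z ^+ p * hext (-1) f z) = hext (-1) f z.
  by rewrite mulrA mulVf ?mul1r.
have [dd _] := isd_ext E (isdM (isdV (isd_sigX 0 y xi p (@ltr01 R)) (s0 p y)) (derivableP dy)).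
exact: dd.
Qed.

End hextN1_derivable.

(** * Integration by parts for a fixed parameter a *)

Section kernel_identity.
Context {R : realType} {p : nat}.
Variables (f u : 'rV[R]_p.+1 -> R).
Hypotheses (p2 : (2 <= p)%N) (f_lip : lipschitz_sphere f).
Hypotheses (u_C2 : C2_sphere u) (u_sol : forall x : 'rV[R]_p.+1, usphere x ->
       laplace_beltrami u x + p%:R * u x = f x).
Variables (x xi : 'rV[R]_p.+1).
Hypotheses (xi1 : usphere xi) (xix : dotp xi x = 0).

Local Notation U := (hext 1 u).
Local Notation F := (hext (-1) f).
Local Notation N := (p.+1%:R : R).

Section fixed_a.
Variable a : R.
Hypothesis a0 : 0 < a.

Local Notation s := (sig a x).
Local Notation l := (dotp xi).

(** The derivatives are explicit, with [l (y - x) = l y] already used. Their decay orders [p],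
    [p+1], [p+2] are exactly those that bring the products with [F], [U_i] and [U] within [W0]. *)
Let H (y : 'rV[R]_p.+1) : R := l y * s y ^+ p.+1.
Let Hxi (y : 'rV[R]_p.+1) : R := s y ^+ p.+1 + (- N) * (l y * (l y * s y ^+ p.+3)).
Let Hxii i (y : 'rV[R]_p.+1) : R := (- N) * ((y - x) ord0 i * s y ^+ p.+3)
  + (- (2 * N) * xi ord0 i) * (l y * s y ^+ p.+3)
  + (N * (N + 2)) * (l y * (l y * ((y - x) ord0 i * s y ^+ p.+4.+1))).
Let Phi (y : 'rV[R]_p.+1) : R := (N * a) * s y ^+ p.+3.
Let Phixi (y : 'rV[R]_p.+1) : R := (- (N * (N + 2) * a)) * (l y * s y ^+ p.+4.+1).

Let xi0 : xi != 0. Proof. exact: usphere_neq0. Qed.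

Let lB y : l (y - x) = l y. Proof. by rewrite dotpBr xix subr0. Qed.

Let lxi : l xi = 1.
Proof. by rewrite -sqr_enorm (xi1 : enorm xi = 1) expr1n. Qed.

Let sl_l : slip (fun r => 1 + r) l := slip_dotp xi.

Let slip_H : slip (decay p) H.
Proof. by apply: slip_decay_lin => //; exact: slip_sigX. Qed.

Let slip_Hxi : slip (decay p.+1) Hxi.
Proof.
apply: slipD; first exact: slip_sigX.
by apply: slipZ; do 2 apply: slip_decay_lin => //; exact: slip_sigX.
Qed.

Let slip_Hxii i : slip (decay p.+2) (Hxii i).
Proof.
have sz := slip_coordB x i.
apply: slipD; [apply: slipD|]; apply: slipZ.
- by apply: slip_decay_lin => //; exact: slip_sigX.
- by apply: slip_decay_lin => //; exact: slip_sigX.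
- by do 3 apply: slip_decay_lin => //; exact: slip_sigX.
Qed.

Let slip_Phi : slip (decay p.+3) Phi.
Proof. by apply: slipZ; exact: slip_sigX. Qed.

Let slip_Phixi : slip (decay p.+4) Phixi.
Proof. by apply: slipZ; apply: slip_decay_lin => //; exact: slip_sigX. Qed.

Let slip_prodF (h : 'rV[R]_p.+1 -> R) : slip (decay p) h -> slip (@W0 R p) (fun y => h y * F y).
Proof.
move=> sh; apply: (@slip_le _ _ _ _ 1) (slipM sh (slip_hextN1 f_lip)) => // r r0.
by rewrite mul1r /decay /W0 mulrC lexx.
Qed.

Let decay_W0 r : 0 < r -> decay p.+1 r <= @W0 R p r.
Proof.
move=> r0; have r1 : 0 < 1 + r by rewrite addr_gt0.
rewrite /decay /W0 exprS invfM ler_wpM2r ?invr_ge0 ?exprn_ge0 ?(ltW r1)//.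
by rewrite lef_pV2 ?posrE// lerDr.
Qed.

Let slip_prod1 (h g : 'rV[R]_p.+1 -> R) : slip (decay p.+1) h -> slip (fun=> 1) g -> slip (@W0 R p) (fun y => h y * g y).
Proof.
move=> sh sg; apply: (@slip_le _ _ _ _ 1) (slipM sh sg) => // r r0.
by rewrite mul1r mulr1 decay_W0.
Qed.

Let slip_prodU (h : 'rV[R]_p.+1 -> R) : slip (decay p.+2) h -> slip (@W0 R p) (fun y => h y * U y).
Proof.
move=> sh; apply: (@slip_le _ _ _ _ 1) (slipM sh (slip_hext1 u_C2)) => // r r0.
have r1 : 0 < 1 + r by rewrite addr_gt0.
rewrite mul1r /decay /W0 !exprS.
rewrite [leLHS](_ : _ = (r / ((1 + r) * (1 + r))) * ((1 + r) ^+ p)^-1); last first.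
  by field; rewrite !gt_eqF// exprn_gt0.
rewrite ler_wpM2r ?invr_ge0 ?exprn_ge0 ?(ltW r1)//.
rewrite ler_pdivrMr ?mulr_gt0// ler_pdivlMl//.
by apply: ler_pM; rewrite ?(ltW r0)// lerDr.
Qed.

Let isd_l (y v : 'rV[R]_p.+1) : is_derive y v l (l v) := isd_dotp xi y v.
Let isd_s (k : nat) (y v : 'rV[R]_p.+1) : is_derive y v (fun y => s y ^+ k)
  (- k%:R * dotp v (y - x) * s y ^+ k.+2) := isd_sigX x y v k a0.

Let isd_z i (y v : 'rV[R]_p.+1) : is_derive y v (fun y => (y - x) ord0 i) (v ord0 i).
Proof.
have := isdB (isd_dotp (delta_mx ord0 i) y v) (isd_cst y v (x ord0 i)).
rewrite subr0 dotpC dotp_delta; apply: isd_ext => z.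
by rewrite dotpC dotp_delta !mxE.
Qed.

Let dH y : is_derive y xi H (Hxi y).
Proof.
apply: isd_eq (isdM (isd_l y xi) (isd_s p.+1 y xi)).
by rewrite lxi lB /Hxi; ring.
Qed.

Let de (i : 'I_p.+1) (w : 'rV[R]_p.+1) : dotp (delta_mx ord0 i) w = w ord0 i.
Proof. by rewrite dotpC dotp_delta. Qed.

Let dHxi i y : is_derive y (delta_mx ord0 i) Hxi (Hxii i y).
Proof.
have D1 := isdM (isd_l y (delta_mx ord0 i)) (isdM (isd_l y (delta_mx ord0 i)) (isd_s p.+3 y (delta_mx ord0 i))).
apply: isd_eq (isdD (isd_s p.+1 y (delta_mx ord0 i)) (isdZ D1 (- N))).
rewrite /Hxii dotp_delta de.
have -> : p.+3%:R = N + 2 by rewrite -natrD addn2.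
set z := (y - x) ord0 i.
by ring.
Qed.

Let dHxii i (y : 'rV[R]_p.+1) : R := (- N) * (s y ^+ p.+3 + (y - x) ord0 i * (- (N + 2) * (y - x) ord0 i * s y ^+ p.+4.+1))
  + (- (2 * N) * xi ord0 i) * (xi ord0 i * s y ^+ p.+3 + l y * (- (N + 2) * (y - x) ord0 i * s y ^+ p.+4.+1))
  + (N * (N + 2)) * (2 * xi ord0 i * (l y * ((y - x) ord0 i * s y ^+ p.+4.+1))
     + l y * (l y * (s y ^+ p.+4.+1 + (y - x) ord0 i * (- (N + 4) * (y - x) ord0 i * s y ^+ p.+4.+3)))).

Let ddHxii i y : is_derive y (delta_mx ord0 i) (Hxii i) (dHxii i y).
Proof.
have Z := isd_z i y (delta_mx ord0 i).
have L := isd_l y (delta_mx ord0 i).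
have S3 := isd_s p.+3 y (delta_mx ord0 i); have S5 := isd_s p.+4.+1 y (delta_mx ord0 i).
have D := isdD (isdD (isdZ (isdM Z S3) (- N)) (isdZ (isdM L S3) (- (2 * N) * xi ord0 i)))
   (isdZ (isdM L (isdM L (isdM Z S5))) (N * (N + 2))).
apply: isd_eq D.
rewrite /dHxii dotp_delta de mxE !eqxx /=.
have -> : p.+3%:R = N + 2 by rewrite -natrD addn2.
have -> : p.+4.+1%:R = N + 4 by rewrite -natrD addn4.
set z := (y - x) ord0 i.
by ring.
Qed.

Let dPhi y : is_derive y xi Phi (Phixi y).
Proof.
apply: isd_eq (isdZ (isd_s p.+3 y xi) (N * a)).
rewrite lB /Phixi; have -> : p.+3%:R = N + 2 by rewrite -natrD addn2.
by ring.
Qed.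

Let dPhixi (y : 'rV[R]_p.+1) : R := (- (N * (N + 2) * a)) * (s y ^+ p.+4.+1 + l y * (- (N + 4) * l y * s y ^+ p.+4.+3)).

Let ddPhixi y : is_derive y xi Phixi (dPhixi y).
Proof.
apply: isd_eq (isdZ (isdM (isd_l y xi) (isd_s p.+4.+1 y xi)) (- (N * (N + 2) * a))).
rewrite lxi lB /dPhixi; have -> : p.+4.+1%:R = N + 4 by rewrite -natrD addn4.
by ring.
Qed.

(* |y - x|^2 = s^-2 - a, which is what makes div H_xi equal to Phi_xixi *)
Let divH y : \sum_i dHxii i y = dPhixi y.
Proof.
pose z i := (y - x) ord0 i.
have zz k : (\sum_i z i * z i) * s y ^+ k.+2 = s y ^+ k - a * s y ^+ k.+2.
  rewrite -/(dotp (y - x) (y - x)).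
  have := sig_sqr x y a0; set q := dotp (y - x) (y - x) => e.
  have qa : q + a != 0 by rewrite gt_eqF// ltr_wpDl// dotp_ge0.
  by rewrite -addn2 exprD e; field.
have lz : \sum_i xi ord0 i * z i = l y by rewrite -lB.
have ll : \sum_i xi ord0 i * xi ord0 i = 1 by rewrite -lxi.
have s1 : \sum_(i < p.+1) (1 : R) = N by rewrite sumr_const card_ord.
set s3 := s y ^+ p.+3; set s5 := s y ^+ p.+4.+1; set s7 := s y ^+ p.+4.+3.
have [L LE] : exists L, l y = L by exists (l y).
(* The summands are grouped by what depends on [i]: the sums of [1], [z_i^2], [xi_i^2] and
   [xi_i z_i] are [N], [|y - x|^2], [1] and [l y]. *)
transitivity ((- N * s3 + N * (N + 2) * L * L * s5) * (\sum_(i < p.+1) (1 : R))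
  + (N * (N + 2) * s5 - N * (N + 2) * (N + 4) * L * L * s7) * (\sum_i z i * z i)
  + (- (2 * N) * s3) * (\sum_i xi ord0 i * xi ord0 i)
  + (2 * N * (N + 2) * L * s5 + 2 * N * (N + 2) * L * s5) * (\sum_i xi ord0 i * z i)).
  rewrite !mulr_sumr -!big_split /=; apply: eq_bigr => i _.
  by rewrite /dHxii LE -/(z i) -/s3 -/s5 -/s7; ring.
have z5 : (\sum_i z i * z i) * s5 = s3 - a * s5 by exact: zz.
have z7 : (\sum_i z i * z i) * s7 = s5 - a * s7 by exact: zz.
rewrite s1 ll lz /dPhixi LE -/s5 -/s7.
have -> : (N * (N + 2) * s5 - N * (N + 2) * (N + 4) * L * L * s7) * (\sum_i z i * z i) =
  N * (N + 2) * (s3 - a * s5) - N * (N + 2) * (N + 4) * L * L * (s5 - a * s7).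
  by rewrite -z5 -z7; ring.
by ring.
Qed.

Let aF := aerv_derivable_hextN1 p2 f_lip xi0.

Lemma kernel_identity :
  [/\ integ (fun y => l y * s y ^+ p.+1 * 'D_xi F y),
      integ (fun y => (N * a) * s y ^+ p.+3 * dir_derive2 u xi y) &
      Int (fun y => l y * s y ^+ p.+1 * 'D_xi F y) =
      - Int (fun y => (N * a) * s y ^+ p.+3 * dir_derive2 u xi y)].
Proof.
have n0 : aerv (fun y : 'rV[R]_p.+1 => y != 0) by exact: aerv_neq.
have mH k : mrv (fun y => s y ^+ k).
  by apply: mrv_continuous => y y0; apply: contX; exact: slip_cont (slip_sig x a0) y0.
have ml : mrv l by apply: mrv_continuous => y _; exact: continuous_dotpr.
have i1 : integ (fun y => H y * 'D_xi F y).
  have [C C0 [b _]] := slip_H.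
  have [D D0 bD] := slip_derive_bound xi0 (slip_hextN1 f_lip).
  apply: (@integ_ae_le _ _ _ (fun y => C * D * weight y)); last 1 first.
  - apply: aervS (aerv_and n0 aF) => y [y0 dy].
    have yp : 0 < enorm y by rewrite enorm_gt0.
    rewrite normrM; apply: (@le_trans _ _ (C * decay p (enorm y) * (D * ((enorm y)^-1 / enorm y)))).
      by apply: ler_pM => //; [exact: b|exact: bD].
    rewrite [leLHS](_ : _ = C * D * (@W0 R p (enorm y) / enorm y)); last by rewrite /W0 /decay; ring.
    by rewrite ler_wpM2l ?mulr_ge0// W0_weight.
  - apply: mrvM; first by apply: mrvM => //; exact: mH.
    by apply: measurable_derive => // y y0; exact: slip_cont (slip_hextN1 f_lip) y0.
  - exact: integZ integ_weight.
have i2 : integ (fun y => Phi y * dir_derive2 u xi y).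
  have [C C0 [b _]] := slip_decayS (slip_decayS slip_Phi).
  have [D D0 bD] := dir_derive2_bounded u_C2 xi.
  apply: (@integ_ae_le _ _ _ (fun y => C * D * weight y)); last 1 first.
  - apply: aervS n0 => y y0.
    have yp : 0 < enorm y by rewrite enorm_gt0.
    rewrite normrM; apply: (@le_trans _ _ (C * decay p.+1 (enorm y) * (D / enorm y))).
      by apply: ler_pM => //; [exact: b|exact: bD].
    rewrite [leLHS](_ : _ = C * D * (decay p.+1 (enorm y) / enorm y)); last by ring.
    rewrite ler_wpM2l ?mulr_ge0//; apply: le_trans (W0_weight p2 y0).
    by rewrite ler_wpM2r ?invr_ge0 ?enorm_ge0// decay_W0.
  - apply: mrvM; first by apply: mrvM; [exact: mrv_cst|exact: mH].
    by apply: mrv_continuous => y y0; exact: dir_derive2_cont.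
  - exact: integZ integ_weight.
split => //.
have CU := C1_hext1 u_C2; have CUi := C1_partial_hext1 u_C2.
have e0 (i : 'I_p.+1) : delta_mx ord0 i != 0 :> 'rV[R]_p.+1.
  by apply/eqP => /rowP/(_ i); rewrite !mxE !eqxx => /eqP; rewrite oner_eq0.
have sUi := slip_partial_hext1 u_C2.
have [_ j1 z1] := slip_div p2 xi0 (slip_prodF slip_H).
have T2 i := slip_div p2 (e0 i) (slip_prod1 slip_Hxi (sUi i)).
have T3 i := slip_div p2 (e0 i) (slip_prodU (slip_Hxii i)).
have [_ j4 z4] := slip_div p2 xi0 (slip_prod1 (slip_decayS (slip_decayS slip_Phi)) (slip_dir_derive u_C2 xi)).
have [_ j5 z5] := slip_div p2 xi0 (slip_prodU (slip_decayS (slip_decayS slip_Phixi))).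
have [j2 z2] := @integ_sum R p.+1 p.+1 (fun i => 'D_(delta_mx ord0 i) (fun y => Hxi y * partial i U y))
  (fun i => let: And3 _ h _ := T2 i in h).
have [j3 z3] := @integ_sum R p.+1 p.+1 (fun i => 'D_(delta_mx ord0 i) (fun y => Hxii i y * U y))
  (fun i => let: And3 _ h _ := T3 i in h).
rewrite big1 in z2; last by move=> i _; have [_ _] := T2 i.
rewrite big1 in z3; last by move=> i _; have [_ _] := T3 i.
(* Each term has integral 0. Expanded, the terms in [H_xi F] cancel because the Laplacian of [U] is
   [F], those in [U] by [divH], and those in [U_i] and [U_xi] in pairs; what remains is
   [H F_xi + Phi U_xixi]. *)
pose tot (y : 'rV[R]_p.+1) := 'D_xi (fun y => H y * F y) y - \sum_i 'D_(delta_mx ord0 i) (fun y => Hxi y * partial i U y) y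
   + \sum_i 'D_(delta_mx ord0 i) (fun y => Hxii i y * U y) y
   + 'D_xi (fun y => Phi y * dir_derive u xi y) y - 'D_xi (fun y => Phixi y * U y) y.
have q1 := integB j1 j2; have q2 := integD q1 j3; have q3 := integD q2 j4.
have jt : integ tot by exact: integB q3 j5.
have zt : Int tot = 0.
  apply: etrans (IntB q3 j5) _; rewrite (IntD q2 j4) (IntD q1 j3) (IntB j1 j2).
  by rewrite z1 z2 z3 z4 z5 subrr !addr0 subrr.
have i12 := integD i1 i2.
have [] := @integ_ae_eq _ _ _ tot (integ_mrv i12) (integ_mrv jt) _ i12; last first.
  by move=> _; rewrite zt IntD// => /eqP; rewrite eq_sym addr_eq0 => /eqP.
apply: aervS (aerv_and n0 aF) => y [y0 dy].
have [_ t1] := isdM (dH y) (derivableP dy).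
have t2 i : 'D_(delta_mx ord0 i) (fun y => Hxi y * partial i U y) y =
    Hxii i y * partial i U y + Hxi y * partial i (partial i U) y.
  by have [_] := isdM (dHxi i y) (C1_is_derive i (CUi i) y0).
have t3 i : 'D_(delta_mx ord0 i) (fun y => Hxii i y * U y) y =
    dHxii i y * U y + Hxii i y * partial i U y.
  by have [_] := isdM (ddHxii i y) (C1_is_derive i CU y0).
have [_ t4] := isdM (dPhi y) (isd_dir_derive u_C2 xi y0).
have [_ t5] := isdM (ddPhixi y) (isd_hext1 u_C2 xi y0).
rewrite /tot t1 t4 t5.
rewrite (eq_bigr _ (fun i _ => t2 i)) (eq_bigr _ (fun i _ => t3 i)).
rewrite !big_split/= -mulr_suml divH -mulr_sumr (laplacian_hext1 u_C2 u_sol y0).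
by ring.
Qed.

End fixed_a.
End kernel_identity.

(** * Majorants for the limit, and the limiting constant *)

Section majorants.
Context {R : realType} {p : nat}.
Implicit Types (x y z : 'rV[R]_p.+1).

Lemma sig_le m (a : R) (x y : 'rV[R]_m) : 0 < a -> y != x -> sig a x y <= (enorm (y - x))^-1.
Proof.
move=> a0 yx; have e0 : 0 < enorm (y - x) by rewrite enorm_gt0 subr_eq0.
rewrite /sig lef_pV2 ?posrE//; last by rewrite sqrtr_gt0 ltr_wpDl// dotp_ge0.
by rewrite /enorm ler_wsqrtr// lerDl ltW.
Qed.

Lemma sig_cvg m (e_ : nat -> R) (x y : 'rV[R]_m) : e_ k @[k --> \oo] --> (0 : R) -> y != x ->
  sig (e_ k) x y @[k --> \oo] --> (enorm (y - x))^-1.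
Proof.
move=> e0 yx; have n0 : 0 < enorm (y - x) by rewrite enorm_gt0 subr_eq0.
have h : dotp (y - x) (y - x) + e_ k @[k --> \oo] --> dotp (y - x) (y - x).
  have := cvgD (cvg_cst (dotp (y - x) (y - x))) e0; rewrite addr0; exact.
rewrite /sig; apply: cvgV; first by rewrite gt_eqF.
exact: (cvg_comp _ _ h (@sqrt_continuous R _)).
Qed.

Lemma cvgXn (h : nat -> R) (l : R) n : h k @[k --> \oo] --> l -> h k ^+ n @[k --> \oo] --> l ^+ n.
Proof.
move=> hl; elim: n => [|n IH]; first by rewrite expr0; exact: cvg_cst.
have -> : (fun k => h k ^+ n.+1) = (fun k => h k * h k ^+ n) by apply: funext => k; rewrite exprS.
by rewrite exprS; exact: cvgM hl IH.
Qed.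

(** The singularities at 0 and [x] are at distance 1. If [|y - x| >= 1/2] then
    [1 + |y| <= 5 |y - x|], which gives the term [5^p]; otherwise [1 + |y - x| <= 3 |y|], which
    gives [9 = 3^2]. *)
Lemma weight_dom x : (2 <= p)%N -> usphere x -> exists2 K, 0 <= K &
  forall y, y != 0 -> y != x ->
  (enorm y ^+ 2)^-1 * (enorm (y - x) ^+ p)^-1 <= K * (weight y + weight (y - x)).
Proof.
move=> p2 x1; have ex : enorm x = 1 := x1.
exists (5 ^+ p + 9); first by rewrite addr_ge0// exprn_ge0.
move=> y y0 yx.
have yp : 0 < enorm y by rewrite enorm_gt0.
have dp : 0 < enorm (y - x) by rewrite enorm_gt0 subr_eq0.
have w1 := weight_ge0 y; have w2 := weight_ge0 (y - x).
have t1 := enormB_le y x; have t2 := enormD (y - x) x; have t3 := enormB_le x y.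
rewrite subrK ex in t2; rewrite ex in t1; rewrite ex enorm_dist in t3.
set r := enorm y in yp t1 t2 t3 *; set d := enorm (y - x) in dp t1 t2 t3 *.
have [d2|d2] := leP (1 / 2) d.
  apply: (@le_trans _ _ (5 ^+ p * weight y)); last first.
    by have := exprn_ge0 p (ler0n R 5); nra.
  apply: (@le_trans _ _ (5 ^+ p * (W0 r / r))).
    rewrite /W0.
    have r5 : 0 < (1 + r) ^+ p by rewrite exprn_gt0// addr_gt0.
    have d5 : 0 < d ^+ p by rewrite exprn_gt0.
    rewrite [leRHS](_ : _ = (r ^+ 2)^-1 * (5 ^+ p / (1 + r) ^+ p)); last first.
      by rewrite expr2 invfM; set A := 5 ^+ p; ring.
    rewrite ler_wpM2l ?invr_ge0 ?exprn_ge0 ?(ltW yp)//.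
    rewrite -[leRHS]invrK lef_pV2 ?posrE ?invr_gt0 ?divr_gt0 ?exprn_gt0 ?(addr_gt0 ltr01 yp)//.
    rewrite invf_div ler_pdivrMr ?exprn_gt0// -exprMn lerXn2r ?nnegrE ?addr_ge0 ?mulr_ge0 ?(ltW yp) ?(ltW dp)//.
    by move: d2 t2; lra.
  apply: ler_wpM2l; first by rewrite exprn_ge0.
  exact: W0_weight.
apply: (@le_trans _ _ (9 * weight (y - x))); last first.
  by have := exprn_ge0 p (ler0n R 5); nra.
rewrite /weight -/d [leLHS]mulrC [leRHS]mulrCA ler_wpM2l ?invr_ge0 ?exprn_ge0 ?(ltW dp)//.
rewrite -[leRHS]invrK lef_pV2 ?posrE ?invr_gt0 ?divr_gt0 ?exprn_gt0 ?addr_gt0//.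
rewrite invf_div ler_pdivrMr// -[9](_ : 3 ^+ 2 = _); last by ring.
rewrite -exprMn lerXn2r ?nnegrE ?addr_ge0 ?mulr_ge0 ?(ltW yp) ?(ltW dp)//.
by move: d2 t3; lra.
Qed.

Lemma integ_weightB x : integ (fun y => weight (y - x)).
Proof.
have [+ _] := @integ_affine R p.+1 _ 1 (- x) ltr01 integ_weight.
by rewrite (_ : (fun y => weight (1 *: y - x)) = (fun y => weight (y - x)))//; apply: funext => y; rewrite scale1r.
Qed.

(** The total mass of [a s^(p+3)], the same for every [a > 0] by scaling: this kernel is [mass]
    times an approximate identity at [x]. *)
Definition mass : R := Int (fun z : 'rV[R]_p.+1 => sig 1 0 z ^+ p.+3).

Lemma integ_sigX (a : R) x : 0 < a -> integ (fun z : 'rV[R]_p.+1 => sig a x z ^+ p.+3).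
Proof.
move=> a0; have [C C0 [b _]] := slip_decayS (slip_sigX x p.+2 a0).
apply: (@integ_ae_le _ _ _ (fun y => C * weight y)).
- apply: mrv_continuous => y y0; apply: contX.
  exact: slip_cont (slip_sig x a0) y0.
- exact: integZ integ_weight.
- apply: aervS (@aerv_neq R p.+1 0 isT) => y y0; apply: le_trans (b _ y0) _.
  by rewrite ler_wpM2l// le_weight.
Qed.

Lemma mrvBx (g : 'rV[R]_p.+1 -> R) x : mrv g -> mrv (fun y => g (y - x)).
Proof.
move=> mg; have mphi := @measurable_tuple_affine R p.+1 1 (vr (- x)).
have := measurableT_comp mg mphi; rewrite (_ : _ \o _ = (fun t => g (rv t - x)))//.
by apply: funext => t; rewrite /= -[vr (- x)]/(vr (- x)) rv_affine scale1r.
Qed.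

Lemma mass_gt0 : 0 < mass.
Proof.
(* [c] bounds the integrand from below on the cube [[-1, 1]^(p+1)], where [|z| <= p+1] by
   [enorm_le_norm]. *)
pose c : R := (Num.sqrt (p.+1%:R ^+ 2 + 1))^-1 ^+ p.+3.
have c0 : 0 < c by rewrite exprn_gt0// invr_gt0 sqrtr_gt0 ltr_wpDl// sqr_ge0.
have pos z : 0 <= sig 1 0 z ^+ p.+3 by rewrite exprn_ge0// ltW// sig_gt0.
have lb : ((c * 2 ^+ p.+1)%:E <= \int[leb p.+1]_t (sig 1 0 (rv t) ^+ p.+3)%:E)%E.
  have mc : measurable_fun setT (fun t => (\1_(@cube R p.+1 1) t)%:E : \bar R).
    by apply/measurable_EFinP; apply: measurable_indic; exact: measurable_cube.
  have -> : ((c * 2 ^+ p.+1)%:E = \int[leb p.+1]_t (c%:E * (\1_(@cube R p.+1 1) t)%:E))%E.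
    rewrite ge0_integralZl//; last by rewrite lee_fin ltW.
    by rewrite integral_cube// mulr1 EFinM.
  apply: ge0_le_integral => //.
  - by move=> t _; rewrite mule_ge0 ?lee_fin// ltW.
  - exact: measurable_funeM.
  - by apply/measurable_EFinP; exact: (integ_mrv (integ_sigX 0 ltr01)).
  - move=> t _; rewrite -EFinM lee_fin indicE.
    have [tc|] := boolP (t \in _); last by rewrite mulr0.
    rewrite mulr1 /c lerXn2r ?nnegrE ?invr_ge0 ?sqrtr_ge0//.
    rewrite lef_pV2 ?posrE ?sqrtr_gt0 ?ltr_wpDl ?dotp_ge0 ?sqr_ge0//.
    rewrite ler_wsqrtr// lerD2r -sqr_enorm subr0 lerXn2r ?nnegrE ?enorm_ge0//.
    apply: le_trans (enorm_le_norm _) _; rewrite ler_piMr//.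
    rewrite [leLHS]/Num.norm/= mx_normrE.
    apply: bigmax_le => // -[i j] _ /=; rewrite (ord1 i) mxE.
    have := set_mem tc j; rewrite /= in_itv/= ler_norml; exact.
have i1 := integrable_fin_num measurableT (integ_sigX (0 : 'rV[R]_p.+1) (@ltr01 R)).
rewrite -(fineK i1) lee_fin in lb.
by apply: lt_le_trans lb; rewrite mulr_gt0// exprn_gt0.
Qed.

End majorants.

(** * Passage to the limit in the identity *)

Section integral_kernel.
Context {R : realType} {p : nat}.
Variables (f u : 'rV[R]_p.+1 -> R).
Hypotheses (p2 : (2 <= p)%N) (f_lip : lipschitz_sphere f).
Hypotheses (u_C2 : C2_sphere u) (u_sol : forall x : 'rV[R]_p.+1, usphere x ->
       laplace_beltrami u x + p%:R * u x = f x).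
Variables (x xi : 'rV[R]_p.+1).
Hypotheses (x1 : usphere x) (xi1 : usphere xi) (xix : dotp xi x = 0).

Local Notation F := (hext (-1) f).
Local Notation N := (p.+1%:R : R).
Local Notation l := (dotp xi).
Local Notation V := (dir_derive2 u xi).

(** The parameter is [a = eps^2], so that the substitution dilates by [eps] itself. *)
Let eps (k : nat) : R := k.+1%:R^-1.
Let s k := sig (eps k ^+ 2) x.

Let eps0 k : 0 < eps k. Proof. by rewrite invr_gt0. Qed.
Let eps1 k : eps k <= 1. Proof. by rewrite invf_le1// ler1n. Qed.
Let eps_cvg : eps k @[k --> \oo] --> (0 : R).
Proof. exact: cvg_harmonic. Qed.
Let eps2_cvg : eps k ^+ 2 @[k --> \oo] --> (0 : R).
Proof. by have := cvgXn (n := 2) eps_cvg; rewrite expr0n. Qed.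
Let e20 k : 0 < eps k ^+ 2. Proof. by rewrite exprn_gt0. Qed.
Let x0 : x != 0. Proof. exact: usphere_neq0. Qed.
Let xi0 : xi != 0. Proof. exact: usphere_neq0. Qed.
Let ex : enorm x = 1. Proof. exact: x1. Qed.

Let lB y : l (y - x) = l y. Proof. by rewrite dotpBr xix subr0. Qed.

Let off (y : 'rV[R]_p.+1) := y != 0 /\ y != x.
Let off_ae : aerv off.
Proof. by apply: aerv_and; exact: aerv_neq. Qed.

Let h (y : 'rV[R]_p.+1) := l y * (enorm (y - x) ^+ p.+1)^-1 * 'D_xi F y.

Let mh : mrv h.
Proof.
apply: mrvM; last by apply: measurable_derive => // y y0; exact: slip_cont (slip_hextN1 f_lip) y0.
apply: mrvM; first by apply: mrv_continuous => y _; exact: continuous_dotpr.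
apply: (@mrvBx _ _ (fun y => (enorm y ^+ p.+1)^-1)).
apply: mrv_continuous => y y0; apply: contV; last by rewrite expf_neq0// enorm_eq0.
by apply: contX; exact: continuous_enorm.
Qed.

(** Because [xi] is orthogonal to [x], [|l y| <= |y - x|]: one power of the singularity at [x]
    cancels, leaving order [-p] in dimension [p+1]. With [F_xi] of order [-2] this is the product
    bounded by [weight_dom], independently of [k]. *)
Lemma kernel_limit : integ h /\
  (Int (fun y => l y * s k y ^+ p.+1 * 'D_xi F y) @[k --> \oo] --> Int h).
Proof.
have [K K0 bK] := weight_dom p2 x1.
have [D D0 bD] := slip_derive_bound xi0 (slip_hextN1 f_lip).
apply: (@integ_dct _ _ _ _ (fun y => D * (K * (weight y + weight (y - x))))).
- by move=> k; have [i1 _ _] := kernel_identity p2 f_lip u_C2 u_sol xi1 xix (e20 k); exact: integ_mrv i1.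
- exact: mh.
- by do 2 apply: integZ; apply: integD; [exact: integ_weight|exact: integ_weightB].
- apply: aervS off_ae => y [_ yx]; apply: cvgM; last exact: cvg_cst.
  apply: cvgM; first exact: cvg_cst.
  by rewrite -exprVn; apply: cvgXn; exact: sig_cvg.
- move=> k.
  have dF := aerv_derivable_hextN1 p2 f_lip xi0.
  apply: aervS (aerv_and off_ae dF) => y [[y0 yx] dy].
  have d0 : 0 < enorm (y - x) by rewrite enorm_gt0 subr_eq0.
  have s0 : 0 < s k y by exact: sig_gt0.
  have yp : 0 < enorm y by rewrite enorm_gt0.
  apply: (@le_trans _ _ (D * ((enorm y ^+ 2)^-1 * (enorm (y - x) ^+ p)^-1))); last first.
    by rewrite ler_wpM2l// bK.
  rewrite [leRHS](_ : _ = (enorm (y - x) ^+ p)^-1 * (D * ((enorm y)^-1 / enorm y))); last first.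
    by rewrite expr2 invfM; ring.
  rewrite normrM; apply: ler_pM => //; last exact: bD.
  rewrite normrM normrX (ger0_norm (ltW s0)).
  apply: (@le_trans _ _ (enorm (y - x) * (enorm (y - x))^-1 ^+ p.+1)).
    apply: ler_pM => //; rewrite ?exprn_ge0 ?(ltW s0)//.
      by rewrite -lB; apply: le_trans (dotp_le _ _) _; rewrite (xi1 : enorm xi = 1) mul1r.
    by rewrite lerXn2r ?nnegrE ?(ltW s0) ?invr_ge0 ?(ltW d0)//; exact: sig_le.
  by rewrite exprS mulrA divff ?gt_eqF// mul1r exprVn.
Qed.

Let q k y := eps k ^+ 2 * s k y ^+ p.+3.

Let mV : mrv V.
Proof. by apply: mrv_continuous => y y0; exact: dir_derive2_cont. Qed.

Let menorm : mrv (fun y : 'rV[R]_p.+1 => enorm y).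
Proof. by apply: mrv_continuous => y _; exact: continuous_enorm. Qed.

Let integ_q k : integ (q k).
Proof. by apply: integZ; exact: integ_sigX. Qed.

(** [V1] is bounded and agrees with [V] at [x], so it survives the substitution. [V2] vanishes at
    [x] to first order and contributes nothing to the limit. *)
Let V1 y := V y * enorm y.
Let V2 y := V y * (1 - enorm y).

Let V1_bounded : exists2 C, 0 <= C & forall y, y != 0 -> `|V1 y| <= C.
Proof.
have [C C0 bC] := dir_derive2_bounded u_C2 xi; exists C => // y y0.
rewrite normrM (ger0_norm (enorm_ge0 _)) -ler_pdivlMr ?enorm_gt0//; exact: bC.
Qed.

Let mV1 : mrv V1. Proof. exact: mrvM. Qed.

Let integ_qV1 k : integ (fun y => q k y * V1 y).
Proof.
have [C C0 bC] := V1_bounded.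
apply: (@integ_ae_le _ _ _ (fun y => C * `|q k y|)).
- by apply: mrvM => //; exact: integ_mrv (integ_q k).
- apply: integZ; exact: integrable_norm (integ_q k).
- apply: aervS (@aerv_neq R p.+1 0 isT) => y y0.
  by rewrite normrM mulrC ler_wpM2r// bC.
Qed.

Let sig_scale k z : s k (eps k *: z + x) = (eps k)^-1 * sig 1 0 z.
Proof.
rewrite /s /sig addrK subr0 dotpZl dotpZr mulrA -expr2.
rewrite -{2}[eps k ^+ 2]mulr1 -mulrDr sqrtrM ?exprn_ge0 ?(ltW (eps0 k))//.
by rewrite sqrtr_sqr ger0_norm ?(ltW (eps0 k))// invfM.
Qed.

Let IntqV1 k : integ (fun z => sig 1 0 z ^+ p.+3 * V1 (eps k *: z + x)) /\
  Int (fun y => q k y * V1 y) = Int (fun z => sig 1 0 z ^+ p.+3 * V1 (eps k *: z + x)).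
Proof.
have e0 : eps k != 0 by rewrite gt_eqF.
have [i1 I1] := integ_affine x (eps0 k) (integ_qV1 k).
have E : (fun z => sig 1 0 z ^+ p.+3 * V1 (eps k *: z + x)) =
    (fun z => eps k ^+ p.+1 * (q k (eps k *: z + x) * V1 (eps k *: z + x))).
  apply: funext => z; rewrite /q sig_scale.
  rewrite exprMn [(eps k)^-1 ^+ _]exprVn.
  (* The Jacobian [eps^(p+1)], the factor [a = eps^2] and the scaling of [s^(p+3)] compensate
     exactly. *)
  have E3 : eps k ^+ p.+1 * (eps k ^+ 2 * (eps k ^+ p.+3)^-1) = 1.
    by rewrite mulrA -exprD addn2 divff// expf_neq0.
  by rewrite -[LHS]mul1r -[X in X * _ = _]E3; ring.
rewrite E; split; first exact: integZ.
by rewrite IntZ// I1 mulrA mulfV ?mul1r// expf_neq0.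
Qed.

Let V1_cont : {for x, continuous V1}.
Proof. by apply: contM; [exact: dir_derive2_cont|exact: continuous_enorm]. Qed.

Let V1_limit : Int (fun y => q k y * V1 y) @[k --> \oo] --> @mass R p * V x.
Proof.
have [C C0 bC] := V1_bounded.
under eq_fun do rewrite (IntqV1 _).2.
have [] := @integ_dct _ _ (fun k z => sig 1 0 z ^+ p.+3 * V1 (eps k *: z + x))
   (fun z => V1 x * sig 1 0 z ^+ p.+3) (fun z => C * sig 1 0 z ^+ p.+3).
- by move=> k; exact: integ_mrv (IntqV1 k).1.
- by apply: mrvM; [exact: mrv_cst|exact: integ_mrv (integ_sigX _ ltr01)].
- by apply: integZ; exact: integ_sigX.
- apply: aervW => z; rewrite [V1 x * _]mulrC; apply: cvgM; first exact: cvg_cst.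
  have c : eps k *: z + x @[k --> \oo] --> 0 *: z + x.
    by apply: cvgD; [exact: (cvgZr_tmp (a := z) eps_cvg)|exact: cvg_cst].
  rewrite scale0r add0r in c.
  exact: (cvg_comp _ _ c V1_cont).
- move=> k; apply: aervS (@aerv_neq R p.+1 (- ((eps k)^-1 *: x)) isT) => z zn.
  rewrite normrM mulrC normrX (ger0_norm (ltW (sig_gt0 _ _ ltr01))) ler_wpM2r//.
    by rewrite exprn_ge0// ltW// sig_gt0.
  apply: bC; apply: contra zn; rewrite addr_eq0 => /eqP e.
  by rewrite -scalerN -e scalerA mulVf ?scale1r// gt_eqF.
- have VE : V1 x = V x by rewrite /V1 ex mulr1.
  move=> _; rewrite (IntZ (V1 x) (integ_sigX (0 : 'rV[R]_p.+1) (@ltr01 R))) -/(@mass R p) VE.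
  by rewrite [V x * _]mulrC.
Qed.

Let V2_limit : (forall k, integ (fun y => q k y * V2 y)) /\
  (Int (fun y => q k y * V2 y) @[k --> \oo] --> (0 : R)).
Proof.
have [C C0 bC] := dir_derive2_bounded u_C2 xi.
have [K K0 bK] := weight_dom p2 x1.
have iw : integ (fun y : 'rV[R]_p.+1 => (4 * C) * (K * (weight y + weight (y - x)))).
  by do 2 apply: integZ; apply: integD; [exact: integ_weight|exact: integ_weightB].
have mq k : mrv (fun y => q k y * V2 y).
  apply: mrvM; first exact: integ_mrv (integ_q k).
  by apply: mrvM => //; apply: mrvB => //; exact: mrv_cst.
have bq k : aerv (fun y => `|q k y * V2 y| <= (4 * C) * (K * (weight y + weight (y - x)))).
  apply: aervS off_ae => y [y0 yx].
  have d0 : 0 < enorm (y - x) by rewrite enorm_gt0 subr_eq0.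
  have s0 : 0 < s k y by exact: sig_gt0.
  have yp : 0 < enorm y by rewrite enorm_gt0.
  have sl : s k y <= (enorm (y - x))^-1 by exact: sig_le.
  (* Here [eps^2 s^2 = e / (d^2 + e)] with [e <= 1]; this bound, uniform in [k], supplies the decay
     at infinity that [s^(p+1)] alone lacks. *)
  have s2 : eps k ^+ 2 * s k y ^+ 2 <= 4 / (1 + enorm (y - x)) ^+ 2.
    rewrite ler_pdivlMr ?exprn_gt0 ?addr_gt0// /s sig_sqr// -sqr_enorm.
    have e1 : eps k ^+ 2 <= 1 by rewrite exprn_ile1// ltW.
    have e0 := e20 k.
    set d := enorm (y - x) in d0 *; set e := eps k ^+ 2 in e0 e1 *.
    rewrite mulrAC ler_pdivrMr ?ltr_wpDl ?sqr_ge0//.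
    have h1 := sqr_ge0 (d - 1); have h2 := sqr_ge0 d.
    have : e * d ^+ 2 <= d ^+ 2 by rewrite ler_piMl.
    have : 0 <= e * (d - 1) ^+ 2 by rewrite mulr_ge0// ltW.
    by rewrite !expr2; lra.
  have q0 : 0 <= q k y := mulr_ge0 (exprn_ge0 2 (ltW (eps0 k))) (exprn_ge0 p.+3 (ltW s0)).
  rewrite normrM (ger0_norm q0) normrM.
  have n1 : `|1 - enorm y| <= enorm (y - x) by rewrite -ex distrC enormB_dist.
  (* The factor [|1 - |y|| <= |y - x|] in [V2] cancels one inverse power of [|y - x|], so order [-p]
     remains at [x]. *)
  apply: (@le_trans _ _ ((4 / (1 + enorm (y - x)) ^+ 2 * ((enorm (y - x))^-1 ^+ p * (enorm (y - x))^-1)) * (C / enorm y * enorm (y - x)))).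
    apply: ler_pM => //.
      rewrite /q (_ : s k y ^+ p.+3 = s k y ^+ 2 * (s k y ^+ p * s k y)); last by rewrite -exprSr -exprD.
      rewrite mulrA; apply: ler_pM; rewrite ?mulr_ge0 ?exprn_ge0 ?(ltW s0) ?(ltW (eps0 k))//.
      apply: ler_pM; rewrite ?exprn_ge0 ?(ltW s0)//.
      by rewrite lerXn2r ?nnegrE ?(ltW s0) ?invr_ge0 ?(ltW d0).
    by apply: ler_pM => //; exact: bC.
  rewrite exprVn.
  rewrite [leLHS](_ : _ = 4 * C * (((enorm y) * (1 + enorm (y - x)) ^+ 2)^-1 * (enorm (y - x) ^+ p)^-1)); last first.
    by field; rewrite !gt_eqF ?exprn_gt0 ?addr_gt0.
  rewrite ler_wpM2l ?mulr_ge0//; apply: le_trans (bK _ y0 yx).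
  rewrite ler_wpM2r ?invr_ge0 ?exprn_ge0 ?(ltW d0)//.
  rewrite lef_pV2 ?posrE ?mulr_gt0 ?exprn_gt0 ?addr_gt0// expr2 ler_wpM2l ?(ltW yp)//.
  have := enormD (y - x) x; rewrite subrK ex => t; nra.
split=> [k|]; first exact: (@integ_ae_le _ _ _ _ (mq k) iw (bq k)).
rewrite -[X in _ --> X](@Int0 R p.+1).
have [||] := @integ_dct _ _ (fun k y => q k y * V2 y) (fun=> 0) _ mq _ iw _ bq => //; first exact: mrv_cst.
apply: aervS off_ae => y [y0 yx].
have c := cvgM (cvgM eps2_cvg (cvgXn (n := p.+3) (sig_cvg eps2_cvg yx))) (cvg_cst (V2 y)).
by move: c; rewrite !mul0r; exact.
Qed.

Lemma integral_kernel : integral_Rn (fun y : 'rV[R]_p.+1 =>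
   (- dotp xi y * 'D_xi (hext (- 1) f) y) / enorm (x - y) ^+ p.+1) = (N * @mass R p * V x)%:E.
Proof.
have [ih ch] := kernel_limit; have [i2 c2] := V2_limit.
have E k : Int (fun y => l y * s k y ^+ p.+1 * 'D_xi F y) =
    - (N * (Int (fun y => q k y * V1 y) + Int (fun y => q k y * V2 y))).
  have [_ _ ->] := kernel_identity p2 f_lip u_C2 u_sol xi1 xix (e20 k).
  rewrite -IntD// -IntZ; last exact: integD.
  congr (- Int _); apply: funext => y; rewrite /q /V1 /V2 /s; ring.
have c : Int (fun y => l y * s k y ^+ p.+1 * 'D_xi F y) @[k --> \oo] -->
    - (N * (@mass R p * V x + 0)).
  rewrite (funext E).
  by apply: cvgN; apply: cvgM; [exact: cvg_cst|exact: cvgD].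
have Ih : Int h = - (N * @mass R p * V x).
  by rewrite -mulrA -[@mass R p * _]addr0; exact: (cvg_unique _ ch c).
have hE : (fun y : 'rV[R]_p.+1 => (- dotp xi y * 'D_xi (hext (- 1) f) y) / enorm (x - y) ^+ p.+1) = (fun y => - h y).
  by apply: funext => y; rewrite /h (enorm_dist x); ring.
by rewrite hE integral_RnE ?IntN ?Ih ?opprK//; exact: integN.
Qed.

End integral_kernel.

(** * Convexity and second derivatives *)

Section convexity.
Context {R : realType}.

Lemma convex_functionE m (U : 'rV[R]_m -> R) : convex_function [set: 'rV[R]_m] U <->
  forall (y z : 'rV[R]_m) (t : R), 0 <= t <= 1 ->
    U (t *: y + (1 - t) *: z) <= t * U y + (1 - t) * U z.
Proof.
split=> [H y z t /andP[t0 t1]|H t y z _ _].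
  by have := H (Itv01 t0 t1) y z (mem_setT _) (mem_setT _).
have t01 : 0 <= t%:num <= 1 by rewrite ge0 le1.
exact: (H y z t%:num t01).
Qed.

Lemma mvt_seg m (g dg : 'rV[R]_m -> R) (z v : 'rV[R]_m) (s t : R) : s <= t ->
  (forall c, s <= c <= t -> is_derive (z + c *: v) v g (dg (z + c *: v))) ->
  exists2 c, s <= c <= t & g (z + t *: v) - g (z + s *: v) = (t - s) * dg (z + c *: v).
Proof.
move=> st D.
have E c : z + s *: v + c *: ((t - s) *: v) = z + (s + c * (t - s)) *: v.
  by rewrite scalerA -addrA -scalerDl.
have I c : 0 <= c <= 1 -> s <= s + c * (t - s) <= t.
  by move=> /andP[c0 c1]; apply/andP; split; nra.
have D' c : 0 <= c <= 1 -> is_derive (z + s *: v + c *: ((t - s) *: v)) ((t - s) *: v) g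
    ((t - s) * dg (z + (s + c * (t - s)) *: v)).
  by move=> /I /D /(isd_scale (t - s)); rewrite E.
have [c c01 e] : exists2 c, 0 <= c <= 1 & g (z + s *: v + (t - s) *: v) - g (z + s *: v) =
    'D_((t - s) *: v) g (z + s *: v + c *: ((t - s) *: v)).
  by apply: mvt_line => c /D' [].
exists (s + c * (t - s)); first exact: I.
have [_ <-] := D' c c01; rewrite -e; congr (g _ - _).
by rewrite -addrA -scalerDl subrKC.
Qed.

(** Four points [-t, 0, t, 2t] are used rather than three: the gap [[0, t]] between the outer
    intervals makes [c1 - c2 >= t > 0], so the sign of [A c1 - A c2] passes to [B]. *)
Lemma midpoint_convex_mvt (ph A B : R -> R) (t : R) : 0 < t ->
  (forall a b, a <= b -> exists2 c, a <= c <= b & ph b - ph a = (b - a) * A c) ->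
  (forall a b, a <= b -> exists2 c, a <= c <= b & A b - A a = (b - a) * B c) ->
  (forall a b, ph ((a + b) / 2) <= (ph a + ph b) / 2) ->
  exists2 c, `|c| <= 2 * t & 0 <= B c.
Proof.
move=> t0 phA AB mid.
have [|c1 /andP[c10 c11] E1] := phA t (2 * t); first by lra.
have [|c2 /andP[c20 c21] E2] := phA (- t) 0; first by lra.
have [|c3 /andP[c30 c31] E3] := AB c2 c1; first by lra.
exists c3; first by rewrite ler_norml; apply/andP; split; lra.
have m1 := mid 0 (2 * t); have m2 := mid (- t) t.
rewrite add0r (_ : 2 * t / 2 = t) in m1; last by field.
rewrite addNr mul0r in m2.
have : 0 <= t * (A c1 - A c2) by lra.
rewrite pmulr_rge0// E3 pmulr_rge0//; lra.
Qed.

(** [t ph 1 + (1 - t) ph 0 - ph t] is [t (1 - t)] times the mean slope on [[t, 1]] minus that on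
    [[0, t]]. All points stay in [[0, 1]], the only part of the line known to miss the origin when
    this is applied. *)
Lemma convex_mvt (ph A B : R -> R) (t : R) : 0 <= t <= 1 ->
  (forall a b, 0 <= a -> a <= b -> b <= 1 -> exists2 c, a <= c <= b & ph b - ph a = (b - a) * A c) ->
  (forall a b, 0 <= a -> a <= b -> b <= 1 -> exists2 c, a <= c <= b & A b - A a = (b - a) * B c) ->
  (forall c, 0 <= c <= 1 -> 0 <= B c) ->
  ph t <= t * ph 1 + (1 - t) * ph 0.
Proof.
move=> /andP[t0 t1] phA AB B0.
have [c1 /andP[c10 c11] E1] := phA 0 t (lexx 0) t0 t1.
have [c2 /andP[c20 c21] E2] := phA t 1 t0 t1 (lexx 1).
have [||c3 /andP[c30 c31] E3] := AB c1 c2 c10; [by lra|by lra|].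
have /B0 V3 : 0 <= c3 <= 1 by lra.
have h3 : 0 <= A c2 - A c1 by rewrite E3 mulr_ge0//; lra.
have h4 : 0 <= t * (1 - t) * (A c2 - A c1) by rewrite mulr_ge0// mulr_ge0//; lra.
have h5 : (1 - t) * (ph t - ph 0) = (1 - t) * ((t - 0) * A c1) by rewrite E1.
have h6 : t * (ph 1 - ph t) = t * ((1 - t) * A c2) by rewrite E2.
lra.
Qed.

(** This direction later shifts a segment through the origin off it. A coordinate vector suffices:
    the second one if [v] lies on the first axis, the first one otherwise. *)
Lemma not_collinear m (v : 'rV[R]_m.+2) :
  exists w : 'rV[R]_m.+2, forall c, w + c *: v != 0.
Proof.
pose e i : 'rV[R]_m.+2 := delta_mx ord0 i.
have [H|H] := boolP [forall i, (i != ord0) ==> (v ord0 i == 0)].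
  exists (e (lift ord0 ord0)) => c; apply/eqP => /rowP/(_ (lift ord0 ord0)).
  have /eqP v0 : v ord0 (lift ord0 ord0) == 0 by have /implyP := forallP H (lift ord0 ord0); exact.
  by rewrite !mxE !eqxx v0 mulr0 addr0 => /eqP; rewrite oner_eq0.
have /forallPn[i] := H; rewrite negb_imply => /andP[i0 vi].
exists (e ord0) => c; apply/eqP => E.
have := congr1 (fun w : 'rV[R]_m.+2 => w ord0 ord0) E; rewrite !mxE !eqxx /= => E0.
have := congr1 (fun w : 'rV[R]_m.+2 => w ord0 i) E; rewrite !mxE (negbTE i0) /= add0r.
move=> /eqP; rewrite mulf_eq0 (negbTE vi) orbF => /eqP c0.
by move: E0; rewrite c0 mul0r addr0 => /eqP; rewrite oner_eq0.
Qed.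

Context {p : nat}.
Variable u : 'rV[R]_p.+1 -> R.
Hypotheses (p0 : (0 < p)%N) (u_C2 : C2_sphere u).
Local Notation U := (hext 1 u).
Local Notation V := (dir_derive2 u).

Lemma cont_hext1 y : {for y, continuous U}.
Proof.
have [C C0 [b _]] := slip_hext1 u_C2.
have [->|y0] := eqVneq y 0; last exact: slip_cont (slip_hext1 u_C2) y0.
apply/continuous_enormP => e e0; exists (e / (C + 1)); first by rewrite divr_gt0// ltr_wpDl.
move=> z; rewrite subr0 hext1_0 subr0 => ze.
have [zE|z0] := eqVneq z 0; first by rewrite zE hext1_0 normr0 ltW.
apply: le_trans (b _ z0) _.
move: ze; rewrite ler_pdivlMr ?ltr_wpDl// => ze.
by have := enorm_ge0 z; nra.
Qed.

Lemma convex_second_derivative (x xi : 'rV[R]_p.+1) :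
  (forall t, x + t *: xi != 0) -> convex_function [set: 'rV[R]_p.+1] U -> 0 <= V xi x.
Proof.
move=> n0 /convex_functionE cU; rewrite leNgt; apply/negP => Vn.
have x0 : x != 0 by have := n0 0; rewrite scale0r addr0.
have /continuous_enormP c : {for x, continuous (V xi)} by exact: dir_derive2_cont.
have [|d d0 H] := c (- V xi x / 2); first by rewrite divr_gt0// oppr_gt0.
(* Points with [|s| <= 2 t] are displaced by at most [2 t |xi| <= d/2], hence [V xi] is negative at
   all of them, against [midpoint_convex_mvt]. *)
pose t := d / (4 * (enorm xi + 1)).
have e0 := enorm_ge0 xi.
have t0 : 0 < t by rewrite divr_gt0// mulr_gt0// ltr_wpDl.
have neg s : `|s| <= 2 * t -> V xi (x + s *: xi) < 0.
  move=> st; have : `|V xi (x + s *: xi) - V xi x| <= - V xi x / 2.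
    apply: H; rewrite addrC addKr enormZ.
    apply: (@le_trans _ _ (2 * t * enorm xi)); first by rewrite ler_wpM2r.
    rewrite /t [leLHS](_ : _ = (d / 2) * (enorm xi / (enorm xi + 1))); last first.
      by field; rewrite gt_eqF// ltr_wpDl.
    have : enorm xi / (enorm xi + 1) <= 1 by rewrite ler_pdivrMr ?ltr_wpDl// mul1r lerDl.
    by nra.
  rewrite ler_norml; move: (V xi (x + s *: xi)) (V xi x) Vn => A B Vn /andP[_].
  by lra.
have [|||r rt] := @midpoint_convex_mvt (fun s => U (x + s *: xi))
  (fun s => dir_derive u xi (x + s *: xi)) (fun s => V xi (x + s *: xi)) t t0.
- by move=> a b ab; apply: mvt_seg => // s _; exact: isd_hext1.
- by move=> a b ab; apply: mvt_seg => // s _; exact: isd_dir_derive.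
- move=> a b; have := cU (x + a *: xi) (x + b *: xi) 2^-1.
  rewrite (_ : 2^-1 *: (x + a *: xi) + (1 - 2^-1) *: (x + b *: xi) = x + ((a + b) / 2) *: xi).
    rewrite invr_ge0 invf_le1// ler1n ler0n => /(_ isT).
    by move: (U _) (U _) (U _) => r1 r2 r3; lra.
  by apply/rowP => i; rewrite !mxE; field.
- by rewrite leNgt neg.
Qed.

Hypothesis V_ge0 : forall x xi : 'rV[R]_p.+1, usphere x -> usphere xi -> dotp xi x = 0 -> 0 <= V xi x.

(** The component of [v] along [y] does not affect the Hessian form, and homogeneity in [y] and [v]
    reduces the rest to orthogonal unit vectors. *)
Lemma dir_derive2_ge0 (y v : 'rV[R]_p.+1) : y != 0 -> 0 <= V v y.
Proof.
move=> y0; have yp : 0 < enorm y by rewrite enorm_gt0.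
pose a := dotp v y / enorm y ^+ 2; pose w := v - a *: y.
have wy : dotp w y = 0.
  by rewrite dotpBl dotpZl /a -sqr_enorm divfK ?subrr// expf_neq0// gt_eqF.
rewrite -(subrK (a *: y) v) -/w addrC dir_derive2_tangent//.
have [->|w0] := eqVneq w 0; first by rewrite -(scale0r (0 : 'rV_p.+1)) dir_derive2Z expr0n mul0r.
rewrite -(normalizeK w0) dir_derive2Z mulr_ge0 ?sqr_ge0// -(normalizeK y0) dir_derive2_scale//; last first.
  by rewrite scaler_eq0 negb_or invr_eq0 gt_eqF.
rewrite mulr_ge0 ?invr_ge0 ?(ltW yp)//; apply: V_ge0; [exact: normalize_sphere|exact: normalize_sphere|].
by rewrite dotpZl dotpZr wy !mulr0.
Qed.

Lemma convex_off0 (z v : 'rV[R]_p.+1) t : 0 <= t <= 1 ->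
  (forall s, 0 <= s <= 1 -> z + s *: v != 0) ->
  U (z + t *: v) <= t * U (z + v) + (1 - t) * U z.
Proof.
move=> /andP[t0 t1] n0.
have I a b c : 0 <= a -> b <= 1 -> a <= c <= b -> z + c *: v != 0.
  by move=> a0 b1 /andP[ac cb]; apply: n0; rewrite (le_trans a0 ac) (le_trans cb b1).
have := @convex_mvt (fun s => U (z + s *: v)) (fun s => dir_derive u v (z + s *: v))
  (fun s => V v (z + s *: v)) t; rewrite t0 t1 scale0r scale1r addr0; apply => //.
- move=> a b a0 ab b1; apply: mvt_seg => // c cab; apply: isd_hext1 => //; exact: I cab.
- move=> a b a0 ab b1; apply: mvt_seg => // c cab; apply: isd_dir_derive => //; exact: I cab.
- by move=> c c01; apply: dir_derive2_ge0; exact: n0.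
Qed.

Lemma convex_hext1 : convex_function [set: 'rV[R]_p.+1] U.
Proof.
apply/convex_functionE => y z t t01.
have E (a b : 'rV[R]_p.+1) : t *: a + (1 - t) *: b = b + t *: (a - b).
  by apply/rowP => i; rewrite !mxE; ring.
have [H|] := pselect (forall s, 0 <= s <= 1 -> z + s *: (y - z) != 0).
  by have := convex_off0 t01 H; rewrite -E subrKC.
move=> /existsNP[s0] /not_implyP[_ /negP]; rewrite negbK => /eqP zs.
have [w wn] : exists w : 'rV[R]_p.+1, forall c, w + c *: (y - z) != 0.
  by move: (y - z); case: (p) p0 => // q _ v; exact: not_collinear.
(* [G d] is the gap in the convexity inequality for the segment translated by [d w]; it is
   continuous in [d], and only [d = 0] is critical. *)
pose G (d : R) := t * U (y + d *: w) + (1 - t) * U (z + d *: w) - U (t *: y + (1 - t) *: z + d *: w).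
have G0 d : d != 0 -> 0 <= G d.
  move=> d0; rewrite subr_ge0.
  (* The segment passes through the origin at [s0], so [z = - s0 (y - z)] and each translated point
     is [d] times a point of the line [w + c (y - z)]. *)
  have n0 s : 0 <= s <= 1 -> z + d *: w + s *: (y - z) != 0.
    move=> _; rewrite (_ : _ + _ = d *: (w + (d^-1 * (s - s0)) *: (y - z))).
      by rewrite scaler_eq0 negb_or d0 wn.
    have zE : - (s0 *: (y - z)) = z by apply/eqP; rewrite eq_sym -addr_eq0 zs.
    rewrite [RHS]scalerDr scalerA mulVKf// scalerBl zE.
    by rewrite [_ + z]addrC addrA [_ + z]addrC.
  have := convex_off0 t01 n0.
  rewrite (_ : z + d *: w + (y - z) = y + d *: w); last by apply/rowP => i; rewrite !mxE; ring.
  rewrite (_ : z + d *: w + t *: (y - z) = t *: y + (1 - t) *: z + d *: w)//.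
  by apply/rowP => i; rewrite !mxE; ring.
have cG : G (k.+1%:R^-1) @[k --> \oo] --> G 0.
  have cs (b : 'rV[R]_p.+1) : U (b + k.+1%:R^-1 *: w) @[k --> \oo] --> U (b + 0 *: w).
    have c : b + (k.+1%:R^-1 : R) *: w @[k --> \oo] --> b + 0 *: w.
      by apply: cvgD; [exact: cvg_cst|exact: (cvgZr_tmp (a := w) (@cvg_harmonic R))].
    exact: (cvg_comp _ _ c (@cont_hext1 _)).
  by apply: cvgB => //; apply: cvgD; apply: cvgM => //; exact: cvg_cst.
have : 0 <= G 0.
  rewrite -(cvg_lim _ cG)//; apply: limr_ge; first by apply/cvg_ex; exists (G 0).
  by apply: nearW => k; apply: G0; rewrite invr_neq0.
by rewrite /G !scale0r !addr0 subr_ge0.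
Qed.

End convexity.

Theorem theorem1p1 (R : realType) (n : nat) (hn : (2 <= n)%N)
    (f : 'rV[R]_n.+1 -> R)
    (f_pos : forall x : 'rV[R]_n.+1, usphere x -> 0 < f x)
    (f_lip : lipschitz_sphere f)
    (u : 'rV[R]_n.+1 -> R)
    (u_C2 : C2_sphere u)
    (u_sol : forall x : 'rV[R]_n.+1, usphere x ->
       laplace_beltrami u x + n%:R * u x = f x) :
  convex_function [set: 'rV[R]_n.+1] (hext 1 u) <->
  (forall x xi : 'rV[R]_n.+1, usphere x -> usphere xi -> dotp xi x = 0 ->
     (0 <= integral_Rn (fun y : 'rV[R]_n.+1 =>
        (- dotp xi y * 'D_xi (hext (- 1) f) y) / enorm (x - y) ^+ n.+1)%R)%E).
Proof.
have c0 : 0 < n.+1%:R * @mass R n by rewrite mulr_gt0 ?mass_gt0.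
have IE (x xi : 'rV[R]_n.+1) : usphere x -> usphere xi -> dotp xi x = 0 ->
    (0 <= integral_Rn (fun y : 'rV[R]_n.+1 =>
      (- dotp xi y * 'D_xi (hext (- 1) f) y) / enorm (x - y) ^+ n.+1)%R)%E = (0 <= dir_derive2 u xi x).
  by move=> x1 xi1 xix; rewrite (integral_kernel hn f_lip u_C2 u_sol x1 xi1 xix) lee_fin pmulr_rge0.
split=> [cU x xi x1 xi1 xix|H].
  (* The whole line [x + t xi] misses the origin, because its inner product with [x] is constantly
     1. *)
  rewrite IE//; apply: (convex_second_derivative u_C2 _ cU) => t.
  apply/eqP => /(congr1 (dotp x)); rewrite dotpDr dotpZr [dotp x xi]dotpC xix mulr0 addr0 dotp0r.
  by rewrite -sqr_enorm (x1 : enorm x = 1) expr1n => /eqP; rewrite oner_eq0.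
by apply: convex_hext1 => // [|x xi x1 xi1 xix]; [exact: ltnW|rewrite -IE//; exact: H].
Qed.
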